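(* Let $z_0\in\mathcal H$, $\ell\in\mathcal U(z_0;D(A))$ and let $z$ be the solution of $\dot z\in A(R\ell-Qz)$, $z(0)=z_0$. Let $\{z_{n,0}\}\subset\mathcal H$ and $\ell_n\in\mathcal U(z_{n,0};D(A))$ satisfy $z_{n,0}\to z_0$ in $\mathcal H$, $\ell_n\rightharpoonup\ell$ in $H^1(0,T;\mathcal X)$ and $\ell_n\to\ell$ in $L^1(0,T;\mathcal X)$, and let $z_n\in H^1(0,T;\mathcal H)$ solve $\dot z_n\in A(R\ell_n-Qz_n)$, $z_n(0)=z_{n,0}$. Then $z_n\rightharpoonup z$ in $H^1(0,T;\mathcal H)$ and $z_n\to z$ in $C([0,T];\mathcal H)$. If in addition $\ell_n\to\ell$ in $H^1(0,T;\mathcal X)$, $A=\partial\phi$ for a proper, convex, lower semicontinuous $\phi:\mathcal H\to(-\infty,\infty]$, and $\phi(R\ell_n(0)-Qz_{n,0})\to\phi(R\ell(0)-Qz_0)$, then $z_n\to z$ in $H^1(0,T;\mathcal H)$.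
   Context: Fix $T>0$. $\mathcal X,\mathcal X_c,\mathcal Y,\mathcal Z,\mathcal W$ are real Banach spaces, $\mathcal X_c$ is reflexive and compactly embedded in $\mathcal X$, and $\mathcal H$ is a real separable Hilbert space with continuous embeddings $\mathcal Y\hookrightarrow\mathcal Z\hookrightarrow\mathcal H\hookrightarrow\mathcal W$. $H^1(0,T;\mathcal V)$, $L^p(0,T;\mathcal V)$, $C([0,T];\mathcal V)$ denote Bochner(–Sobolev) spaces and $\dot z$ the time derivative. $A:\mathcal H\to2^{\mathcal H}$ is maximal monotone with closed domain $D(A)$, and its minimal section $A^0:D(A)\to\mathcal H$, $A^0(h)=\operatorname{argmin}_{v\in A(h)}\|v\|_{\mathcal H}$, is bounded on bounded sets. For $\lambda>0$, $R_\lambda=(I+\lambda A)^{-1}$ is the resolvent and $A_\lambda=\lambda^{-1}(I-R_\lambda)$ the Yosida approximation. $R\in L(\mathcal X;\mathcal Y)$ (hence $R\in L(\mathcal X;\mathcal H)$) and $Q\in L(\mathcal W)$ whose restrictions to $\mathcal H,\mathcal Z,\mathcal Y$ map these spaces boundedly into themselves (denoted again $Q$); as an operator on $\mathcal H$, $Q$ is self-adjoint and coercive with constant $\gamma_Q>0$, i.e. $(Qh,h)_{\mathcal H}\ge\gamma_Q\|h\|_{\mathcal H}^2$. Given $z_0\in\mathcal H$ and $\ell\in H^1(0,T;\mathcal X)$, a solution of the state equation $\dot z\in A(R\ell-Qz)$, $z(0)=z_0$, is $z\in H^1(0,T;\mathcal H)$ with $z(0)=z_0$ and $\dot z(t)\in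 A(R\ell(t)-Qz(t))$ for a.e. $t\in(0,T)$; it exists uniquely for $\ell\in\mathcal U(z_0;D(A))$. For $M\subset D(A)$, $\mathcal U(z_0;M)=\{\ell\in H^1(0,T;\mathcal X):R\ell(0)-Qz_0\in M\}$. *)

(* Defs.v *)
From HB Require Import structures.
From mathcomp Require Import all_boot all_order all_algebra.
From mathcomp Require Import all_classical all_reals all_analysis.
Set Implicit Arguments. Unset Strict Implicit. Unset Printing Implicit Defensive.
Import Order.TTheory GRing.Theory Num.Theory.
Import numFieldNormedType.Exports.
Local Open Scope classical_set_scope.
Local Open Scope ring_scope.

Section Defs.
Variable R : realType.
Local Notation mu := (@lebesgue_measure R).

Section Bochner.
Variable V : normedModType R.
Variable T : R.
Local Notation I := (`[0, T]%classic : set R).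

Definition simple_fun (s : R -> V) : Prop :=
  finite_set (range s) /\ forall v : V, measurable (s @^-1` [set v]).

Definition strongly_meas (f : R -> V) : Prop :=
  exists s : nat -> R -> V, (forall k, simple_fun (s k)) /\
    {ae mu, forall t, I t -> (fun k => s k t) @ \oo --> f t}.

Definition Lp_int (p : nat) (f : R -> V) : \bar R :=
  (\int[mu]_(t in I) ((`|f t| ^+ p)%:E))%E.

Definition cont_lin_functional (f : V -> R) : Prop :=
  (forall (a : R) (x y : V), f (a *: x + y) = a * f x + f y) /\ continuous f.

(* z belongs to H^1(0,T;V) with (weak = a.e.) derivative v :
   v is strongly measurable and square integrable, and
   z(t) - z(s) = \int_s^t v  (Bochner integral, tested against every
   continuous linear functional) for all 0 <= s <= t <= T. *)
Definition H1_with_deriv (z v : R -> V) : Prop :=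
  strongly_meas v /\ strongly_meas z /\
  (Lp_int 2 z < +oo)%E /\ (Lp_int 2 v < +oo)%E /\
  forall f : V -> R, cont_lin_functional f ->
    forall s t, I s -> I t -> s <= t ->
      ((f (z t) - f (z s))%:E = \int[mu]_(r in `[s, t]) ((f (v r))%:E))%E.

Definition inH1 (z : R -> V) : Prop := exists v, H1_with_deriv z v.

Definition H1_normsq (z v : R -> V) : R := fine (adde (Lp_int 2 z) (Lp_int 2 v)).

Definition H1_dual (F : (R -> V) -> R) : Prop :=
  (forall (a : R) (u w : R -> V), inH1 u -> inH1 w ->
      F (fun t => a *: u t + w t) = a * F u + F w) /\
  exists C : R, forall u v, H1_with_deriv u v ->
      `|F u| <= C * Num.sqrt (H1_normsq u v).

Definition H1_weak_cvg (u : nat -> R -> V) (w : R -> V) : Prop :=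
  forall F, H1_dual F -> (fun n => F (u n)) @ \oo --> F w.

Definition H1_strong_cvg (u : nat -> R -> V) (w : R -> V) : Prop :=
  exists (du : nat -> R -> V) (dw : R -> V),
    (forall n, H1_with_deriv (u n) (du n)) /\ H1_with_deriv w dw /\
    (fun n => adde (Lp_int 2 (fun t => u n t - w t)) (Lp_int 2 (fun t => du n t - dw t)))
      @ \oo --> (0 : \bar R).

Definition L1_cvg (u : nat -> R -> V) (w : R -> V) : Prop :=
  (fun n => Lp_int 1 (fun t => u n t - w t)) @ \oo --> (0 : \bar R).

Definition C_cvg (u : nat -> R -> V) (w : R -> V) : Prop :=
  forall eps : R, 0 < eps ->
    \forall n \near \oo, forall t, I t -> `|u n t - w t| < eps.
End Bochner.

Section Hilbert.
Variable H : completeNormedModType R.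

Definition inner_product (ip : H -> H -> R) : Prop :=
  (forall x y, ip x y = ip y x) /\
  (forall (a : R) x y z, ip (a *: x + y) z = a * ip x z + ip y z) /\
  (forall x, ip x x = `|x| ^+ 2).

Definition separable_space : Prop :=
  exists s : nat -> H, closure (range s) = setT.

Definition domain (A : H -> set H) : set H := [set h | exists u, A h u].

Definition monotone_op (ip : H -> H -> R) (A : H -> set H) : Prop :=
  forall x y u v, A x u -> A y v -> 0 <= ip (u - v) (x - y).

Definition maximal_monotone (ip : H -> H -> R) (A : H -> set H) : Prop :=
  monotone_op ip A /\
  forall B : H -> set H, monotone_op ip B ->
    (forall x u, A x u -> B x u) -> B = A.

Definition min_section_bounded (A : H -> set H) : Prop :=
  forall r : R, exists C : R, forall h, domain A h -> `|h| <= r ->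
    exists u, [/\ A h u, (forall w, A h w -> `|u| <= `|w|) & `|u| <= C].

Definition linear_cont (V W : normedModType R) (f : V -> W) : Prop :=
  (forall (a : R) x y, f (a *: x + y) = a *: f x + f y) /\ continuous f.

Definition proper_fun (phi : H -> \bar R) : Prop :=
  (forall x, phi x != -oo%E) /\ exists x, phi x \is a fin_num.

Definition convex_fun (phi : H -> \bar R) : Prop :=
  forall (l : R) (x y : H), 0 <= l <= 1 ->
    lee (phi (l *: x + (1 - l) *: y)) (adde (mule l%:E (phi x)) (mule (1 - l)%:E (phi y))).

Definition lsc_fun (phi : H -> \bar R) : Prop :=
  forall c : R, closed [set x | (phi x <= c%:E)%E].

Definition is_subdiff (ip : H -> H -> R) (phi : H -> \bar R) (A : H -> set H) : Prop :=
  forall x u, A x u <->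
    (phi x \is a fin_num /\ forall y, lee (adde (phi x) (ip u (y - x))%:E) (phi y)).
End Hilbert.

Section State.
Variables (X : normedModType R) (H : completeNormedModType R).

Definition admissible (T : R) (Rop : X -> H) (Q : H -> H) (M : set H)
    (z0 : H) (l : R -> X) : Prop :=
  inH1 T l /\ M (Rop (l 0) - Q z0).

Definition solves (T : R) (A : H -> set H) (Rop : X -> H) (Q : H -> H)
    (l : R -> X) (z0 : H) (z : R -> H) : Prop :=
  z 0 = z0 /\ exists v : R -> H, H1_with_deriv T z v /\
    {ae mu, forall t, (`]0, T[%classic : set R) t -> A (Rop (l t) - Q (z t)) (v t)}.
End State.
End Defs.

(* Main.v *)
Require Import Defs.
From HB Require Import structures.
From mathcomp Require Import all_boot all_order all_algebra.
From mathcomp Require Import all_classical all_reals all_analysis.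
From mathcomp Require Import measurable_realfun ring lra.
Set Implicit Arguments. Unset Strict Implicit. Unset Printing Implicit Defensive.
Import Order.TTheory GRing.Theory Num.Theory.
Import numFieldNormedType.Exports.
Local Open Scope classical_set_scope.
Local Open Scope ring_scope.

(* Write w = R l - Q z, k_n = R (l_n - l), e_n = z_n - z.  Monotonicity gives
   (Q e_n, e_n') <= (k_n, e_n') a.e.; after an integration by parts this bounds
   e_n uniformly in terms of the H^1 norm of k_n.  Comparing z' with a selection
   of A bounded along w gives (z', w') >= - C |w'|, which by coercivity of Q
   bounds z' in L^2 in terms of l and C.  Hence e_n' is bounded in L^2, and the first
   inequality yields |e_n|^2 <= c (|e_n (0)|^2 + ||k_n||_2 ||e_n'||_2), where
   ||k_n||_2^2 <= sup |k_n| ||k_n||_1 tends to 0: this is uniform convergence.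
   Together with boundedness in H^1 it gives weak convergence.
   If A is the subdifferential of phi, the chain rule turns the integral of
   (z', w') into phi (w (T)) - phi (w (0)).  Expanding the integral of
   (Q e_n', e_n') leaves terms that vanish by weak or strong convergence, and
   phi (w (T)) - phi (w_n (T)), whose upper limit is nonpositive by lower
   semicontinuity.  Coercivity of Q concludes. *)

(** Three obstacles shape the proof. The velocity estimate needs one bound for selections of [A]
    along all trajectories, hence a prior bound on the trajectories themselves; this is why the
    first energy estimate must not involve the velocities. The inclusion holds only almost
    everywhere, while a selection is wanted at every time: closedness of the domain and continuity
    of [w] close this gap. Finally the curves are vector valued, while every integral used is
    scalar: curves are tested with vectors, and separability recovers norms from countably many
    tests. The integration by parts and the chain rule both reduce to [ac_ftc], a fundamental
    theorem for functions whose increments are dominated by an integral. It rests on difference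
    quotients over uniform grids, and the same grids supply the step functions that turn uniform
    convergence into weak convergence. Weak convergence of the loads serves only to bound them in
    H^1; they are first mapped into [H], where an inner product makes the uniform boundedness
    principle elementary. *)

Section IntervalIntegral.
Variable R : realType.
Notation mu := (@lebesgue_measure R).

(** * Integrals of real functions over compact intervals *)

Definition integ (s t : R) (f : R -> R) : Prop :=
  mu.-integrable `[s, t]%classic (EFin \o f).
(** Meaningful only together with [integ]: the real-valued integral takes [fine] of the extended
    one, which sends infinite values to 0. *)
Definition J (s t : R) (f : R -> R) : R := \int[mu]_(x in `[s, t]) f x.

Implicit Types (f g : R -> R) (s t : R).

Lemma aeS (P Q : R -> Prop) : (forall x, P x -> Q x) ->
  {ae mu, forall x, P x} -> {ae mu, forall x, Q x}.
Proof. by move=> PQ; apply: (@filterS _ _ (ae_filter_ringOfSetsType mu)). Qed.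

Lemma aeI (P Q : R -> Prop) :
  {ae mu, forall x, P x} -> {ae mu, forall x, Q x} -> {ae mu, forall x, P x /\ Q x}.
Proof. exact: (@filterI _ _ (ae_filter_ringOfSetsType mu)). Qed.

Lemma integ_meas s t f : integ s t f -> measurable_fun `[s, t]%classic f.
Proof. by move=> /measurable_int /measurable_EFinP. Qed.

Lemma integ_sub a b s t f : a <= s -> t <= b -> integ a b f -> integ s t f.
Proof.
move=> as_ tb; apply: integrableS => //.
by apply: subset_itv; rewrite bnd_simp.
Qed.

Lemma integ_cst s t (c : R) : integ s t (fun=> c).
Proof.
apply: measurable_bounded_integrable => //.
  rewrite /= lebesgue_measure_itv; case: ifP => // _; rewrite -EFinB ltry//.
by exists `|c|; split => // M cM x _ /=; exact: ltW.
Qed.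

Lemma integ_ext s t f g : (forall x, s <= x <= t -> f x = g x) ->
  integ s t f -> integ s t g.
Proof.
move=> fg; apply: eq_integrable => // x; rewrite inE/= in_itv/= => h.
by rewrite fg.
Qed.

Lemma integD s t f g : integ s t f -> integ s t g -> integ s t (fun x => f x + g x).
Proof. by move=> fi gi; apply: (integrableD _ fi gi). Qed.

Lemma integZ s t (c : R) f : integ s t f -> integ s t (fun x => c * f x).
Proof. by move=> fi; apply: (integrableZl _ c fi). Qed.

Lemma integB s t f g : integ s t f -> integ s t g -> integ s t (fun x => f x - g x).
Proof. by move=> fi gi; apply: (integrableB _ fi gi). Qed.

Lemma integ_abs s t f : integ s t f -> integ s t (fun x => `|f x|).
Proof. by move=> fi; apply: integrable_norm. Qed.

Lemma integ_dom s t f g : measurable_fun `[s, t]%classic f ->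
  (forall x, s <= x <= t -> `|f x| <= g x) -> integ s t g -> integ s t f.
Proof.
move=> mf fg; apply: le_integrable => //; first exact/measurable_EFinP.
move=> x /=; rewrite in_itv/= => /fg h; rewrite lee_fin.
by rewrite (le_trans h)// ler_norm.
Qed.

Lemma integ_bounded s t f (M : R) : measurable_fun `[s, t]%classic f ->
  (forall x, s <= x <= t -> `|f x| <= M) -> integ s t f.
Proof. by move=> mf fM; apply: (integ_dom mf fM); exact: integ_cst. Qed.

Lemma J_ext s t f g : (forall x, s <= x <= t -> f x = g x) -> J s t f = J s t g.
Proof.
move=> fg; apply: eq_Rintegral => x; rewrite inE/= in_itv/= => h.
by rewrite fg.
Qed.

Lemma JD s t f g : integ s t f -> integ s t g ->
  J s t (fun x => f x + g x) = J s t f + J s t g.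
Proof. exact: RintegralD. Qed.

Lemma JB s t f g : integ s t f -> integ s t g ->
  J s t (fun x => f x - g x) = J s t f - J s t g.
Proof. exact: RintegralB. Qed.

Lemma JZ s t (c : R) f : integ s t f -> J s t (fun x => c * f x) = c * J s t f.
Proof. exact: RintegralZl. Qed.

Lemma J_cst s t (c : R) : s <= t -> J s t (fun=> c) = c * (t - s).
Proof.
move=> st; rewrite /J Rintegral_cst//= lebesgue_measure_itv/=; congr (_ * _).
case: ifPn => [_|]; first by rewrite -EFinB.
by rewrite lte_fin -leNgt => ts /=; apply/esym/eqP; rewrite subr_eq0 eq_le st ts.
Qed.

Lemma J_ge0 s t f : (forall x, s <= x <= t -> 0 <= f x) -> 0 <= J s t f.
Proof. by move=> f0; apply: Rintegral_ge0 => x /=; rewrite in_itv/=; exact: f0. Qed.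

Lemma J_le s t f g : integ s t f -> integ s t g ->
  (forall x, s <= x <= t -> f x <= g x) -> J s t f <= J s t g.
Proof.
move=> fi gi fg; apply: le_Rintegral => // x /=; rewrite in_itv/=; exact: fg.
Qed.

Lemma J_ext_ae s t f g : integ s t f -> integ s t g ->
  {ae mu, forall x, s <= x <= t -> f x = g x} -> J s t f = J s t g.
Proof.
move=> fi gi fg; congr fine; apply: ae_eq_integral => //.
- exact: measurable_int fi.
- exact: measurable_int gi.
- by apply: aeS fg => x h /=; rewrite in_itv/= => /h ->.
Qed.

Lemma J_ge0_ae s t f : integ s t f ->
  {ae mu, forall x, s <= x <= t -> 0 <= f x} -> 0 <= J s t f.
Proof.
move=> fi f0; rewrite (@J_ext_ae s t f (fun x => `|f x|)) //.
- by apply: J_ge0.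
- exact: integ_abs.
- by apply: aeS f0 => x h /h /ger0_norm ->.
Qed.

Lemma J_le_ae s t f g : integ s t f -> integ s t g ->
  {ae mu, forall x, s <= x <= t -> f x <= g x} -> J s t f <= J s t g.
Proof.
move=> fi gi fg; rewrite -subr_ge0 -JB//; apply: J_ge0_ae; first exact: integB.
by apply: aeS fg => x h /h; rewrite subr_ge0.
Qed.

Lemma J_abs s t f : integ s t f -> `|J s t f| <= J s t (fun x => `|f x|).
Proof. exact: le_normr_Rintegral. Qed.

Lemma J_split a s b f : a <= s -> s <= b -> integ a b f ->
  J a b f = J a s f + J s b f.
Proof.
move=> as_ sb fi; apply/eqP; rewrite addrC -subr_eq; apply/eqP.
rewrite /J Rintegral_itvB ?bnd_simp// Rintegral_itv_obnd_cbnd//.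
apply: integrableS fi => //; apply: subset_itvr; rewrite bnd_simp//.
Qed.

(** The two intervals overlap in [s]. The norm on the union is bounded by the sum of its two
    restrictions; counting [s] twice does no harm in an inequality. *)
Lemma integ_glue a s b f : a <= s -> s <= b -> integ a s f -> integ s b f ->
  integ a b f.
Proof.
move=> as_ sb fi gi.
have mf : measurable_fun `[a, b]%classic (EFin \o f).
  rewrite (@itv_bndbnd_setU _ _ _ (BRight s)) ?bnd_simp//.
  apply/measurable_funU => //; split; first exact: measurable_int fi.
  apply: measurable_funS (measurable_int _ gi) => //.
  by apply: subset_itvr; rewrite bnd_simp.
apply/integrableP; split => //.
have sub : `[a, b]%classic `<=` `[a, s]%classic `|` `[s, b]%classic.
  move=> x /=; rewrite !in_itv/= => /andP[-> ->]; rewrite andbT/=.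
  by apply/orP; exact: le_total.
have mU : measurable_fun (`[a, s]%classic `|` `[s, b]%classic) (abse \o (EFin \o f)).
  apply/measurable_funU => //; split; apply: measurableT_comp => //.
    exact: measurable_int fi.
  exact: measurable_int gi.
apply: le_lt_trans.
  apply: (@ge0_subset_integral _ _ _ mu _ (`[a, s]%classic `|` `[s, b]%classic)) => //.
  exact: measurableU.
apply: le_lt_trans.
  rewrite integral_mkcond.
  apply: (@ge0_le_integral _ _ _ mu setT measurableT _
    (((abse \o (EFin \o f)) \_ `[a, s]%classic) \+ ((abse \o (EFin \o f)) \_ `[s, b]%classic))%E).
  - by move=> x _; rewrite erestrict_ge0.
  - apply: (measurable_restrictT _ _).1 mU; exact: measurableU.
  - by apply: emeasurable_funD; apply: (measurable_restrictT _ _).1 => //;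
      apply: measurableT_comp => //; [exact: measurable_int fi|exact: measurable_int gi].
  - move=> x _; rewrite /= !patchE in_setU.
    by case: (x \in _); case: (x \in _) => //=; rewrite ?adde0 ?add0e// leeDl.
rewrite ge0_integralD//=; last 4 first.
- by move=> x _; rewrite patchE; case: ifP => // _; exact: abse_ge0.
- apply: (measurable_restrictT _ _).1 => //; apply: measurableT_comp => //.
  exact: measurable_int fi.
- by move=> x _; rewrite patchE; case: ifP => // _; exact: abse_ge0.
- apply: (measurable_restrictT _ _).1 => //; apply: measurableT_comp => //.
  exact: measurable_int gi.
rewrite -!integral_mkcond lte_add_pinfty//.
- by case/integrableP : fi.
- by case/integrableP : gi.
Qed.

(** Agreement at the endpoints is not asked for, because the value of a grid step function at the
    right end of a cell already belongs to the next cell. *)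
Lemma integ_ext_oo s t f g : (forall x, s < x < t -> f x = g x) ->
  integ s t f -> integ s t g.
Proof.
move=> fg fi.
have mg : measurable_fun `[s, t]%classic g.
  apply: (@measurable_fun_itv_cc _ s t false true).
  apply: (eq_measurable_fun f).
    by move=> x; rewrite inE/= in_itv/=; exact: fg.
  apply: measurable_funS (integ_meas fi) => //.
  by apply: subset_itv; rewrite bnd_simp.
apply/integrableP; split; first exact/measurable_EFinP.
have /integrableP[_] := fi; apply: le_lt_trans.
have E (h : R -> R) : measurable_fun `[s, t]%classic h ->
  (\int[mu]_(x in `[s, t]) `|(h x)%:E| = \int[mu]_(x in `]s, t[) `|(h x)%:E|)%E.
  move=> mh; rewrite integral_itv_bndoo//; apply: measurableT_comp => //.
  apply/measurable_EFinP; apply: measurable_funS mh => //.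
  by apply: subset_itv; rewrite bnd_simp.
rewrite /= !E //; last exact: integ_meas fi.
by rewrite le_eqVlt; apply/orP; left; apply/eqP; apply: eq_integral => x;
  rewrite inE/= in_itv/= => /fg ->.
Qed.

Lemma J_ext_oo s t f g : (forall x, s < x < t -> f x = g x) ->
  integ s t f -> J s t f = J s t g.
Proof.
move=> fg fi; have gi := integ_ext_oo fg fi.
have E (h : R -> R) : integ s t h -> J s t h = \int[mu]_(x in `]s, t[) h x.
  move=> hi; rewrite /J /Rintegral integral_itv_bndoo//.
  apply: measurable_funS (measurable_int _ hi) => //.
  by apply: subset_itv; rewrite bnd_simp.
rewrite !E//; apply: eq_Rintegral => x; rewrite inE/= in_itv/=; exact: fg.
Qed.

Lemma J_EFin s t f : integ s t f -> (\int[mu]_(x in `[s, t]) (f x)%:E)%E = (J s t f)%:E.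
Proof. by move=> fi; rewrite /J /Rintegral fineK//; exact: integrable_fin_num. Qed.

Lemma integ_point s f : integ s s f.
Proof.
apply: (@integ_ext_oo s s (fun=> 0)); last exact: integ_cst.
by move=> x /andP[sx xs]; have := lt_trans sx xs; rewrite ltxx.
Qed.

Lemma J_point s f : J s s f = 0.
Proof.
rewrite -(@J_ext_oo s s (fun=> 0)); first by rewrite J_cst// mul0r.
  by move=> x /andP[sx xs]; have := lt_trans sx xs; rewrite ltxx.
exact: integ_cst.
Qed.

Lemma J_cells (N : nat) (h : R) (phi : R -> R) (a : nat -> R) : 0 < h ->
  (forall i, (i < N)%N -> integ (i%:R * h) (i.+1%:R * h) phi /\
     J (i%:R * h) (i.+1%:R * h) phi = a i) ->
  integ 0 (N%:R * h) phi /\ J 0 (N%:R * h) phi = \sum_(0 <= i < N) a i.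
Proof.
move=> h0; elim: N => [_|N IH H].
  by rewrite mul0r big_nil; split; [exact: integ_point|exact: J_point].
have [|I1 J1] := IH; first by move=> i iN; apply: H; exact: ltnW.
have [I2 J2] := H N (ltnSn N).
have le1 : 0 <= N%:R * h by rewrite mulr_ge0// ltW.
have le2 : N%:R * h <= N.+1%:R * h by rewrite ler_pM2r// ler_nat.
have I3 := integ_glue le1 le2 I1 I2.
by split => //; rewrite (J_split le1 le2 I3) J1 J2 big_nat_recr.
Qed.

(** * Difference quotients on a uniform grid *)

Definition lo (h t : R) : R := (Num.truncn (t / h))%:R * h.
Definition hi (h t : R) : R := lo h t + h.
Definition slope (p : R -> R) (h t : R) : R := (p (hi h t) - p (lo h t)) / h.

Lemma lo_cell h t (i : nat) : 0 < h -> i%:R * h <= t < i.+1%:R * h ->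
  lo h t = i%:R * h.
Proof.
move=> h0 /andP[h1 h2]; congr (_%:R * _); apply: Num.Theory.truncn_def.
by rewrite ler_pdivlMr// ltr_pdivrMr// h1 h2.
Qed.

Lemma hi_cell h t (i : nat) : 0 < h -> i%:R * h <= t < i.+1%:R * h ->
  hi h t = i.+1%:R * h.
Proof. by move=> h0 H; rewrite /hi (lo_cell h0 H) -natr1 mulrDl mul1r. Qed.

Lemma lo_bounds h t : 0 < h -> 0 <= t -> 0 <= lo h t /\ lo h t <= t < hi h t.
Proof.
move=> h0 t0; split; first by rewrite mulr_ge0// ltW.
have := Num.Theory.truncn_itv (divr_ge0 t0 (ltW h0)).
by rewrite ler_pdivlMr// ltr_pdivrMr// /hi /lo -natr1 mulrDl mul1r.
Qed.

(** The strict bound [t < T] matters: the cell of [T] itself starts at [T] and ends outside the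
    interval. *)
Lemma hi_le (T : R) (N : nat) t : 0 < T -> (0 < N)%N -> 0 <= t < T ->
  hi (T / N%:R) t <= T.
Proof.
move=> T0 N0 /andP[t0 tT].
have h0 : 0 < T / N%:R by rewrite divr_gt0// ltr0n.
rewrite /hi /lo -[X in _ + X]mul1r -mulrDl natr1 mulrA ler_pdivrMr ?ltr0n//.
rewrite mulrC ler_pM2l// ler_nat -(ltr_nat R).
have /andP[+ _] := Num.Theory.truncn_itv (divr_ge0 t0 (ltW h0)).
move=> /le_lt_trans; apply; rewrite ltr_pdivrMr// mulrCA divff ?mulr1//.
by rewrite pnatr_eq0 -lt0n.
Qed.

(** The sum over the cells telescopes, so the identity is exact on every grid and holds for
    arbitrary [p]. *)
Lemma J_slope (T : R) (N : nat) (p : R -> R) : 0 < T -> (0 < N)%N ->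
  integ 0 T (slope p (T / N%:R)) /\ J 0 T (slope p (T / N%:R)) = p T - p 0.
Proof.
move=> T0 N0; set h := T / N%:R.
have h0 : 0 < h by rewrite divr_gt0// ltr0n.
have TN : T = N%:R * h by rewrite /h mulrCA divff ?mulr1// pnatr_eq0 -lt0n.
have [|I1 J1] := @J_cells N h (slope p h) (fun i => p (i.+1%:R * h) - p (i%:R * h)) h0.
  move=> i iN.
  have le2 : i%:R * h <= i.+1%:R * h by rewrite ler_pM2r// ler_nat.
  have E x : i%:R * h < x < i.+1%:R * h ->
      (p (i.+1%:R * h) - p (i%:R * h)) / h = slope p h x.
    move=> /andP[h1 h2]; have H : i%:R * h <= x < i.+1%:R * h by rewrite h2 ltW.
    by rewrite /slope (lo_cell h0 H) (hi_cell h0 H).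
  split; first by apply: integ_ext_oo E _; exact: integ_cst.
  rewrite -(J_ext_oo E (integ_cst _ _ _)) J_cst//.
  have -> : i.+1%:R * h - i%:R * h = h.
    by rewrite -[i.+1%:R]natr1 mulrDl mul1r addrAC subrr add0r.
  by rewrite divfK// gt_eqF.
rewrite -TN in I1 J1; split => //.
rewrite J1 (telescope_sumr (fun i => p (i%:R * h)))//.
by rewrite -TN mul0r.
Qed.

(** * Differentiation almost everywhere and the fundamental theorem *)

(** Differentiability relative to [[0, T]], without division: [p] is never read outside the
    interval. *)
Definition sdif (T : R) (p : R -> R) (t d : R) : Prop :=
  forall e : R, 0 < e -> exists2 r : R, 0 < r &
    forall s, 0 <= s <= T -> `|s - t| < r -> `|p s - p t - (s - t) * d| <= e * `|s - t|.

Lemma sdifW (T b : R) p t d : b <= T -> sdif T p t d -> sdif b p t d.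
Proof.
move=> bT H e /H[r r0 K]; exists r => // s /andP[s0 sb]; apply: K.
by rewrite s0 (le_trans sb).
Qed.

Lemma ftc_ae (T : R) f : 0 < T -> integ 0 T f ->
  {ae mu, forall t, 0 < t < T -> sdif T (fun s => J 0 s f) t (f t)}.
Proof.
move=> T0 fi.
have mI : measurable (`[0, T]%classic : set R) by [].
(* Extension by 0 gives a function integrable on the whole line, to which Lebesgue differentiation
   applies. *)
pose f' := f \_ `[0, T]%classic.
have f'i : mu.-integrable setT (EFin \o f').
  have := (integrable_mkcond (mu := mu) (EFin \o f) mI).1 fi.
  by rewrite /f' restrict_EFin.
have lf : locally_integrable setT f' by exact: integrable_locally.
have H := @FTC1 R f' (BLeft 0) _ lf.
have /H : forall y, mu.-integrable [set` Interval (BLeft 0) (BRight y)] (EFin \o f').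
  by move=> y; apply: (integrableS measurableT _ _ f'i).
 apply: aeS => t Ht /andP[t0 tT].
have [|dF F'] := Ht; first by rewrite lte_fin.
have EF s : s <= T -> (\int[mu]_(t in [set` Interval (BLeft 0) (BRight s)]) f' t)%R = J 0 s f.
  move=> sT; apply: eq_Rintegral => x; rewrite inE/= in_itv/= => /andP[x0 xs].
  by rewrite /f' patchE mem_set//= in_itv/= x0 (le_trans xs).
have f't : f' t = f t by rewrite /f' patchE mem_set//= in_itv/= !ltW.
set F := (fun x : R => _) in dF F'.
move: F'; rewrite derive1E /derive f't => F' e e0.
have : h^-1 *: ((F \o shift t) (h *: 1) - F t) @[h --> 0^'] --> f t.
  by rewrite -F'; exact: dF.
move/cvgrPdist_le => /(_ _ e0).
rewrite near_withinE => /nbhs_ballP[r /= r0 K].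
exists r => // s /andP[s0 sT] st.
have [->|sNt] := eqVneq s t; first by rewrite !subrr mul0r subrr normr0 mulr0.
have hN0 : s - t != 0 by rewrite subr_eq0.
have := K (s - t); rewrite /ball/= sub0r normrN => /(_ st hN0).
rewrite /= /shift/= [_%:A]mulr1 subrK /F !EF ?(ltW tT)//.
rewrite distrC => K1.
have -> : J 0 s f - J 0 t f - (s - t) * f t =
   (s - t) * ((s - t)^-1 *: (J 0 s f - J 0 t f) - f t).
  by rewrite /GRing.scale/= mulrBr mulrA divff// mul1r.
by rewrite normrM mulrC ler_pM2r// normr_gt0.
Qed.

(** The point [t] lies between the ends of its cell, so the errors at the two ends add up to [e]
    times the cell length, which the quotient divides out. *)
Lemma slope_cvg (T : R) p t d : 0 < t < T -> sdif T p t d ->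
  (fun k => slope p (T / k.+1%:R) t) @ \oo --> d.
Proof.
move=> /andP[t0 tT] H; have T0 : 0 < T := lt_trans t0 tT.
apply/cvgrPdist_le => e e0.
have [r r0 K] := H e e0.
have hr : (fun k => T / k.+1%:R) @ \oo --> (0 : R).
  rewrite -(mulr0 T); apply: cvgMr; exact: cvg_harmonic.
have [M _ HM] := (cvgrPdist_lt _ _).1 hr r r0; exists M => // k /HM /=.
set h := T / k.+1%:R; rewrite sub0r normrN => hr1.
have h0 : 0 < h by rewrite divr_gt0.
rewrite gtr0_norm// in hr1.
have [l0 /andP[l1 l2]] := lo_bounds h0 (ltW t0).
have l3 : hi h t <= T by apply: hi_le => //; rewrite (ltW t0) tT.
have := K (hi h t); have := K (lo h t).
have E1 : `|lo h t - t| = t - lo h t by rewrite distrC ger0_norm// subr_ge0.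
have E2 : `|hi h t - t| = hi h t - t by rewrite gtr0_norm// subr_gt0.
have hE : hi h t - lo h t = h by rewrite /hi addrAC subrr add0r.
rewrite E1 E2 => K1 K2.
have {}K1 : `|p (lo h t) - p t - (lo h t - t) * d| <= e * (t - lo h t).
  by apply: K1; [rewrite l0/=|]; lra.
have {}K2 : `|p (hi h t) - p t - (hi h t - t) * d| <= e * (hi h t - t).
  by apply: K2; [apply/andP; split|]; lra.
have -> : d - slope p h t =
   ((p (lo h t) - p t - (lo h t - t) * d) - (p (hi h t) - p t - (hi h t - t) * d)) / h.
  have hN0 : h != 0 by rewrite gt_eqF.
  rewrite /slope; apply: (mulIf hN0); rewrite mulrBl !divfK//.
  by rewrite -{1}hE; ring.
rewrite normrM normfV (gtr0_norm h0) ler_pdivrMr//.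
apply: (le_trans (ler_normB _ _)); apply: (le_trans (lerD K1 K2)).
have eh : e * h = e * (hi h t - lo h t) by rewrite hE.
by rewrite eh -mulrDr le_eqVlt; apply/orP; left; apply/eqP; congr (_ * _); ring.
Qed.

Lemma J_dct (T : R) (f : nat -> R -> R) g : integ 0 T g ->
  (forall k, measurable_fun `[0, T]%classic (f k)) ->
  {ae mu, forall t, 0 <= t <= T -> (fun k => f k t) @ \oo --> 0} ->
  (forall k t, 0 <= t <= T -> `|f k t| <= g t) ->
  (fun k => J 0 T (f k)) @ \oo --> 0.
Proof.
move=> gi mf f0 fg.
have [] := @dominated_convergence _ _ _ mu `[0, T]%classic (measurable_itv _)
  (fun k t => (f k t)%:E) (fun=> 0%:E) (EFin \o g).
- by move=> k; apply/measurable_EFinP; exact: mf.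
- exact: measurable_cst.
- apply: aeS f0 => t H /=; rewrite in_itv/= => /H h.
  by apply: cvg_EFin; [exact: nearW|exact: h].
- exact: gi.
- apply: aeW => t k /=; rewrite in_itv/= => /fg h.
  by rewrite lee_fin.
move=> _ _; rewrite integral0.
move=> /fine_cvgP[_]; exact.
Qed.

(* Scheffe-type dominated convergence: the dominating functions [G k] vary,
   but converge to [g] and have the same integral as [g]. *)
Lemma J_gdct (T : R) (f G : nat -> R -> R) g :
  (forall k, measurable_fun `[0, T]%classic (f k)) ->
  (forall k, integ 0 T (G k)) -> integ 0 T g ->
  (forall k t, 0 <= t <= T -> 0 <= f k t /\ 0 <= G k t /\ 0 <= g t) ->
  {ae mu, forall t, 0 <= t <= T -> forall k, f k t <= 2 * (G k t + g t)} ->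
  {ae mu, forall t, 0 <= t <= T -> (fun k => f k t) @ \oo --> 0} ->
  {ae mu, forall t, 0 <= t <= T -> (fun k => G k t) @ \oo --> g t} ->
  (forall k, J 0 T (G k) = J 0 T g) ->
  (forall k, integ 0 T (f k)) /\ (fun k => J 0 T (f k)) @ \oo --> 0.
Proof.
move=> mf Gi gi nn fG f0 Gg JG.
have fi k : integ 0 T (f k).
  have i1 : integ 0 T (fun t => 2 * (G k t + g t)) by apply: integZ; exact: integD.
  apply/integrableP; split; first by apply/measurable_EFinP; exact: mf.
  have /integrableP[_] := i1; apply: le_lt_trans.
  apply: ae_ge0_le_integral => //.
  - by apply: measurableT_comp => //; apply/measurable_EFinP; exact: mf.
  - by apply: measurableT_comp => //; exact: measurable_int i1.
  apply: aeS fG => t H /=; rewrite in_itv/= => tT; rewrite lee_fin.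
  have [a b] := nn k t tT.
  by rewrite (ger0_norm a) (le_trans (H tT k))// ler_norm.
split => //.
(* By f <= 2 (G + g), the excess of f over 4 g is at most 2 (G - g)^+, and (G - g)^+ = (G - g) + (g
   - G)^+. Hence f <= h + 2 (G - g), where the last term has integral 0 and [h] is dominated by 6
   g. *)
pose h k t := Num.min (f k t) (4 * g t) + 2 * Num.max (g t - G k t) 0.
have mg := integ_meas gi; have mG k := integ_meas (Gi k).
have mh k : measurable_fun `[0, T]%classic (h k).
  apply: measurable_funD.
    by apply: measurable_minr => //; apply: measurable_funM.
  apply: measurable_funM => //; apply: measurable_maxr => //.
  exact: measurable_funB.
have h6 k t : 0 <= t <= T -> `|h k t| <= 6 * g t.
  move=> tT; have [f1 [g1 g2]] := nn k t tT; rewrite /h.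
  have m1 : 0 <= Num.min (f k t) (4 * g t) by rewrite le_min f1 mulr_ge0.
  have m2 : Num.min (f k t) (4 * g t) <= 4 * g t by rewrite ge_min lexx orbT.
  have m3 : 0 <= Num.max (g t - G k t) 0 by rewrite le_max lexx orbT.
  have m4 : Num.max (g t - G k t) 0 <= g t.
    by rewrite ge_max g2 andbT; lra.
  rewrite ger0_norm; lra.
have i6 : integ 0 T (fun t => 6 * g t) by exact: integZ.
have h0 : (fun k => J 0 T (h k)) @ \oo --> 0.
  apply: (J_dct i6 mh _ h6).
  apply: aeS (aeI f0 Gg) => t [H1 H2] tT.
  have E1 : (fun k => Num.min (f k t) (4 * g t)) @ \oo --> 0.
    apply: (@squeeze_cvgr _ _ _ _ (fun=> 0) (fun k => f k t)); [|exact: cvg_cst|exact: H1].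
    near=> k; have [a [b c]] := nn k t tT.
    by rewrite le_min a mulr_ge0//= ge_min lexx.
  have E2 : (fun k => Num.max (g t - G k t) 0) @ \oo --> 0.
    have E3 : (fun k => `|g t - G k t|) @ \oo --> 0.
      rewrite -(normr0 R) -(subrr (g t)); apply: cvg_norm; apply: cvgB; [exact: cvg_cst|exact: H2].
    apply: (@squeeze_cvgr _ _ _ _ (fun=> 0) (fun k => `|g t - G k t|)); [|exact: cvg_cst|exact: E3].
    by near=> k; rewrite le_max lexx orbT/= ge_max ler_norm normr_ge0.
  rewrite -[X in _ --> X]addr0 -{2}(mulr0 2); apply: cvgD => //; apply: cvgMr.
  exact: E2.
have hi k : integ 0 T (h k) by apply: integ_dom i6; [exact: mh|exact: h6].
apply: (@squeeze_cvgr _ _ _ _ (fun=> 0) (fun k => J 0 T (h k))); [|exact: cvg_cst|exact: h0].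
near=> k; rewrite J_ge0; last by move=> x xT; have [] := nn k x xT.
have i2 : integ 0 T (fun t => G k t - g t) by exact: integB.
have -> : J 0 T (h k) = J 0 T (fun t => h k t + 2 * (G k t - g t)).
  rewrite JD//; last exact: integZ.
  by rewrite JZ// JB// JG subrr mulr0 addr0.
apply: J_le_ae => //; first by apply: integD => //; exact: integZ.
apply: aeS fG => t H tT; have := H tT k; have [a [b c]] := nn k t tT.
rewrite /h maxEle minEle; case: ifPn; case: ifPn; rewrite -?ltNge; lra.
Unshelve. all: by end_near.
Qed.

(** The grid quotients of [p] are dominated by those of the primitive [W] of [g], which converge to
    [g] almost everywhere while keeping its integral. So [J_gdct] gives convergence of the quotients
    of [p] to [d] in L^1, and their integral is [p T - p 0] on every grid. *)
Lemma ac_ftc (T : R) (p g d : R -> R) : 0 < T -> integ 0 T g -> integ 0 T d ->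
  (forall t, 0 <= t <= T -> 0 <= g t) ->
  (forall s t, 0 <= s -> s <= t -> t <= T -> `|p t - p s| <= J s t g) ->
  {ae mu, forall t, 0 < t < T -> sdif T p t (d t)} ->
  p T - p 0 = J 0 T d.
Proof.
move=> T0 gi di g0 pg pd.
pose W s := J 0 s g.
pose h (k : nat) := T / k.+1%:R.
have hp k : 0 < h k by rewrite divr_gt0.
have WE s t : 0 <= s -> s <= t -> t <= T -> W t - W s = J s t g.
  move=> s0 st tT; rewrite /W (J_split s0 st); last exact: integ_sub gi.
  by rewrite addrC addKr.
have end_ae (P : R -> Prop) : {ae mu, forall t, 0 < t < T -> P t} ->
    {ae mu, forall t, 0 <= t <= T -> P t}.
  have a0 : {ae mu, forall t, t != 0 :> R}.
    exists [set 0]; split => //; first exact: lebesgue_measure_set1.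
    by move=> x /= /negP; rewrite negbK => /eqP.
  have aT : {ae mu, forall t, t != T :> R}.
    exists [set T]; split => //; first exact: lebesgue_measure_set1.
    by move=> x /= /negP; rewrite negbK => /eqP.
  move=> H; apply: aeS (aeI (aeI a0 aT) H) => t [[t0 tT] K] /andP[t1 t2].
  by apply: K; rewrite !lt_neqAle t1 t2 tT eq_sym t0.
have Wd := end_ae _ (ftc_ae T0 gi).
have {}pd := end_ae _ pd.
have sl k t : 0 <= t < T -> `|slope p (h k) t| <= slope W (h k) t.
  move=> /andP[t1 t2].
  have [l0 /andP[l1 l2]] := lo_bounds (hp k) t1.
  have l3 : hi (h k) t <= T by apply: hi_le => //; rewrite t1 t2.
  rewrite /slope normrM normfV (gtr0_norm (hp k)) ler_pM2r ?invr_gt0//.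
  by rewrite WE// ?pg//; lra.
have sl' : {ae mu, forall t, 0 <= t <= T -> 0 < t < T}.
  by apply: end_ae; apply: aeW.
have dg : {ae mu, forall t, 0 <= t <= T -> `|d t| <= g t}.
  apply: aeS (aeI sl' (aeI Wd pd)) => t [H1 [H2 H3]] tT.
  have t1 := H1 tT.
  have c1 := slope_cvg t1 (H2 tT); have c2 := slope_cvg t1 (H3 tT).
  have c3 : (fun k => `|slope p (h k) t|) @ \oo --> `|d t| by exact: cvg_norm.
  apply: (ler_cvg_to c3 c1); apply: nearW => k; apply: sl.
  by case/andP: t1 => a b; rewrite ltW.
have ip k := (J_slope p T0 (ltn0Sn k)).1; have jp k := (J_slope p T0 (ltn0Sn k)).2.
have iW k := (J_slope W T0 (ltn0Sn k)).1; have jW k := (J_slope W T0 (ltn0Sn k)).2.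
pose f k t := `|slope p (h k) t - d t|.
have mf k : measurable_fun `[0, T]%classic (f k).
  by apply: integ_meas; apply: integ_abs; apply: integB => //; exact: ip.
(* At [t = T] the quotient reads [W] beyond [T]. The absolute value gives nonnegativity everywhere
   and alters the quotient on a null set only. *)
pose G k t := `|slope W (h k) t|.
have GE k : {ae mu, forall t, 0 <= t <= T -> G k t = slope W (h k) t}.
  apply: aeS sl' => t H /H /andP[a b]; apply: ger0_norm.
  by apply: le_trans (sl k t _) => //; rewrite ltW.
have [] := @J_gdct T f G g mf _ gi.
- by move=> k; apply: integ_abs; exact: iW.
- by move=> k t tT; split; [exact: normr_ge0|split; [exact: normr_ge0|exact: g0]].
- apply: aeS (aeI sl' dg) => t [H1 H2] tT k.
  have /andP[a b] := H1 tT; have := H2 tT.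
  have := sl k t; rewrite (ltW a) b => /(_ isT) S1 D1.
  have := ler_normB (slope p (h k) t) (d t); have := ler_norm (slope W (h k) t).
  have := normr_ge0 (slope W (h k) t); have := normr_ge0 (d t).
  rewrite -/(f k t) -/(G k t); lra.
- apply: aeS (aeI sl' pd) => t [H1 H2] tT.
  have c := slope_cvg (H1 tT) (H2 tT).
  rewrite -(normr0 R) -(subrr (d t)); apply: cvg_norm; apply: cvgB; [exact: c|exact: cvg_cst].
- apply: aeS (aeI sl' Wd) => t [H1 H2] tT.
  have c := slope_cvg (H1 tT) (H2 tT).
  rewrite -[g t]ger0_norm ?g0//; apply: cvg_norm; exact: c.
- move=> k; rewrite (@J_ext_ae 0 T (G k) (slope W (h k)))//; [|by apply: integ_abs; exact: iW|exact: iW].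
  by rewrite jW /W J_point subr0.
move=> fi f0.
apply/eqP; rewrite -subr_eq0 -normr_eq0 eq_le normr_ge0 andbT.
apply: (ler_cvg_to (cvg_cst _) f0); apply: nearW => k.
rewrite -(jp k) -JB//; exact: (J_abs (integB (ip k) di)).
Qed.

End IntervalIntegral.

Lemma quad_disc (R : realFieldType) (a b c : R) : 0 <= a ->
  (forall s : R, 0 <= a * s ^+ 2 + 2 * b * s + c) -> b ^+ 2 <= a * c.
Proof.
move=> a0 H; have [a_eq0|aN0] := eqVneq a 0.
  have [->|bN0] := eqVneq b 0; first by rewrite a_eq0 mul0r expr0n.
  (* At this [s] the affine function [2 * b * s + c] equals -1. *)
  have := H (- (c + 1) / (2 * b)); rewrite a_eq0 mul0r add0r.
  by rewrite mulrC divfK ?mulf_neq0 ?pnatr_eq0// => h; lra.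
have ap : 0 < a by rewrite lt_neqAle eq_sym aN0.
have := H (- b / a).
have -> : a * (- b / a) ^+ 2 + 2 * b * (- b / a) + c = (a * c - b ^+ 2) / a by field.
by rewrite pmulr_lge0 ?invr_gt0// subr_ge0.
Qed.

(** * Semi-inner products: approximate Riesz representation and uniform boundedness *)

Section SemiInner.
Variables (R : realType) (E : lmodType R) (P : E -> Prop) (B : E -> E -> R).
Hypothesis P0 : P 0.
Hypothesis P_lin : forall (a : R) u w, P u -> P w -> P (a *: u + w).
Hypothesis B_sym : forall u w, P u -> P w -> B u w = B w u.
Hypothesis B_lin : forall (a : R) u w y, P u -> P w -> P y ->
  B (a *: u + w) y = a * B u y + B w y.
Hypothesis B_ge0 : forall u, P u -> 0 <= B u u.

(** [E] will be the space of all curves on the line, [P] membership in H^1. [B] is only semidefinite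
    there, since curves that agree on [[0, T]] are not identified. The squared bound avoids the root
    of [B u u]. *)
Definition bounded_functional (F : E -> R) : Prop :=
  (forall (a : R) u w, P u -> P w -> F (a *: u + w) = a * F u + F w) /\
  exists C : R, forall u, P u -> F u ^+ 2 <= C * B u u.

Lemma B_sq a u w : P u -> P w ->
  B (a *: u + w) (a *: u + w) = B u u * a ^+ 2 + 2 * B w u * a + B w w.
Proof.
move=> Pu Pw; have Pa := P_lin a Pu Pw.
rewrite B_lin// (B_sym Pu Pa) (B_sym Pw Pa) !B_lin//.
by rewrite (B_sym Pu Pw); ring.
Qed.

Lemma B_cs u w : P u -> P w -> B u w ^+ 2 <= B u u * B w w.
Proof.
move=> Pu Pw; rewrite (B_sym Pu Pw); apply: quad_disc; first exact: B_ge0.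
by move=> s; rewrite -B_sq//; apply: B_ge0; exact: P_lin.
Qed.

(* A near-minimiser of [B y y - 2 F y] nearly represents [F]; completeness is
   only needed for exact representation. *)
Lemma approx_riesz F e : 0 < e -> bounded_functional F ->
  exists2 y, P y & forall x, P x -> (F x - B x y) ^+ 2 <= e * B x x.
Proof.
move=> e0 [Flin [C FC]].
pose V := [set B y y - 2 * F y | y in P].
have Vlb : has_inf V.
  split; first by exists (B 0 0 - 2 * F 0); exists 0.
  exists (- (`|C| + 1)) => _ [y Py <-].
  have h1 := FC y Py; have h2 := B_ge0 Py; have h3 := normr_ge0 C; have h4 := ler_norm C.
  have : F y ^+ 2 <= `|C| * B y y by apply: le_trans h1 _; exact: ler_wpM2r.
  move: h2 h3; set c := `|C|; set b := B y y; set f := F y => h2 h3 h5.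
  (* If 2 f exceeded b + c, squaring would give 4 f^2 > (b + c)^2 >= 4 b c, against f^2 <= c b. *)
  rewrite leNgt; apply/negP => lt.
  have p1 : 0 < 2 * f - (b + c) by lra.
  have p2 : 0 < 2 * f + (b + c) by lra.
  have := mulr_gt0 p1 p2; have := sqr_ge0 (b - c); nra.
have [_ [y Py <-] ylt] : exists2 v, V v & v < inf V + e by exact: inf_adherent.
exists y => // x Px; rewrite -sqrrN opprB mulrC.
(* Moving from [y] in the direction [x] lowers the quadratic functional by less than [e]; the
   discriminant of this quadratic inequality in the step length is the claim. *)
apply: quad_disc; first exact: B_ge0.
move=> s; have Ps := P_lin s Px Py.
have : inf V <= B (s *: x + y) (s *: x + y) - 2 * F (s *: x + y).
  by apply: ge_inf; [exact: Vlb.2|exists (s *: x + y)].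
rewrite B_sq// Flin// (B_sym Py Px); lra.
Qed.

(* Gliding hump. *)
Lemma uniform_boundedness (u : nat -> E) : (forall n, P (u n)) ->
  (forall F, bounded_functional F -> exists M : R, forall n, `|F (u n)| <= M) ->
  exists M : R, forall n, B (u n) (u n) <= M.
Proof.
move=> Pu HF; apply: contrapT => unb.
pose N x := Num.sqrt (B x x).
have N0 x : 0 <= N x by exact: sqrtr_ge0.
have N2 x : P x -> N x ^+ 2 = B x x by move=> Px; rewrite sqr_sqrtr// B_ge0.
have BN x y : P x -> P y -> `|B x y| <= N x * N y.
  move=> Px Py; rewrite -sqrtrM ?B_ge0// -sqrtr_sqr ler_wsqrtr//; exact: B_cs.
have pickP (x : R) : exists n, x < N (u n).
  apply: contrapT => /forallNP h; apply: unb; exists (x ^+ 2) => n.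
  have := h n; move/negP; rewrite -leNgt => le.
  by rewrite -N2// lerXn2r ?nnegrE// (le_trans (N0 (u n))).
pose pick x := sval (cid (pickP x)).
have pickE x : x < N (u (pick x)) := svalP (cid (pickP x)).
(* Pairing with [u j] is itself a bounded functional, so the hypothesis bounds the cross terms. They
   replace orthogonality in the control of the head of the series below. *)
have Mex j : exists M : R, forall n, `|B (u n) (u j)| <= M.
  apply: (HF (fun x => B x (u j))); split => [a x w Px Pw|]; first exact: B_lin.
  by exists (B (u j) (u j)) => x Px; rewrite mulrC; exact: B_cs.
pose M j := sval (cid (Mex j)).
have ME j n : `|B (u n) (u j)| <= M j := svalP (cid (Mex j)) n.
have M0 j : 0 <= M j by apply: le_trans (ME j 0%N).
pose q (k : nat) : R := (3%:R^-1) ^+ k.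
have q0 k : 0 < q k by rewrite exprn_gt0// invr_gt0.
have qS k : q k.+1 = q k / 3 by rewrite /q exprSr.
(* Indices and head bounds are built together: [S k] bounds what the first [k] terms can contribute
   at any [u n], and the index [n k] makes the norm so large that half of the [k]-th term at
   [u (n k)] exceeds [S k + k + 1]. *)
pose nk k S := pick ((q k)^-1 * 2 * (S + k%:R + 1)).
pose S := fix S k := if k is j.+1 then
   S j + q j * (M (nk j (S j)) / N (u (nk j (S j)))) else 0.
pose n k := nk k (S k).
have SS k : S k.+1 = S k + q k * (M (n k) / N (u (n k))) by [].
have S0 k : 0 <= S k.
  elim: k => [//|k IH]; rewrite SS addr_ge0// mulr_ge0 ?(ltW (q0 k))// mulr_ge0//.
  by rewrite invr_ge0.
have nE k : S k + k%:R + 1 <= q k * N (u (n k)) / 2.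
  have := pickE ((q k)^-1 * 2 * (S k + k%:R + 1)); rewrite -/(nk k (S k)) -/(n k) => h.
  have /ltW := h; rewrite -(ler_pM2l (q0 k)) !mulrA mulfV ?gt_eqF// mul1r.
  by move=> h2; lra.
have Nn k : 0 < N (u (n k)).
  have := nE k; have := S0 k; have := ler0n R k; have := q0 k => a b c d.
  by rewrite -(pmulr_rgt0 _ a); lra.
pose a x k := q k * (B x (u (n k)) / N (u (n k))).
have a_le x k : P x -> `|a x k| <= q k * N x.
  move=> Px; rewrite /a normrM (gtr0_norm (q0 k)) ler_pM2l// normrM normfV.
  by rewrite (gtr0_norm (Nn k)) ler_pdivrMr// BN.
have a_lin c x w k : P x -> P w -> a (c *: x + w) k = c * a x k + a w k.
  by move=> Px Pw; rewrite /a B_lin//; ring.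
have acv x : P x -> cvgn (series (a x)).
  move=> Px; apply: normed_cvg; apply: (@series_le_cvg _ _ (geometric (N x) 3%:R^-1)).
  - by move=> k /=.
  - by move=> k /=; rewrite mulr_ge0// ltW.
  - by move=> k /=; rewrite mulrC a_le.
  - by apply: is_cvg_geometric_series; rewrite ger0_norm ?invr_ge0// invf_lt1// ltr1n.
pose F x := limn (series (a x)).
have [|K FK] := HF F.
  split=> [c x w Px Pw|].
    have -> : F (c *: x + w) = limn (fun k => c * series (a x) k + series (a w) k).
      congr (lim (_ @ \oo)); apply/funext => k.
      rewrite /series/= mulr_sumr -big_split/=; apply: eq_bigr => i _; exact: a_lin.
    apply: cvg_lim => //; apply: cvgD; last exact: acv.
    by apply: cvgMr; exact: acv.
  exists 4 => x Px.
  have bd k : `|series (a x) k| <= 3 / 2 * (1 - q k) * N x.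
    elim: k => [|k IH]; first by rewrite /series/= big_geq// normr0 /q expr0 subrr mulr0 mul0r.
    rewrite seriesSr; apply: (le_trans (ler_normD _ _)).
    apply: (le_trans (lerD IH (a_le _ _ Px))); rewrite -mulrDl ler_wpM2r//.
    by rewrite qS; have := q0 k; lra.
  have le : `|F x| <= 2 * N x.
    have cF : (fun k => `|series (a x) k|) @ \oo --> `|F x| by apply: cvg_norm; exact: acv.
    apply: (ler_cvg_to cF (cvg_cst (2 * N x))).
    apply: nearW => k; apply: le_trans (bd k) _; rewrite ler_wpM2r//.
    by have := q0 k; lra.
  rewrite -N2// -[F x ^+ 2]real_normK ?num_real//.
  have -> : 4 * N x ^+ 2 = (2 * N x) ^+ 2 by ring.
  by rewrite lerXn2r ?nnegrE// mulr_ge0.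
have big k : k%:R + 1 <= F (u (n k)).
  have cF : (fun m => series (a (u (n k))) (m + k.+1)%N) @ \oo --> F (u (n k)).
    by rewrite (cvg_shiftn k.+1 (series (a (u (n k))))); exact: acv.
  have c0 : (fun=> k%:R + 1) @ \oo --> (k%:R + 1 : R) by exact: cvg_cst.
  apply: (ler_cvg_to c0 cF).
  apply: nearW => m.
  have head j : - S j <= series (a (u (n k))) j.
    elim: j => [|j IH]; first by rewrite /series/= big_geq// oppr0.
    rewrite seriesSr SS opprD lerD// /a -mulrN ler_pM2l// -mulNr ler_pM2r ?invr_gt0//.
    by have := ME (n j) (n k); rewrite ler_norml => /andP[].
  have aD : a (u (n k)) k = q k * N (u (n k)).
    by rewrite /a -N2// expr2 mulfK// gt_eqF.
  (* The ratio 1/3 is chosen so that the whole tail is at most 1/3 + 1/9 + ... = 1/2 of the diagonal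
     term; after [m] tail terms the fraction [(1 + q m) / 2] of it is left. *)
  apply: le_trans (_ : q k * N (u (n k)) * ((1 + q m) / 2) - S k <= _).
    have := nE k; have := q0 m => qm h.
    have : 0 <= q k * N (u (n k)) * q m.
      by rewrite mulr_ge0 ?(ltW qm)// mulr_ge0 ?(ltW (q0 k)).
    lra.
  elim: m => [|m IH].
    rewrite add0n seriesSr aD; have := head k; have -> : q 0%N = 1 by rewrite /q expr0.
    lra.
  rewrite addSn seriesSr.
  have := a_le (u (n k)) (m + k.+1)%N (Pu _); rewrite ler_norml => /andP[h _].
  have qE : q (m + k.+1)%N = q m * q k / 3 by rewrite addnS qS /q exprD.
  apply: le_trans (lerD IH h); rewrite qS qE; lra.
have [m Km] : exists m : nat, K < m%:R.
  by exists (Num.truncn K).+1; rewrite Num.Theory.truncnS_gt.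
have := big m; have := FK (n m); have := ler_norm (F (u (n m))); lra.
Qed.

End SemiInner.

(** * Inner product identities and bounded linear maps *)

Section InnerProduct.
Variables (R : realType) (H : completeNormedModType R) (ip : H -> H -> R).
Hypothesis ipH : inner_product ip.

Lemma ipC x y : ip x y = ip y x. Proof. by case: ipH. Qed.

Lemma ipP a x y z : ip (a *: x + y) z = a * ip x z + ip y z.
Proof. by case: ipH => _ []. Qed.

Lemma ipxx x : ip x x = `|x| ^+ 2. Proof. by case: ipH => _ []. Qed.

Lemma ipDl x y z : ip (x + y) z = ip x z + ip y z.
Proof. by rewrite -[x in LHS]scale1r ipP mul1r. Qed.

Lemma ip0l z : ip 0 z = 0.
Proof. by have := ipDl 0 0 z; rewrite addr0 => /eqP; rewrite -subr_eq0 opprD addNKr oppr_eq0 => /eqP. Qed.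

Lemma ipZl a x z : ip (a *: x) z = a * ip x z.
Proof. by rewrite -[a *: x]addr0 ipP ip0l addr0. Qed.

Lemma ipNl x z : ip (- x) z = - ip x z.
Proof. by rewrite -scaleN1r ipZl mulN1r. Qed.

Lemma ipBl x y z : ip (x - y) z = ip x z - ip y z.
Proof. by rewrite ipDl ipNl. Qed.

Lemma ipDr x y z : ip z (x + y) = ip z x + ip z y.
Proof. by rewrite !(ipC z) ipDl. Qed.

Lemma ipZr a x z : ip z (a *: x) = a * ip z x.
Proof. by rewrite !(ipC z) ipZl. Qed.

Lemma ipBr x y z : ip z (x - y) = ip z x - ip z y.
Proof. by rewrite !(ipC z) ipBl. Qed.

Lemma ipNr x z : ip z (- x) = - ip z x.
Proof. by rewrite !(ipC z) ipNl. Qed.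

Lemma norm2D x y : `|x + y| ^+ 2 = `|x| ^+ 2 + 2 * ip x y + `|y| ^+ 2.
Proof. by rewrite -!ipxx ipDl !ipDr (ipC y x); ring. Qed.

Lemma norm2B x y : `|x - y| ^+ 2 = `|x| ^+ 2 - 2 * ip x y + `|y| ^+ 2.
Proof. by rewrite -!ipxx ipBl !ipBr (ipC y x); ring. Qed.

Lemma ip_cs x y : `|ip x y| <= `|x| * `|y|.
Proof.
have h : ip x y ^+ 2 <= (`|x| * `|y|) ^+ 2.
  rewrite exprMn; apply: quad_disc; first exact: sqr_ge0.
  move=> s; have := sqr_ge0 `|s *: x + y|.
  rewrite norm2D normrZ exprMn real_normK ?num_real// ipZl.
  by move=> h; apply: le_trans h _; rewrite le_eqVlt; apply/orP; left; apply/eqP; ring.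
rewrite -[leLHS]ger0_norm// -[leRHS]ger0_norm ?mulr_ge0//.
by rewrite -ler_sqr ?nnegrE// !real_normK ?num_real.
Qed.

Lemma ip_le x y : ip x y <= `|x| * `|y|.
Proof. exact: le_trans (ler_norm _) (ip_cs x y). Qed.

Lemma ip_young x y : `|ip x y| <= `|x| ^+ 2 + `|y| ^+ 2.
Proof.
apply: le_trans (ip_cs x y) _.
have := sqr_ge0 (`|x| - `|y|); have := sqr_ge0 `|x|; have := sqr_ge0 `|y|.
by move: `|x| `|y| => a b; rewrite sqrrB; lra.
Qed.

Lemma ip_functional (x : H) : cont_lin_functional (fun y => ip y x).
Proof.
split=> [a u v|u]; first exact: ipP.
apply/cvgrPdist_le => e e0.
have k0 : 0 < `|x| + 1 by rewrite ltr_wpDl.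
have := @cvg_id _ (nbhs u) => /cvgrPdist_le /(_ (e / (`|x| + 1))).
rewrite divr_gt0// => /(_ isT); apply: filterS => v uv.
rewrite -ipBl; apply: le_trans (ip_cs _ _) _.
apply: le_trans (ler_wpM2r (normr_ge0 x) uv) _.
by rewrite mulrAC ler_pdivrMr// ler_pM2l//; lra.
Qed.

End InnerProduct.

Lemma linear_cont_bounded (R : realType) (V W : normedModType R) (f : V -> W) :
  linear_cont f -> exists2 C : R, 0 <= C & forall x, `|f x| <= C * `|x|.
Proof.
move=> [flin fc].
have f0 : f 0 = 0.
  have := flin 1 0 0; rewrite scale1r addr0 scale1r => /eqP.
  by rewrite -subr_eq0 opprD addNKr oppr_eq0 => /eqP.
have fZ a x : f (a *: x) = a *: f x by have := flin a x 0; rewrite f0 !addr0.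
have := fc 0; rewrite /continuous_at f0 => /cvgrPdist_le /(_ 1 ltr01).
rewrite near_simpl => /nbhs_ballP[r /= r0 K].
exists (2 / r); first by rewrite divr_ge0// ltW.
move=> x; have [->|xN0] := eqVneq x 0; first by rewrite f0 !normr0 mulr0.
have x0 : 0 < `|x| by rewrite normr_gt0.
pose a := r / 2 / `|x|.
have a0 : 0 < a by rewrite !divr_gt0.
have := K (a *: x); rewrite -ball_normE/= sub0r normrN normrZ gtr0_norm// /a divfK ?gt_eqF//.
have -> : r / 2 < r by lra.
move=> /(_ isT); rewrite sub0r normrN fZ normrZ gtr0_norm//.
rewrite mulrC -ler_pdivlMr// => h; apply: le_trans h _.
by rewrite /a div1r !invfM !invrK le_eqVlt; apply/orP; left; apply/eqP; field; rewrite gt_eqF.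
Qed.


(** * Square integrable and absolutely continuous curves in a Hilbert space *)

Section HilbertCurves.
Variables (R : realType) (T : R) (H : completeNormedModType R) (ip : H -> H -> R).
Hypothesis T0 : 0 < T.
Hypothesis ipH : inner_product ip.
Variable xs : nat -> H.
Hypothesis xs_dense : forall (x : H) (e : R), 0 < e -> exists k, `|x - xs k| < e.
Notation mu := (@lebesgue_measure R).
Notation I := (`[0, T]%classic : set R).

Implicit Types (u v w y z : R -> H).

(** Weak measurability. Since [H] is separable it already makes norms and inner products of curves
    measurable, so that simple functions can be avoided here. *)
Definition wm v : Prop := forall x : H, measurable_fun I (fun t => ip (v t) x).

Lemma wm_lin (a : R) u v : wm u -> wm v -> wm (fun t => a *: u t + v t).
Proof.
move=> mu_ mv x.
rewrite (_ : (fun t => _) = (fun t => a * ip (u t) x + ip (v t) x)); last first.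
  by apply/funext => t; exact: ipP.
by apply: measurable_funD => //; apply: measurable_funM.
Qed.

Lemma wmD u v : wm u -> wm v -> wm (fun t => u t + v t).
Proof.
move=> mu_ mv; rewrite (_ : (fun t => _) = (fun t => 1 *: u t + v t)); first exact: wm_lin.
by apply/funext => t; rewrite scale1r.
Qed.

Lemma wmB u v : wm u -> wm v -> wm (fun t => u t - v t).
Proof.
move=> mu_ mv; rewrite (_ : (fun t => _) = (fun t => (-1) *: v t + u t)); first exact: wm_lin.
by apply/funext => t; rewrite scaleN1r addrC.
Qed.

(* [|v|^2] is the supremum of [2 (v, x_k) - |x_k|^2] over a dense sequence. *)
Lemma wm_norm2 v : wm v -> measurable_fun I (fun t => `|v t| ^+ 2).
Proof.
move=> mv; pose h k t := 2 * ip (v t) (xs k) - `|xs k| ^+ 2.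
have hle k t : h k t <= `|v t| ^+ 2.
  have := sqr_ge0 `|v t - xs k|; rewrite (norm2B ipH) /h; lra.
have -> : (fun t => `|v t| ^+ 2) = (fun t => sups (h ^~ t) 0).
  apply/funext => t; apply/eqP; rewrite eq_le; apply/andP; split; last first.
    apply: ge_sup; first by exists (h 0%N t); exists 0%N.
    by move=> _ [k _ <-]; exact: hle.
  apply/ler_addgt0Pr => e e0.
  have e1 : 0 < Num.sqrt e by rewrite sqrtr_gt0.
  have [k kx] := xs_dense (v t) e1.
  have h2 : h k t <= sups (h ^~ t) 0.
    apply: ub_le_sup; last by exists k.
    by exists (`|v t| ^+ 2) => _ [j _ <-]; exact: hle.
  have : `|v t - xs k| ^+ 2 <= e.
    have E : Num.sqrt e ^+ 2 = e by rewrite sqr_sqrtr// ltW.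
    by rewrite -[leRHS]E lerXn2r ?nnegrE ?(ltW e1) ?(ltW kx).
  rewrite (norm2B ipH); move: h2; rewrite /h; lra.
apply: measurable_fun_sups.
- by move=> t _; exists (`|v t| ^+ 2) => _ [j _ <-]; exact: hle.
- move=> k; apply: measurable_funB => //; apply: measurable_funM => //; exact: mv.
Qed.

Lemma wm_norm v : wm v -> measurable_fun I (fun t => `|v t|).
Proof.
move=> mv; rewrite (_ : (fun t => _) = (fun t => Num.sqrt (`|v t| ^+ 2))).
  apply: measurableT_comp (wm_norm2 mv).
  by apply: continuous_measurable_fun; exact: sqrt_continuous.
by apply/funext => t; rewrite sqrtr_sqr normr_id.
Qed.

Lemma wm_ip u v : wm u -> wm v -> measurable_fun I (fun t => ip (u t) (v t)).
Proof.
move=> mu_ mv.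
rewrite (_ : (fun t => _) =
  (fun t => 2^-1 * (`|u t + v t| ^+ 2 - (`|u t| ^+ 2 + `|v t| ^+ 2)))); last first.
  by apply/funext => t; rewrite (norm2D ipH); lra.
apply: measurable_funM => //; apply: measurable_funB.
  by apply: (@wm_norm2 (fun t => u t + v t)); exact: wmD.
by apply: measurable_funD; exact: wm_norm2.
Qed.

Definition L2 v : Prop := wm v /\ integ 0 T (fun t => `|v t| ^+ 2).

Lemma L2_lin (a : R) u v : L2 u -> L2 v -> L2 (fun t => a *: u t + v t).
Proof.
move=> [m1 i1] [m2 i2]; split; first exact: wm_lin.
apply: (@integ_dom R 0 T _ (fun t => 2 * (a ^+ 2 * `|u t| ^+ 2 + `|v t| ^+ 2))).
- by apply: wm_norm2; exact: wm_lin.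
- move=> t _; rewrite ger0_norm ?sqr_ge0//.
  have := sqr_ge0 `|a *: u t - v t|; rewrite (norm2B ipH) (norm2D ipH) normrZ.
  by rewrite exprMn real_normK ?num_real//; lra.
- by apply: integZ; apply: integD => //; apply: integZ.
Qed.

Lemma L2B u v : L2 u -> L2 v -> L2 (fun t => u t - v t).
Proof.
move=> mu_ mv; rewrite (_ : (fun t => _) = (fun t => (-1) *: v t + u t)); first exact: L2_lin.
by apply/funext => t; rewrite scaleN1r addrC.
Qed.

Lemma L2_ip u v : L2 u -> L2 v -> integ 0 T (fun t => ip (u t) (v t)).
Proof.
move=> [m1 i1] [m2 i2].
apply: (@integ_dom R 0 T _ (fun t => `|u t| ^+ 2 + `|v t| ^+ 2)).
- exact: wm_ip.
- by move=> t _; exact: ip_young.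
- exact: integD.
Qed.

Lemma L2_norm u : L2 u -> integ 0 T (fun t => `|u t|).
Proof.
move=> [m1 i1]; apply: (@integ_dom R 0 T _ (fun t => 1 + `|u t| ^+ 2)).
- exact: wm_norm.
- move=> t _; rewrite normr_id; have := sqr_ge0 (`|u t| - 1); have := sqr_ge0 `|u t|; rewrite sqrrB; lra.
- by apply: integD => //; exact: integ_cst.
Qed.

Lemma L2_ipc u (x : H) : L2 u -> integ 0 T (fun t => ip (u t) x).
Proof.
move=> [m1 i1]; apply: (@integ_dom R 0 T _ (fun t => `|u t| ^+ 2 + `|x| ^+ 2)).
- exact: m1.
- by move=> t _; exact: ip_young.
- by apply: integD => //; exact: integ_cst.
Qed.

Lemma L2_norm_norm u v : L2 u -> L2 v -> integ 0 T (fun t => `|u t| * `|v t|).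
Proof.
move=> [m1 i1] [m2 i2].
apply: (@integ_dom R 0 T _ (fun t => `|u t| ^+ 2 + `|v t| ^+ 2)).
- by apply: measurable_funM; exact: wm_norm.
- move=> t _; rewrite normrM !normr_id.
  have := sqr_ge0 (`|u t| - `|v t|); have := sqr_ge0 `|u t|; have := sqr_ge0 `|v t|.
  by move: `|u t| `|v t| => a b; rewrite sqrrB; lra.
- exact: integD.
Qed.

Lemma J_cs s t (f g : R -> R) : s <= t ->
  integ s t (fun r => f r ^+ 2) -> integ s t (fun r => g r ^+ 2) ->
  integ s t (fun r => f r * g r) ->
  (J s t (fun r => f r * g r)) ^+ 2 <= J s t (fun r => f r ^+ 2) * J s t (fun r => g r ^+ 2).
Proof.
move=> st i1 i2 i3; apply: quad_disc; first by apply: J_ge0 => x _; exact: sqr_ge0.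
move=> a.
have -> : J s t (fun r => f r ^+ 2) * a ^+ 2 + 2 * J s t (fun r => f r * g r) * a
    + J s t (fun r => g r ^+ 2) = J s t (fun r => (a * f r + g r) ^+ 2).
  rewrite [RHS](@J_ext _ _ _ _ (fun r => (a ^+ 2 * f r ^+ 2 + 2 * a * (f r * g r)) + g r ^+ 2)).
    rewrite JD//; last by apply: integD; apply: integZ.
    rewrite JD; [|exact: integZ|exact: integZ].
    by rewrite !JZ//; ring.
  by move=> x _; ring.
by apply: J_ge0 => x _; exact: sqr_ge0.
Qed.

Lemma J_ip_cs u v : L2 u -> L2 v ->
  (J 0 T (fun t => ip (u t) (v t))) ^+ 2 <=
  J 0 T (fun t => `|u t| ^+ 2) * J 0 T (fun t => `|v t| ^+ 2).
Proof.
move=> Lu Lv.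
apply: le_trans (_ : J 0 T (fun t => `|u t| * `|v t|) ^+ 2 <= _).
  rewrite -[leLHS]real_normK ?num_real// lerXn2r ?nnegrE//.
    by apply: J_ge0 => t _; rewrite mulr_ge0.
  apply: le_trans (J_abs (L2_ip Lu Lv)) _.
  apply: J_le; [apply: integ_abs; exact: L2_ip|exact: L2_norm_norm|].
  by move=> t _; exact: ip_cs.
apply: J_cs; [exact: ltW|by case: Lu|by case: Lv|exact: L2_norm_norm].
Qed.

(* [h1 z v]: [z] is in H^1(0,T;H) with weak derivative [v], stated with
   everywhere (not only almost everywhere) measurable representatives. *)
Definition h1 z v : Prop := L2 v /\ forall s t, 0 <= s -> s <= t -> t <= T ->
  forall x : H, ip (z t) x - ip (z s) x = J s t (fun r => ip (v r) x).

Lemma h1_lin (a : R) y u z v : h1 y u -> h1 z v ->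
  h1 (fun t => a *: y t + z t) (fun t => a *: u t + v t).
Proof.
move=> [L1 E1] [L2' E2]; split; first exact: L2_lin.
move=> s t s0 st tT x; rewrite !(ipP ipH).
rewrite (@J_ext _ s t _ (fun r => a * ip (u r) x + ip (v r) x)); last first.
  by move=> r _; exact: ipP.
have iu := integ_sub s0 tT (L2_ipc x L1); have iv := integ_sub s0 tT (L2_ipc x L2').
rewrite JD ?JZ//; last exact: integZ.
by rewrite -E1// -E2//; ring.
Qed.

Lemma h1B y u z v : h1 y u -> h1 z v ->
  h1 (fun t => y t - z t) (fun t => u t - v t).
Proof.
move=> h g; rewrite (_ : (fun t => y t - _) = (fun t => (-1) *: z t + y t)).
  rewrite (_ : (fun t => u t - _) = (fun t => (-1) *: v t + u t)); first exact: h1_lin.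
  by apply/funext => t; rewrite scaleN1r addrC.
by apply/funext => t; rewrite scaleN1r addrC.
Qed.

(** Testing the weak identity with the increment [z t - z s] itself yields its norm. *)
Lemma h1_lip z v s t : h1 z v -> 0 <= s -> s <= t -> t <= T ->
  `|z t - z s| <= J s t (fun r => `|v r|).
Proof.
move=> [Lv E] s0 st tT; set x := z t - z s.
have iv := integ_sub s0 tT (L2_norm Lv).
have [x_eq0|xN0] := eqVneq `|x| 0; first by rewrite x_eq0; apply: J_ge0.
have xp : 0 < `|x| by rewrite lt_neqAle eq_sym xN0 normr_ge0.
rewrite -(ler_pM2l xp) -expr2 -(ipxx ipH) {1}/x (ipBl ipH) E// -JZ//.
apply: J_le; [exact: integ_sub (L2_ipc x Lv)|exact: integZ|].
by move=> r _; rewrite mulrC; exact: ip_le.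
Qed.

Lemma h1_holder z v s t : h1 z v -> 0 <= s -> s <= t -> t <= T ->
  `|z t - z s| ^+ 2 <= (t - s) * J s t (fun r => `|v r| ^+ 2).
Proof.
move=> hz s0 st tT; have [Lv _] := hz.
have i2 := integ_sub s0 tT Lv.2; have i1 := integ_sub s0 tT (L2_norm Lv).
apply: le_trans (_ : J s t (fun r => `|v r|) ^+ 2 <= _).
  by rewrite lerXn2r ?nnegrE//; [apply: J_ge0|exact: h1_lip hz _ _ _].
have := @J_cs s t (fun=> 1) (fun r => `|v r|) st.
rewrite (@J_ext _ s t (fun r => 1 * `|v r|) (fun r => `|v r|)); last by move=> r _; rewrite mul1r.
rewrite expr1n (J_cst 1 st) mul1r => h; apply: le_trans (h _ _ _) _ => //.
- exact: integ_cst.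
- by apply: integ_ext i1 => r _; rewrite mul1r.
Qed.

Lemma h1_bounded z v : h1 z v -> exists2 M : R, 0 <= M & forall t, 0 <= t <= T -> `|z t| <= M.
Proof.
move=> hz; have [Lv _] := hz; have iv := L2_norm Lv.
have J0 : 0 <= J 0 T (fun r => `|v r|) by apply: J_ge0.
exists (`|z 0| + J 0 T (fun r => `|v r|)); first by rewrite addr_ge0.
move=> t /andP[t0 tT]; rewrite -[z t](subrK (z 0)) addrC.
apply: le_trans (ler_normD _ _) _; rewrite lerD2l.
apply: le_trans (h1_lip hz (lexx 0) t0 tT) _.
by rewrite (J_split t0 tT iv) lerDl; apply: J_ge0.
Qed.

Lemma h1_wm z v : h1 z v -> wm z.
Proof.
move=> [Lv E] x.
have iv := L2_ipc x Lv.
apply: (eq_measurable_fun (fun t => ip (z 0) x + J 0 t (fun r => ip (v r) x))).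
  by move=> t; rewrite inE/= in_itv/= => /andP[t0 tT]; rewrite -E//; ring.
apply: measurable_funD => //.
apply: subspace_continuous_measurable_fun => //.
exact: (parameterized_integral_continuous (ltW T0) iv).
Qed.

Lemma L2_bounded z (M : R) : wm z -> (forall t, 0 <= t <= T -> `|z t| <= M) -> L2 z.
Proof.
move=> mz bz; split => //; apply: (@integ_bounded _ _ _ _ (M ^+ 2)); first exact: wm_norm2.
move=> t tT; rewrite normrX normr_id lerXn2r ?nnegrE// ?bz//.
exact: le_trans (bz t tT).
Qed.

Lemma h1_L2 z v : h1 z v -> L2 z.
Proof. by move=> hz; have [M _ /(L2_bounded (h1_wm hz))] := h1_bounded hz. Qed.

Definition vdif z (t : R) (d : H) : Prop :=
  forall e : R, 0 < e -> exists2 r : R, 0 < r &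
    forall s, 0 <= s <= T -> `|s - t| < r -> `|z s - z t - (s - t) *: d| <= e * `|s - t|.

Lemma h1_incr z v s t : h1 z v -> 0 <= s <= T -> 0 <= t <= T ->
  `|z s - z t| <= `|J 0 s (fun r => `|v r|) - J 0 t (fun r => `|v r|)|.
Proof.
move=> hz; wlog st : s t / s <= t.
  move=> W sT tT; have [|ts] := leP s t; first by move/W; apply.
  by rewrite distrC [leRHS]distrC; apply: W => //; exact: ltW.
move=> /andP[s0 sT] /andP[t0 tT].
have iv := L2_norm hz.1.
rewrite (J_split s0 st (integ_sub (lexx 0) tT iv)) opprD addNKr normrN.
rewrite ger0_norm; last by apply: J_ge0.
by rewrite distrC; exact: h1_lip hz s0 st tT.
Qed.

(** Weak convergence together with convergence of norms gives strong convergence. The derivative of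
    the primitive of [|v|] bounds [|D|] by about [|d| |V|], a test vector close to [V] controls the
    inner product of [D] and [V], and expanding [|D - d *: V| ^+ 2] combines the two. *)
Lemma vdif_of_sdif z v t (V := v t) : h1 z v -> 0 < t < T ->
  sdif T (fun s => J 0 s (fun r => `|v r|)) t `|V| ->
  (forall k, sdif T (fun s => J 0 s (fun r => ip (v r) (xs k))) t (ip V (xs k))) ->
  vdif z t V.
Proof.
move=> hz /andP[t0 tT] dW dk e e0.
have V0 := normr_ge0 V.
(* The expansion leaves the factor 6 |V| n + 2 n + 3 n^2, at most n (6 |V| + 5) once n <= 1. *)
pose n : R := Num.min 1 (e ^+ 2 / (6 * `|V| + 5)).
have den : 0 < 6 * `|V| + 5 by lra.
have n0 : 0 < n by rewrite lt_min ltr01 divr_gt0// exprn_gt0.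
have n1 : n <= 1 by rewrite ge_min lexx.
have n2 : n * (6 * `|V| + 5) <= e ^+ 2.
  by rewrite -ler_pdivlMr// ge_min lexx orbT.
have [k Vk] := xs_dense V n0.
have [r1 r10 K1] := dW n n0; have [r2 r20 K2] := dk k n n0.
exists (Num.min r1 r2); first by rewrite lt_min r10.
move=> s sT; rewrite lt_min => /andP[s1 s2].
have {}K1 := K1 s sT s1; have {}K2 := K2 s sT s2.
have tT' : 0 <= t <= T by rewrite !ltW.
set D := z s - z t; set d := s - t in s1 s2 K1 K2 *.
have DW : `|D| <= `|d| * (`|V| + n).
  apply: le_trans (h1_incr hz sT tT') _.
  set A := J 0 s _ - J 0 t _ in K1 *.
  rewrite -[A](subrK (d * `|V|)); apply: le_trans (ler_normD _ _) _.
  rewrite normrM normr_id; move: K1; lra.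
have Dk : `|ip D (xs k) - d * ip V (xs k)| <= n * `|d|.
  have E p : 0 <= p <= T -> J 0 p (fun r => ip (v r) (xs k)) = ip (z p) (xs k) - ip (z 0) (xs k).
    by move=> /andP[p0 pT]; rewrite hz.2.
  have -> : ip D (xs k) = J 0 s (fun r => ip (v r) (xs k)) - J 0 t (fun r => ip (v r) (xs k)).
    by rewrite !E// /D (ipBl ipH); ring.
  exact: K2.
have h1_ : `|ip D (V - xs k)| <= `|d| * (`|V| + n) * n.
  apply: le_trans (ip_cs ipH _ _) _; apply: ler_pM => //; exact: ltW.
have h2_ : `|ip V (V - xs k)| <= `|V| * n.
  apply: le_trans (ip_cs ipH _ _) _; rewrite ler_wpM2l//; exact: ltW.
have sq : `|D - d *: V| ^+ 2 <= (e * `|d|) ^+ 2.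
  rewrite (norm2B ipH) (ipZr ipH) normrZ.
  have dd : d ^+ 2 = `|d| ^+ 2 by rewrite real_normK ?num_real.
  have EV : ip D V = d * `|V| ^+ 2 + (ip D (xs k) - d * ip V (xs k)) + ip D (V - xs k)
      - d * ip V (V - xs k).
    by rewrite !(ipBr ipH) -(ipxx ipH); ring.
  have l1 : - (d * (ip D (xs k) - d * ip V (xs k))) <= `|d| * (n * `|d|).
    apply: le_trans (ler_norm _) _; rewrite normrN normrM ler_wpM2l//.
  have l2 : - (d * ip D (V - xs k)) <= `|d| * (`|d| * (`|V| + n) * n).
    apply: le_trans (ler_norm _) _; rewrite normrN normrM ler_wpM2l//.
  have l3 : d * (d * ip V (V - xs k)) <= `|d| * (`|d| * (`|V| * n)).
    apply: le_trans (ler_norm _) _; rewrite normrM ler_wpM2l// normrM ler_wpM2l//.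
  have l4 : `|D| ^+ 2 <= (`|d| * (`|V| + n)) ^+ 2.
    by rewrite lerXn2r ?nnegrE// mulr_ge0// addr_ge0// ltW.
  have lE : d * ip D V = d ^+ 2 * `|V| ^+ 2 + d * (ip D (xs k) - d * ip V (xs k))
      + d * ip D (V - xs k) - d * (d * ip V (V - xs k)) by rewrite EV; ring.
  apply: le_trans (_ : `|d| ^+ 2 * (6 * `|V| * n + 2 * n + 3 * n ^+ 2) <= _).
    rewrite dd in lE; rewrite !exprMn !mulrDr in l4 *.
    rewrite lE; lra.
  rewrite exprMn mulrC ler_wpM2r ?sqr_ge0//.
  have : n ^+ 2 <= n by rewrite expr2 ler_piMr// ltW.
  lra.
rewrite -[leLHS]ger0_norm// -[leRHS]ger0_norm ?mulr_ge0 ?(ltW e0)//.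
by rewrite -ler_sqr ?nnegrE// !real_normK ?num_real.
Qed.

(** Only the countably many tests [xs k] occur, so their exceptional sets merge into one null
    set. *)
Lemma h1_dif_ae z v : h1 z v -> {ae mu, forall t, 0 < t < T -> vdif z t (v t) /\
  sdif T (fun s => J 0 s (fun r => `|v r|)) t `|v t|}.
Proof.
move=> hz; have [Lv _] := hz.
have A := ftc_ae T0 (L2_norm Lv).
have B : {ae mu, forall t, forall k, 0 < t < T ->
    sdif T (fun s => J 0 s (fun r => ip (v r) (xs k))) t (ip (v t) (xs k))}.
  by apply: ae_foralln => k; exact: (ftc_ae T0 (L2_ipc (xs k) Lv)).
apply: aeS (aeI A B) => t [a b] tT; split; last exact: a.
by apply: vdif_of_sdif => // [|k]; [exact: a|exact: b].
Qed.

Lemma vdif_unique z t d1 d2 : 0 < t < T -> vdif z t d1 -> vdif z t d2 -> d1 = d2.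
Proof.
move=> /andP[t0 tT] h g; apply/eqP; rewrite -subr_eq0 -normr_eq0 eq_le normr_ge0 andbT.
apply/ler_addgt0Pr => e e0; rewrite add0r.
have e2 : 0 < e / 2 by rewrite divr_gt0.
have [r1 r10 K1] := h _ e2; have [r2 r20 K2] := g _ e2.
pose d := Num.min (Num.min r1 r2) (T - t) / 2.
have d0 : 0 < d by rewrite divr_gt0// !lt_min r10 r20 subr_gt0.
have m0 : 2 * d = Num.min (Num.min r1 r2) (T - t) by rewrite mulrC divfK.
have dr1 : 2 * d <= r1 by rewrite m0 !ge_min lexx.
have dr2 : 2 * d <= r2 by rewrite m0 !ge_min lexx !orbT.
have dT : 2 * d <= T - t by rewrite m0 ge_min lexx orbT.
have sE : t + d - t = d by rewrite addrAC subrr add0r.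
have sT : 0 <= t + d <= T by apply/andP; split; lra.
have := K1 (t + d) sT; have := K2 (t + d) sT; rewrite sE gtr0_norm//.
have -> : d < r1 by lra.
have -> : d < r2 by lra.
move=> /(_ isT) k2 /(_ isT) k1.
have : `|d *: (d1 - d2)| <= e * d.
  have -> : d *: (d1 - d2) = (z (t + d) - z t - d *: d2) - (z (t + d) - z t - d *: d1).
    by rewrite scalerBr opprB [RHS]addrC addrA subrK.
  apply: le_trans (ler_normB _ _) _; lra.
by rewrite normrZ gtr0_norm// mulrC ler_pM2r.
Qed.

Lemma ae_interior (Q : R -> Prop) : {ae mu, forall t, 0 < t < T -> Q t} ->
  {ae mu, forall t, 0 <= t <= T -> Q t}.
Proof.
have a0 (c : R) : {ae mu, forall t, t != c :> R}.
  exists [set c]; split => //; first exact: lebesgue_measure_set1.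
  by move=> x /= /negP; rewrite negbK => /eqP.
move=> h; apply: aeS (aeI (aeI (a0 0) (a0 T)) h) => t [[t0 tT] K] /andP[t1 t2].
by apply: K; rewrite !lt_neqAle t1 t2 tT eq_sym t0.
Qed.

Lemma h1_unique z v v' : h1 z v -> h1 z v' ->
  {ae mu, forall t, 0 <= t <= T -> v t = v' t}.
Proof.
move=> h g; apply: ae_interior.
apply: aeS (aeI (h1_dif_ae h) (h1_dif_ae g)) => t [a b] tT.
by apply: (vdif_unique tT); [exact: (a tT).1|exact: (b tT).1].
Qed.

Lemma vdif_lip z t d : vdif z t d -> exists2 r : R, 0 < r &
  forall s, 0 <= s <= T -> `|s - t| < r -> `|z s - z t| <= (`|d| + 1) * `|s - t|.
Proof.
move=> /(_ 1 ltr01)[r r0 K]; exists r => // s sT st.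
rewrite -[z s - z t](subrK ((s - t) *: d)); apply: le_trans (ler_normD _ _) _.
have := K s sT st; rewrite normrZ; lra.
Qed.

Lemma sdif_ip x y t dx dy : vdif x t dx -> vdif y t dy ->
  sdif T (fun s => ip (x s) (y s)) t (ip dx (y t) + ip (x t) dy).
Proof.
move=> hx hy e e0.
have [r1 r10 K1] := vdif_lip hx; have [r2 r20 K2] := vdif_lip hy.
pose c := `|x t| + `|y t| + 1 + (`|dx| + 1) * (`|dy| + 1).
have c0 : 0 < c.
  have : 0 <= (`|dx| + 1) * (`|dy| + 1) by rewrite mulr_ge0// addr_ge0.
  have := normr_ge0 (x t); have := normr_ge0 (y t); rewrite /c; lra.
have ec : 0 < e / c by rewrite divr_gt0.
have [r3 r30 K3] := hx _ ec; have [r4 r40 K4] := hy _ ec.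
(* The radius [e / c] makes the product of the two increments, quadratic in [s - t], a small
   multiple of [|s - t|]. *)
exists (Num.min (Num.min (Num.min r1 r2) (Num.min r3 r4)) (e / c)).
  by rewrite !lt_min r10 r20 r30 r40.
move=> s sT; rewrite !lt_min => /andP[/andP[/andP[s1 s2] /andP[s3 s4]] s5].
have {}K1 := K1 s sT s1; have {}K2 := K2 s sT s2.
have {}K3 := K3 s sT s3; have {}K4 := K4 s sT s4.
set d := s - t in s1 s2 s3 s4 s5 K1 K2 K3 K4 *.
set Dx := x s - x t in K1 K3 *; set Dy := y s - y t in K2 K4 *.
have -> : ip (x s) (y s) - ip (x t) (y t) - d * (ip dx (y t) + ip (x t) dy) =
    ip (Dx - d *: dx) (y t) + ip (x t) (Dy - d *: dy) + ip Dx Dy.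
  by rewrite /Dx /Dy !(ipBl ipH, ipBr ipH, ipZl ipH, ipZr ipH); ring.
have d0 := normr_ge0 d.
have l1 : `|ip (Dx - d *: dx) (y t)| <= e / c * `|d| * `|y t|.
  by apply: le_trans (ip_cs ipH _ _) _; exact: ler_wpM2r.
have l2 : `|ip (x t) (Dy - d *: dy)| <= `|x t| * (e / c * `|d|).
  by apply: le_trans (ip_cs ipH _ _) _; exact: ler_wpM2l.
have l3 : `|ip Dx Dy| <= ((`|dx| + 1) * (`|dy| + 1)) * (e / c * `|d|).
  apply: le_trans (ip_cs ipH _ _) _; apply: le_trans (ler_pM _ _ K1 K2) _ => //.
  rewrite mulrACA ler_wpM2l//.
  by rewrite ler_wpM2r// ltW.
apply: le_trans (ler_normD _ _) _; apply: le_trans (lerD (ler_normD _ _) l3) _.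
apply: le_trans (lerD (lerD l1 l2) (lexx _)) _.
have -> : e * `|d| = c * (e / c * `|d|) by field; rewrite gt_eqF.
have : 0 <= e / c * `|d| by rewrite mulr_ge0// ltW.
rewrite /c; move: (e / c * `|d|) => q q0; lra.
Qed.

Lemma h1_prod x x' y y' b : h1 x x' -> h1 y y' -> 0 <= b <= T ->
  ip (x b) (y b) - ip (x 0) (y 0) = J 0 b (fun t => ip (x' t) (y t) + ip (x t) (y' t)).
Proof.
move=> hx hy /andP[]; rewrite le_eqVlt => /predU1P[<- _|b0 bT].
  by rewrite J_point subrr.
have [Mx Mx0 bx] := h1_bounded hx; have [My My0 by_] := h1_bounded hy.
have Lx := h1_L2 hx; have Ly := h1_L2 hy.
have i1 := integ_sub (lexx 0) bT (L2_norm hx.1).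
have i2 := integ_sub (lexx 0) bT (L2_norm hy.1).
apply: (@ac_ftc R b (fun t => ip (x t) (y t)) (fun t => My * `|x' t| + Mx * `|y' t|)) => //.
- by apply: integD; apply: integZ.
- apply: (integ_sub (lexx 0) bT); apply: integD; apply: L2_ip => //.
  + exact: hx.1.
  + exact: hy.1.
- by move=> t _; rewrite addr_ge0// mulr_ge0.
- move=> s t s0 st tb.
  have tT := le_trans tb bT.
  rewrite JD; [|by apply: integZ; exact: integ_sub s0 tT (L2_norm hx.1)|
    by apply: integZ; exact: integ_sub s0 tT (L2_norm hy.1)].
  rewrite !JZ; [|exact: integ_sub s0 tT (L2_norm hy.1)|exact: integ_sub s0 tT (L2_norm hx.1)].
  have -> : ip (x t) (y t) - ip (x s) (y s) = ip (x t - x s) (y t) + ip (x s) (y t - y s).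
    by rewrite (ipBl ipH) (ipBr ipH); ring.
  apply: le_trans (ler_normD _ _) _; apply: lerD.
    apply: le_trans (ip_cs ipH _ _) _; rewrite mulrC; apply: ler_pM => //.
      by apply: by_; rewrite (le_trans s0 st).
    exact: h1_lip hx _ _ _.
  apply: le_trans (ip_cs ipH _ _) _; apply: ler_pM => //.
    by apply: bx; rewrite s0 (le_trans st).
  exact: h1_lip hy _ _ _.
- apply: aeS (aeI (h1_dif_ae hx) (h1_dif_ae hy)) => t [a c] /andP[t0 tb].
  have tT : 0 < t < T by rewrite t0 (lt_le_trans tb).
  by apply: (sdifW bT); apply: sdif_ip; [exact: (a tT).1|exact: (c tT).1].
Qed.

End HilbertCurves.

(** * Step functions and weak convergence of derivatives *)

Section StepApproximation.
Variables (R : realType) (T : R) (H : completeNormedModType R) (ip : H -> H -> R).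
Hypothesis T0 : 0 < T.
Hypothesis ipH : inner_product ip.
Variable xs : nat -> H.
Hypothesis xs_dense : forall (x : H) (e : R), 0 < e -> exists k, `|x - xs k| < e.
Notation mu := (@lebesgue_measure R).
Notation h1 := (h1 T ip).
Notation L2 := (L2 T ip).
Notation wm := (wm T ip).

Implicit Types (u v w y z : R -> H).

(* Piecewise constant averages of the derivative of [y]; the value [0] from [T]
   on avoids reading [y] outside [[0, T]]. *)
Definition stp (h : R) y (t : R) : H :=
  if t < T then h^-1 *: (y (hi h t) - y (lo h t)) else 0.

Lemma stp_slope (N : nat) y t (x : H) : 0 < t < T ->
  ip (stp (T / N%:R) y t) x = slope (fun s => ip (y s) x) (T / N%:R) t.
Proof.
move=> /andP[_ tT]; rewrite /stp tT (ipZl ipH) (ipBl ipH) /slope mulrC.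
by [].
Qed.

Lemma stp_wm (k : nat) y : wm (stp (T / k.+1%:R) y).
Proof.
move=> x; apply: integ_meas.
apply: (@integ_ext_oo R 0 T (slope (fun s => ip (y s) x) (T / k.+1%:R))).
  by move=> t tT; rewrite stp_slope.
exact: (J_slope _ T0 (ltn0Sn k)).1.
Qed.

(** Jensen's inequality on a cell: the squared average of [y'] is at most the average of its square,
    a grid quotient of the primitive of [|y'|^2]. *)
Lemma stp_le y y' k t (h := T / k.+1%:R) : h1 y y' -> 0 <= t <= T ->
  `|stp h y t| ^+ 2 <= `|slope (fun s => J 0 s (fun r => `|y' r| ^+ 2)) h t|.
Proof.
move=> hy /andP[t0 tT]; rewrite /stp; case: ifPn => [tT'|_]; last first.
  by rewrite normr0 expr0n.
have hp : 0 < h by rewrite divr_gt0.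
have [l0 /andP[l1 l2]] := lo_bounds hp t0.
have l3 : hi h t <= T by apply: hi_le => //; rewrite t0.
have hE : hi h t - lo h t = h by rewrite /hi addrAC subrr add0r.
have llh : lo h t <= hi h t by rewrite (le_trans l1)// ltW.
rewrite normrZ exprMn real_normK ?num_real//.
have i2 := integ_sub (lexx 0) l3 hy.1.2.
rewrite /slope (J_split l0 llh i2) addrAC subrr add0r ger0_norm; last first.
  by rewrite divr_ge0 ?(ltW hp)//; apply: J_ge0 => r _; exact: sqr_ge0.
have := h1_holder ipH xs_dense hy l0 llh l3; rewrite hE => K.
have h2 : 0 <= h^-1 ^+ 2 by exact: sqr_ge0.
apply: le_trans (ler_wpM2l h2 K) _.
by rewrite le_eqVlt; apply/orP; left; apply/eqP; field; rewrite gt_eqF.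
Qed.

Lemma stp_L2 y y' k : h1 y y' -> L2 (stp (T / k.+1%:R) y).
Proof.
move=> hy; split; first exact: stp_wm.
apply: (@integ_dom R 0 T _
  (fun t => `|slope (fun s => J 0 s (fun r => `|y' r| ^+ 2)) (T / k.+1%:R) t|)).
- exact: (wm_norm2 ipH xs_dense (stp_wm k y)).
- by move=> t tT; rewrite ger0_norm ?sqr_ge0//; apply: stp_le.
- by apply: integ_abs; exact: (J_slope _ T0 (ltn0Sn k)).1.
Qed.

Lemma stp_cvg y t (d : H) : 0 < t < T -> vdif T y t d ->
  (fun k => `|stp (T / k.+1%:R) y t - d|) @ \oo --> (0 : R).
Proof.
move=> /andP[t0 tT] D; apply/cvgrPdist_le => e e0.
have [r r0 K] := D e e0.
have hr : (fun k => T / k.+1%:R) @ \oo --> (0 : R).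
  rewrite -(mulr0 T); apply: cvgMr; exact: cvg_harmonic.
have [M _ HM] := (cvgrPdist_lt _ _).1 hr r r0; exists M => // k /HM /=.
set h := T / k.+1%:R; rewrite !sub0r !normrN normr_id => hr1.
have h0 : 0 < h by rewrite divr_gt0.
rewrite gtr0_norm// in hr1.
have [l0 /andP[l1 l2]] := lo_bounds h0 (ltW t0).
have l3 : hi h t <= T by apply: hi_le => //; rewrite (ltW t0) tT.
have := K (hi h t); have := K (lo h t).
have E1 : `|lo h t - t| = t - lo h t by rewrite distrC ger0_norm// subr_ge0.
have E2 : `|hi h t - t| = hi h t - t by rewrite gtr0_norm// subr_gt0.
have hE : hi h t - lo h t = h by rewrite /hi addrAC subrr add0r.
rewrite E1 E2 => K1 K2.
have {}K1 : `|y (lo h t) - y t - (lo h t - t) *: d| <= e * (t - lo h t).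
  by apply: K1; [rewrite l0/=|]; lra.
have {}K2 : `|y (hi h t) - y t - (hi h t - t) *: d| <= e * (hi h t - t).
  by apply: K2; [apply/andP; split|]; lra.
rewrite /stp tT.
have -> : h^-1 *: (y (hi h t) - y (lo h t)) - d =
   h^-1 *: ((y (hi h t) - y t - (hi h t - t) *: d) - (y (lo h t) - y t - (lo h t - t) *: d)).
  rewrite -[d in LHS](scalerK (_ : h != 0)) ?gt_eqF// -scalerBr; congr (_ *: _).
  have -> : h *: d = (hi h t - t) *: d - (lo h t - t) *: d.
    by rewrite -scalerBl; congr (_ *: _); rewrite opprB addrA subrK hE.
  set a := y (hi h t); set b := y (lo h t); set c := y t.
  set p := (hi h t - t) *: d; set q := (lo h t - t) *: d.
  by rewrite !opprB [q + (c - b)]addrC [RHS]addrACA [a - c + _]addrA subrK [- p + q]addrC.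
rewrite normrZ normfV (gtr0_norm h0) mulrC ler_pdivrMr//.
apply: (le_trans (ler_normB _ _)); apply: (le_trans (lerD K2 K1)).
have eh : e * h = e * (hi h t - lo h t) by rewrite hE.
by rewrite eh -mulrDr le_eqVlt; apply/orP; left; apply/eqP; congr (_ * _); ring.
Qed.

(** The dominating quotients from [stp_le] have the integral of [|y'|^2] on every grid, so [J_gdct]
    applies. *)
Lemma stp_L2_cvg y y' : h1 y y' ->
  (fun k => J 0 T (fun t => `|stp (T / k.+1%:R) y t - y' t| ^+ 2)) @ \oo --> (0 : R).
Proof.
move=> hy.
pose W s := J 0 s (fun r => `|y' r| ^+ 2).
pose h (k : nat) := T / k.+1%:R.
pose G k t := `|slope W (h k) t|.
have iW k := (J_slope W T0 (ltn0Sn k)).1.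
have W_le k t : 0 < t < T -> G k t = slope W (h k) t.
  move=> /andP[t0 tT]; have hp : 0 < h k by rewrite divr_gt0.
  have [l0 /andP[l1 l2]] := lo_bounds hp (ltW t0).
  have l3 : hi (h k) t <= T by apply: hi_le => //; rewrite ltW.
  have llh : lo (h k) t <= hi (h k) t by rewrite (le_trans l1)// ltW.
  rewrite /G ger0_norm// divr_ge0 ?(ltW hp)// /W.
  rewrite (J_split l0 llh (integ_sub (lexx 0) l3 hy.1.2)) addrAC subrr add0r.
  by apply: J_ge0 => r _; exact: sqr_ge0.
have dW := ftc_ae T0 hy.1.2.
have dy := h1_dif_ae T0 ipH xs_dense hy.
have [] // := @J_gdct R T (fun k t => `|stp (h k) y t - y' t| ^+ 2) G
  (fun t => `|y' t| ^+ 2) _ _ hy.1.2.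
- move=> k; apply: (wm_norm2 ipH xs_dense); apply: wmB => //; first exact: stp_wm.
  exact: hy.1.1.
- by move=> k; apply: integ_abs; exact: iW.
- by move=> k t tT; split; [exact: sqr_ge0|split; [exact: normr_ge0|exact: sqr_ge0]].
- apply: aeW => t tT k; have := stp_le k hy tT; rewrite -/(h k) -/(G k t).
  have := sqr_ge0 `|stp (h k) y t + y' t|; rewrite (norm2B ipH) (norm2D ipH); lra.
- apply: ae_interior; apply: aeS dy => t D tT; have [vd _] := D tT.
  have := stp_cvg tT vd => c.
  rewrite -(mulr0 0); apply: cvg_trans; last exact: (cvgM c c).
  by apply: near_eq_cvg; apply: nearW => k; rewrite expr2.
- apply: ae_interior; apply: aeS dW => t D tT.
  have c := slope_cvg tT (D tT).
  apply: cvg_trans c; apply: near_eq_cvg; apply: nearW => k; exact/esym/W_le.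
- move=> k; rewrite -(@J_ext_oo R 0 T (slope W (h k))); last exact: iW.
    by rewrite (J_slope W T0 (ltn0Sn k)).2 /W J_point subr0.
  by move=> t tT; rewrite W_le.
Qed.

(** Against a constant on a cell, [u'] integrates to an increment of [u], of norm at most 2 e. The
    bound grows with [k], but is used with the grid fixed before [e] tends to 0. *)
Lemma J_ip_stp u u' y k (h := T / k.+1%:R) (e M : R) : h1 u u' ->
  (forall t, 0 <= t <= T -> `|u t| <= e) ->
  (forall t, 0 <= t <= T -> `|y t| <= M) ->
  `|J 0 T (fun t => ip (u' t) (stp h y t))| <= k.+1%:R * (2 * e * (2 * M / h)).
Proof.
move=> hu ue yM.
have hp : 0 < h by rewrite divr_gt0.
have TN : T = k.+1%:R * h by rewrite /h mulrCA divff ?mulr1// pnatr_eq0.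
pose c (i : nat) := h^-1 *: (y (i.+1%:R * h) - y (i%:R * h)).
pose a (i : nat) := ip (u (i.+1%:R * h) - u (i%:R * h)) (c i).
have bnd i : (i <= k.+1)%N -> 0 <= i%:R * h <= T.
  by move=> ik; rewrite mulr_ge0 ?(ltW hp)//= TN ler_pM2r// ler_nat.
have [|_ JE] := @J_cells R k.+1 h (fun t => ip (u' t) (stp h y t)) a hp.
  move=> i ik.
  have /andP[b1 b2] := bnd i (ltnW ik); have /andP[b3 b4] := bnd i.+1 ik.
  have le2 : i%:R * h <= i.+1%:R * h by rewrite ler_pM2r// ler_nat.
  have E x : i%:R * h < x < i.+1%:R * h -> ip (u' x) (c i) = ip (u' x) (stp h y x).
    move=> /andP[q1 q2]; have Q : i%:R * h <= x < i.+1%:R * h by rewrite q2 ltW.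
    by rewrite /stp (lo_cell hp Q) (hi_cell hp Q) (lt_le_trans q2 b4).
  have ii := integ_sub b1 b4 (L2_ipc ipH (c i) hu.1).
  split; first exact: integ_ext_oo E ii.
  by rewrite -(J_ext_oo E ii) /a (ipBl ipH) hu.2.
rewrite -TN in JE; rewrite JE.
apply: le_trans (ler_norm_sum _ _ _) _.
apply: le_trans (_ : \sum_(0 <= i < k.+1) (2 * e * (2 * M / h)) <= _); last first.
  by rewrite sumr_const_nat subn0 -[leLHS]mulr_natl.
rewrite big_nat_cond [leRHS]big_nat_cond; apply: ler_sum => i /andP[/andP[_ ik] _].
have b1 := bnd i (ltnW ik); have b2 := bnd i.+1 ik.
have e0 : 0 <= e := le_trans (normr_ge0 _) (ue _ b1).
apply: le_trans (ip_cs ipH _ _) _; apply: ler_pM => //.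
  by apply: le_trans (ler_normB _ _) _; have := ue _ b1; have := ue _ b2; lra.
rewrite /c normrZ normfV (gtr0_norm hp) mulrC ler_wpM2r ?invr_ge0 ?(ltW hp)//.
by apply: le_trans (ler_normB _ _) _; have := yM _ b1; have := yM _ b2; lra.
Qed.

(** Replace [y'] by a step function: the error is small uniformly in [n] by Cauchy-Schwarz and the
    bound [K], and the step function part vanishes by [J_ip_stp]. *)
Lemma h1_weak0 (u u' : nat -> R -> H) (K : R) y y' :
  (forall n, h1 (u n) (u' n)) ->
  (forall n, J 0 T (fun t => `|u' n t| ^+ 2) <= K) ->
  (forall e : R, 0 < e -> \forall n \near \oo, forall t, 0 <= t <= T -> `|u n t| <= e) ->
  h1 y y' ->
  (fun n => J 0 T (fun t => ip (u' n t) (y' t))) @ \oo --> (0 : R).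
Proof.
move=> hu uK u0 hy.
have K0 : 0 <= K by apply: le_trans (uK 0%N); apply: J_ge0 => t _; exact: sqr_ge0.
apply/cvgrPdist_le => e e0.
have e1 : 0 < (e / 2) ^+ 2 / (K + 1) by rewrite divr_gt0 ?exprn_gt0 ?divr_gt0// ltr_wpDl.
have [k _ Hk] := (cvgrPdist_le _ _).1 (stp_L2_cvg hy) _ e1.
have := Hk k (leqnn k) => /=; set h := T / k.+1%:R.
rewrite sub0r normrN ger0_norm; last by apply: J_ge0 => t _; exact: sqr_ge0.
move=> Jk; have hp : 0 < h by rewrite divr_gt0.
have [M M0 yM] := h1_bounded ipH xs_dense hy.
have d0 : 0 < k.+1%:R * (2 * (2 * (M + 1) / h)).
  by rewrite mulr_gt0// mulr_gt0// divr_gt0// mulr_gt0// ltr_wpDl.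
have [N _ HN] := u0 (e / 2 / (k.+1%:R * (2 * (2 * (M + 1) / h)))) (divr_gt0 (divr_gt0 e0 (ltr0Sn _ 1)) d0).
exists N => // n /HN un /=; rewrite sub0r normrN.
have Lu := (hu n).1; have Ls := stp_L2 k hy; have Ly := hy.1.
have yM' t : 0 <= t <= T -> `|y t| <= M + 1 by move=> /yM; lra.
have b1 := J_ip_stp k (hu n) un yM'; rewrite -/h in b1.
have b2 : `|J 0 T (fun t => ip (u' n t) (y' t - stp h y t))| <= e / 2.
  have Lb : L2 (fun t => y' t - stp h y t) by exact: (L2B ipH xs_dense Ly Ls).
  have cs := J_ip_cs T0 ipH xs_dense Lu Lb.
  rewrite -[leRHS]ger0_norm ?divr_ge0 ?(ltW e0)// -ler_sqr ?nnegrE//.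
  rewrite !real_normK ?num_real//; apply: le_trans cs _.
  have Jk' : J 0 T (fun t => `|y' t - stp h y t| ^+ 2) <= (e / 2) ^+ 2 / (K + 1).
    by rewrite (@J_ext _ 0 T _ (fun t => `|stp h y t - y' t| ^+ 2))// => t _; rewrite distrC.
  apply: le_trans (ler_pM _ _ (uK n) Jk') _.
  - by apply: J_ge0 => t _; exact: sqr_ge0.
  - by apply: J_ge0 => t _; exact: sqr_ge0.
  rewrite mulrCA ler_piMr ?sqr_ge0// ler_pdivrMr ?ltr_wpDl// mul1r; lra.
have -> : J 0 T (fun t => ip (u' n t) (y' t)) =
    J 0 T (fun t => ip (u' n t) (stp h y t)) + J 0 T (fun t => ip (u' n t) (y' t - stp h y t)).
  rewrite -JD; [|exact: (L2_ip ipH xs_dense)|apply: (L2_ip ipH xs_dense) => //; exact: (L2B ipH xs_dense Ly Ls)].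
  by apply: J_ext => t _; rewrite (ipBr ipH) addrCA subrr addr0.
apply: le_trans (ler_normD _ _) _; rewrite [leRHS](splitr e); apply: lerD => //.
apply: le_trans b1 _; rewrite le_eqVlt; apply/orP; left; apply/eqP; field.
by apply/and3P; split; apply: lt0r_neq0 => //; exact: ltr_wpDl.
Qed.

End StepApproximation.

(** * Integrals of functions equal almost everywhere *)

Section AlmostEverywhereEqual.
Variable R : realType.
Notation mu := (@lebesgue_measure R).
Import HBNNSimple.

(* The integral of a nonnegative function is a supremum over simple minorants,
   so no measurability is needed to change the function on a null set. *)
Lemma ge0_le_integral_ae (f g : R -> \bar R) :
  (forall x, (0 <= f x)%E) -> (forall x, (0 <= g x)%E) ->
  {ae mu, forall x, (f x <= g x)%E} ->
  (\int[mu]_x f x <= \int[mu]_x g x)%E.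
Proof.
move=> f0 g0 [N [mN N0 fgN]].
rewrite !ge0_integralTE//; apply: ge_ereal_sup => _ [h hf <-].
pose h' := proj_nnsfun h (measurableC mN).
have h'E x : h' x = if x \in N then 0 else h x.
  rewrite /h' /proj_nnsfun/= mindicE in_setC.
  by case: (x \in N); rewrite ?mulr0 ?mulr1.
have -> : sintegral mu h = sintegral mu h'.
  rewrite -!integralT_nnsfun; apply: ae_eq_integral => //.
  - by apply/measurable_EFinP.
  - by apply/measurable_EFinP.
  - exists N; split => // x /= /not_implyP[_]; apply: contra_notP => xN.
    by congr EFin; apply/esym; have := h'E x; rewrite memNset.
apply: ereal_sup_ubound; exists h' => // x; rewrite h'E.
case: ifPn => [//|]; rewrite notin_setE => xN.
apply: le_trans (hf x) _; apply: contrapT => fg; apply: xN; exact: fgN.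
Qed.

Lemma ge0_integral_ae_eq (D : set R) (f g : R -> \bar R) :
  (forall x, D x -> (0 <= f x)%E) -> (forall x, D x -> (0 <= g x)%E) ->
  {ae mu, forall x, D x -> f x = g x} ->
  (\int[mu]_(x in D) f x = \int[mu]_(x in D) g x)%E.
Proof.
move=> f0 g0 fg; rewrite integral_mkcond [RHS]integral_mkcond.
have p (k : R -> \bar R) : (forall x, D x -> (0 <= k x)%E) -> forall x, (0 <= (k \_ D) x)%E.
  by move=> k0 x; rewrite patchE; case: ifPn => // /set_mem /k0.
apply/eqP; rewrite eq_le; apply/andP; split;
  apply: ge0_le_integral_ae; try exact: p;
  by apply: aeS fg => x H; rewrite !patchE; case: ifPn => // /set_mem /H ->.
Qed.

(** A strongly measurable function is only an almost everywhere limit of simple ones and need not be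
    Borel; this lets its Borel version replace it under the integral. *)
Lemma integral_ae_eq_fun (D : set R) (f g : R -> \bar R) :
  {ae mu, forall x, D x -> f x = g x} ->
  (\int[mu]_(x in D) f x = \int[mu]_(x in D) g x)%E.
Proof.
move=> fg; rewrite integralE [RHS]integralE; congr (_ - _)%E;
  apply: ge0_integral_ae_eq => //;
  by apply: aeS fg => x H /H; rewrite ?funeposE ?funenegE => ->.
Qed.

End AlmostEverywhereEqual.

(** * Strong measurability *)

Section StronglyMeasurable.
Variables (R : realType) (V : normedModType R) (T : R).
Notation mu := (@lebesgue_measure R).
Notation I := (`[0, T]%classic : set R).

(** With finitely many values, the preimage of any set at all is a finite union of level sets. *)
Lemma simple_fun_comp (W : Type) (s : R -> V) (h : V -> W) :
  simple_fun s -> forall B : set W, measurable ((h \o s) @^-1` B).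
Proof.
move=> [fs ms] B.
have -> : (h \o s) @^-1` B = \bigcup_(v in range s `&` h @^-1` B) (s @^-1` [set v]).
  apply/seteqP; split => [x /= Bx|x [v [_ Bv] /= ->//]].
  by exists (s x) => //; split => //; exists x.
apply: fin_bigcup_measurable; first exact: finite_setIl.
by move=> v _; exact: ms.
Qed.

Lemma simple_fun_comp_fun (W : normedModType R) (s : R -> V) (h : V -> W) :
  simple_fun s -> simple_fun (h \o s).
Proof.
move=> sf; split; last by move=> v; exact: simple_fun_comp.
case: sf => fs _; rewrite (_ : range (h \o s) = h @` range s); last by rewrite image_comp.
exact: (finite_image h fs).
Qed.

Lemma simple_fun_lin (a : R) (s r : R -> V) : simple_fun s -> simple_fun r ->
  simple_fun (fun t => a *: s t + r t).
Proof.
move=> [fs ms] [fr mr]; split.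
  apply: (@sub_finite_set _ _ [set a *: x + y | x in range s & y in range r]).
    by move=> _ [t _ <-]; exists (s t); [exists t|exists (r t); [exists t|]].
  exact: finite_image2.
move=> v.
have -> : (fun t => a *: s t + r t) @^-1` [set v] =
    \bigcup_(x in range s) (s @^-1` [set x] `&` r @^-1` [set v - a *: x]).
  apply/seteqP; split => [t /= E|t [x _ [/= <- E]]].
    by exists (s t); [exists t|split => //=; rewrite -E addrC addKr].
  by rewrite /= E addrC subrK.
apply: fin_bigcup_measurable => // x _; apply: measurableI; [exact: ms|exact: mr].
Qed.

Lemma strongly_meas_lin (a : R) (f g : R -> V) : strongly_meas T f -> strongly_meas T g ->
  strongly_meas T (fun t => a *: f t + g t).
Proof.
move=> [s [ss sf]] [r [sr rg]].
exists (fun k t => a *: s k t + r k t); split; first by move=> k; exact: simple_fun_lin.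
apply: aeS (aeI sf rg) => t [A B] It.
by apply: cvgD; [apply: cvgZr; exact: A|exact: B].
Qed.

Lemma strongly_meas_comp (W : normedModType R) (h : V -> W) (f : R -> V) :
  continuous h -> strongly_meas T f -> strongly_meas T (h \o f).
Proof.
move=> ch [s [ss sf]]; exists (fun k => h \o s k); split.
  by move=> k; exact: simple_fun_comp_fun.
apply: aeS sf => t A It; apply: continuous_cvg; [exact: ch|exact: A].
Qed.

(** Once [f] is set to 0 on a measurable null set containing the exceptional times, the simple
    functions, modified likewise, converge at every time of [[0, T]]. The same [f'] serves every
    [h]. *)
Lemma strongly_meas_borel (f : R -> V) : strongly_meas T f -> exists2 f' : R -> V,
  {ae mu, forall t, I t -> f t = f' t} &
  forall h : V -> R, continuous h -> measurable_fun I (fun t => h (f' t)).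
Proof.
move=> [s [ss [N [mN N0 HN]]]].
exists (fun t => if t \in N then 0 else f t).
  exists N; split => // t /= /not_implyP[_]; apply: contra_notP => tN.
  by rewrite memNset.
move=> h ch.
apply: (@measurable_fun_cvg _ _ _ _ (fun k t => if t \in N then h 0 else h (s k t))).
  move=> k; apply: measurable_fun_if => //.
  - apply: (measurable_fun_bool true); rewrite (_ : _ @^-1` _ = N).
      exact: measurableI.
    by apply/seteqP; split => x /=; [move/set_mem|move/mem_set].
  - apply: (@measurable_funS _ _ _ _ setT) => // _ B mB; rewrite setTI.
    exact: (simple_fun_comp h (ss k)).
move=> t It /=; case: ifPn => [tN|]; first exact: cvg_cst.
rewrite notin_setE => tN; apply: continuous_cvg; first exact: ch.
by move: It; apply: contrapT => K; apply: tN; apply: HN.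
Qed.

Lemma Lp_int_ae (p : nat) (f g : R -> V) :
  {ae mu, forall t, I t -> f t = g t} -> Lp_int T p f = Lp_int T p g.
Proof. by move=> fg; apply: integral_ae_eq_fun; apply: aeS fg => t H /H ->. Qed.

Lemma norm_pow_continuous (p : nat) : continuous (fun x : V => `|x| ^+ p).
Proof.
move=> x; apply: (@continuous_comp _ _ _ (fun x : V => `|x|) (fun r : R => r ^+ p)).
  exact: norm_continuous.
exact: exprn_continuous.
Qed.

Lemma Lp_int_ge0 (p : nat) (f : R -> V) : (0 <= Lp_int T p f)%E.
Proof. by apply: integral_ge0 => t _; rewrite lee_fin exprn_ge0. Qed.

End StronglyMeasurable.

Lemma strongly_meas_le (R : realType) (V W : normedModType R) (T C : R) (p : nat)
    (f : R -> V) (h : V -> W) : 0 <= C ->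
  continuous h -> (forall x, `|h x| <= C * `|x|) -> strongly_meas T f ->
  (Lp_int T p (h \o f) <= (C ^+ p)%:E * Lp_int T p f)%E.
Proof.
move=> C0 ch hC sf; have [f' ff' mf'] := strongly_meas_borel sf.
have hff' : {ae (@lebesgue_measure R), forall t, `[0, T]%classic t -> (h \o f) t = (h \o f') t}.
  by apply: aeS ff' => t H /H /= ->.
rewrite (Lp_int_ae p hff') (Lp_int_ae p ff') /Lp_int.
have c1 : continuous (fun x : V => `|h x| ^+ p).
  move=> x; apply: (@continuous_comp _ _ _ h (fun y : W => `|y| ^+ p)); first exact: ch.
  exact: norm_pow_continuous.
have m1 := mf' _ (@norm_pow_continuous _ V p).
rewrite -ge0_integralZl ?lee_fin ?exprn_ge0//; [|by apply/measurable_EFinP].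
apply: ge0_le_integral => //.
- by apply/measurable_EFinP; exact: (mf' _ c1).
- by apply: measurable_funeM; apply/measurable_EFinP.
- by move=> t _; rewrite -EFinM lee_fin -exprMn lerXn2r ?nnegrE ?mulr_ge0//; exact: hC.
Qed.

(** * H^1(0,T;H) as a semi-inner product space, and its weak convergence *)

Section SobolevCurves.
Variables (R : realType) (T : R) (H : completeNormedModType R) (ip : H -> H -> R).
Hypothesis T0 : 0 < T.
Hypothesis ipH : inner_product ip.
Variable xs : nat -> H.
Hypothesis xs_dense : forall (x : H) (e : R), 0 < e -> exists k, `|x - xs k| < e.
Notation mu := (@lebesgue_measure R).
Notation I := (`[0, T]%classic : set R).
Notation h1 := (h1 T ip).
Notation L2 := (L2 T ip).
Notation wm := (wm T ip).

Implicit Types (u v w y z : R -> H).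

Lemma strongly_meas_L2 v : strongly_meas T v -> (Lp_int T 2 v < +oo)%E ->
  exists2 v' : R -> H, {ae mu, forall t, I t -> v t = v' t} &
  L2 v' /\ Lp_int T 2 v = (J 0 T (fun t => `|v' t| ^+ 2))%:E.
Proof.
move=> sv; have [v' vv' mv'] := strongly_meas_borel sv => Lv.
exists v' => //; rewrite (Lp_int_ae 2 vv') in Lv *.
have I1 : integ 0 T (fun t => `|v' t| ^+ 2).
  apply/integrableP; split.
    by apply/measurable_EFinP; exact: (mv' _ (@norm_pow_continuous _ _ 2)).
  apply: le_lt_trans Lv; rewrite le_eqVlt; apply/orP; left; apply/eqP.
  by apply: eq_integral => t _ /=; rewrite ger0_norm// exprn_ge0.
split; first split => // x.
  have c := (ip_functional ipH x).2; have m := mv' _ c.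
by apply: m.
exact: J_EFin.
Qed.

Lemma integral_itv_ae s t (f g : R -> R) : 0 <= s -> t <= T ->
  {ae mu, forall r, I r -> f r = g r} -> integ 0 T g ->
  (\int[mu]_(r in `[s, t]) ((f r)%:E))%E = (J s t g)%:E.
Proof.
move=> s0 tT fg gi.
rewrite (@integral_ae_eq_fun _ _ _ (EFin \o g)); last first.
  apply: aeS fg => r H1; rewrite /= in_itv/= => /andP[h1_ h2_].
  by rewrite H1//= in_itv/= (le_trans s0) ?(le_trans h2_).
exact: (J_EFin (integ_sub s0 tT gi)).
Qed.

Lemma H1_h1 z v : H1_with_deriv T z v ->
  exists2 v', {ae mu, forall t, I t -> v t = v' t} & h1 z v'.
Proof.
move=> [sv [sz [Lz [Lv E]]]].
have [v' vv' [Lv' _]] := strongly_meas_L2 sv Lv.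
exists v' => //; split => // s t s0 st tT x.
have := E _ (ip_functional ipH x) s t.
rewrite /= !in_itv/= s0 tT (le_trans s0 st) (le_trans st tT) => /(_ isT isT st).
rewrite (@integral_itv_ae s t _ (fun r => ip (v' r) x) s0 tT).
- by move=> [].
- by apply: aeS vv' => r K /K ->.
- exact: L2_ipc.
Qed.

Lemma H1_Lp z v v' : H1_with_deriv T z v -> h1 z v' ->
  Lp_int T 2 v = (J 0 T (fun t => `|v' t| ^+ 2))%:E /\
  Lp_int T 2 z = (J 0 T (fun t => `|z t| ^+ 2))%:E.
Proof.
move=> Hz hz; have [v2 vv2 hz2] := H1_h1 Hz.
have [sv [sz [Lz [Lv E]]]] := Hz.
split.
  rewrite (@Lp_int_ae _ _ _ _ v v'); last first.
    apply: aeS (aeI vv2 (h1_unique T0 ipH xs_dense hz2 hz)) => t [a b] It.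
    by rewrite a// b//; move: It; rewrite /= in_itv/=.
  exact: (J_EFin hz.1.2).
exact: (J_EFin (h1_L2 T0 ipH xs_dense hz).2).
Qed.

Lemma cont_lin_bounded (f : H -> R) : cont_lin_functional f ->
  exists2 C : R, 0 <= C & forall x, `|f x| <= C * `|x|.
Proof. by move=> fl; apply: (@linear_cont_bounded R H R^o f). Qed.

Lemma functional_integ (f : H -> R) v : cont_lin_functional f -> strongly_meas T v ->
  (Lp_int T 2 v < +oo)%E ->
  exists2 g : R -> R, {ae mu, forall t, I t -> f (v t) = g t} & integ 0 T g.
Proof.
move=> fl sv Lv; have [v' vv' mv'] := strongly_meas_borel sv.
have [C C0 fC] := cont_lin_bounded fl.
exists (f \o v'); first by apply: aeS vv' => t H1 /H1 /= ->.
have [v2 vv2 [Lv2 _]] := strongly_meas_L2 sv Lv.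
have i2 := L2_norm ipH xs_dense Lv2.
have mf : measurable_fun I (f \o v') by apply: mv'; exact: fl.2.
have i3 : integ 0 T (fun t => C * `|v2 t|) by exact: integZ.
apply/integrableP; split; first exact/measurable_EFinP.
have /integrableP[_] := i3; apply: le_lt_trans.
apply: ae_ge0_le_integral => //.
- by apply: measurableT_comp => //; exact/measurable_EFinP.
- by apply: measurableT_comp => //; exact: measurable_int i3.
apply: aeS (aeI vv' vv2) => t [a b] It /=; rewrite lee_fin.
by rewrite -(a It) (b It) normrM normr_id (ger0_norm C0).
Qed.

Lemma H1_lin (a : R) y u z v : H1_with_deriv T y u -> H1_with_deriv T z v ->
  H1_with_deriv T (fun t => a *: y t + z t) (fun t => a *: u t + v t).
Proof.
move=> Hy Hz.
have [u' uu' hy] := H1_h1 Hy; have [v' vv' hz] := H1_h1 Hz.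
have [su [sy [Ly [Lu E1]]]] := Hy; have [sv [sz [Lz [Lv E2]]]] := Hz.
have hl := h1_lin ipH xs_dense a hy hz.
split; first exact: strongly_meas_lin.
split; first exact: strongly_meas_lin.
split.
  by rewrite /Lp_int (J_EFin (h1_L2 T0 ipH xs_dense hl).2) ltry.
split.
  rewrite (@Lp_int_ae _ _ _ _ _ (fun t => a *: u' t + v' t)); last first.
    by apply: aeS (aeI uu' vv') => t [p q] It; rewrite p// q.
  by rewrite /Lp_int (J_EFin hl.1.2) ltry.
move=> f fl s t Is It st.
have [g1 e1 i1] := functional_integ fl su Lu.
have [g2 e2 i2] := functional_integ fl sv Lv.
have := E1 f fl s t Is It st; have := E2 f fl s t Is It st.
move: (Is) (It); rewrite /= !in_itv/= => /andP[s0 sT] /andP[t0 tT].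
rewrite (integral_itv_ae s0 tT e1 i1) (integral_itv_ae s0 tT e2 i2) => -[q2] [q1].
rewrite (@integral_itv_ae s t _ (fun r => a * g1 r + g2 r))//.
- rewrite !fl.1 JD; [|by apply: integZ; exact: integ_sub i1|exact: integ_sub i2].
  rewrite JZ; last exact: integ_sub i1.
  by rewrite -q1 -q2; congr EFin; ring.
- by apply: aeS (aeI e1 e2) => r [p q] Ir; rewrite fl.1 p// q.
- by apply: integD => //; exact: integZ.
Qed.

Lemma H1_sub y u z v : H1_with_deriv T y u -> H1_with_deriv T z v ->
  H1_with_deriv T (fun t => y t - z t) (fun t => u t - v t).
Proof.
move=> h g; rewrite (_ : (fun t => y t - _) = (fun t => (-1) *: z t + y t)).
  rewrite (_ : (fun t => u t - _) = (fun t => (-1) *: v t + u t)); first exact: H1_lin.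
  by apply/funext => t; rewrite scaleN1r addrC.
by apply/funext => t; rewrite scaleN1r addrC.
Qed.

(** A choice of derivative, unique up to null sets by [h1_unique], with default 0 outside H^1. It
    turns the H^1 inner product [B] into a function of the curves alone. *)
Definition der u : R -> H :=
  if pselect (exists v, h1 u v) is left e then projT1 (cid e) else fun=> 0.

Lemma der_h1 u : inH1 T u -> h1 u (der u).
Proof.
move=> [v /H1_h1[v' _ hv]]; rewrite /der; case: pselect => [e|[]]; last by exists v'.
exact: (projT2 (cid e)).
Qed.

Definition B u w : R :=
  J 0 T (fun t => ip (u t) (w t)) + J 0 T (fun t => ip (der u t) (der w t)).

Lemma B_norm u v : H1_with_deriv T u v -> H1_normsq T u v = B u u.
Proof.
move=> Hu; have hu : h1 u (der u) by apply: der_h1; exists v.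
have [e1 e2] := H1_Lp Hu hu; rewrite /H1_normsq e1 e2 /=.
by congr (_ + _); apply: J_ext => t _; rewrite (ipxx ipH).
Qed.

Lemma B_h1 u v : inH1 T u -> h1 u v ->
  B u u = J 0 T (fun t => `|u t| ^+ 2) + J 0 T (fun t => `|v t| ^+ 2).
Proof.
move=> iu hu; have hd := der_h1 iu; congr (_ + _).
  by apply: J_ext => t _; rewrite (ipxx ipH).
apply: J_ext_ae; [exact: (L2_ip ipH xs_dense hd.1 hd.1)|exact: hu.1.2|].
by apply: aeS (h1_unique T0 ipH xs_dense hd hu) => t E /E ->; rewrite (ipxx ipH).
Qed.

Notation P := (inH1 T : (R -> H) -> Prop).

Lemma P_lin (a : R) u w : P u -> P w -> P (a *: u + w).
Proof.
move=> [u' Hu] [w' Hw]; exists (fun t => a *: u' t + w' t).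
exact: H1_lin Hu Hw.
Qed.

Lemma P_zero u : P u -> P 0.
Proof.
move=> Pu; rewrite (_ : 0 = (-1) *: u + u); first exact: P_lin.
by rewrite scaleN1r addNr.
Qed.

Lemma B_symm u w : P u -> P w -> B u w = B w u.
Proof. by move=> _ _; congr (_ + _); apply: J_ext => t _; exact: ipC. Qed.

Lemma B_linl (a : R) u w y : P u -> P w -> P y -> B (a *: u + w) y = a * B u y + B w y.
Proof.
move=> Pu Pw Py.
have hu := der_h1 Pu; have hw := der_h1 Pw; have hy := der_h1 Py.
have hl := der_h1 (P_lin a Pu Pw); have hl' := h1_lin ipH xs_dense a hu hw.
have Lu := h1_L2 T0 ipH xs_dense hu; have Lw := h1_L2 T0 ipH xs_dense hw.
have Ly := h1_L2 T0 ipH xs_dense hy.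
have i1 := L2_ip ipH xs_dense Lu Ly; have i2 := L2_ip ipH xs_dense Lw Ly.
have i3 := L2_ip ipH xs_dense hu.1 hy.1; have i4 := L2_ip ipH xs_dense hw.1 hy.1.
rewrite /B.
have -> : J 0 T (fun t => ip ((a *: u + w) t) (y t)) =
    a * J 0 T (fun t => ip (u t) (y t)) + J 0 T (fun t => ip (w t) (y t)).
  rewrite -JZ// -JD//; last exact: integZ.
  by apply: J_ext => t _; exact: ipP.
have -> : J 0 T (fun t => ip (der (a *: u + w) t) (der y t)) =
    a * J 0 T (fun t => ip (der u t) (der y t)) + J 0 T (fun t => ip (der w t) (der y t)).
  rewrite -JZ// -JD//; last exact: integZ.
  apply: J_ext_ae; [exact: (L2_ip ipH xs_dense hl.1 hy.1)|by apply: integD => //; exact: integZ|].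
  by apply: aeS (h1_unique T0 ipH xs_dense hl hl') => t E /E ->; exact: ipP.
ring.
Qed.

Lemma B_nneg u : P u -> 0 <= B u u.
Proof.
by move=> Pu; rewrite /B addr_ge0//; apply: J_ge0 => t _; rewrite (ipxx ipH) sqr_ge0.
Qed.

Lemma dual_bounded F : H1_dual T F -> bounded_functional P B F.
Proof.
move=> [Fl [C FC]]; split; first exact: Fl.
exists (C ^+ 2) => u [v Hu].
have K := FC u v Hu; rewrite (B_norm Hu) in K.
have Bu : 0 <= B u u by apply: B_nneg; exists v.
rewrite -[F u ^+ 2]real_normK ?num_real// -[B u u]sqr_sqrtr// -exprMn.
by rewrite lerXn2r ?nnegrE// (le_trans _ K).
Qed.

Lemma bounded_dual F : bounded_functional P B F -> H1_dual T F.
Proof.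
move=> [Fl [C FC]]; split; first exact: Fl.
exists (Num.sqrt `|C|) => u v Hu; rewrite (B_norm Hu).
have Bu : 0 <= B u u by apply: B_nneg; exists v.
have Pu : P u by exists v.
rewrite -sqrtrM// -sqrtr_sqr ler_wsqrtr//; apply: le_trans (FC u Pu) _.
by rewrite ler_wpM2r// ler_norm.
Qed.

Lemma weak_cvg_bounded (u : nat -> R -> H) w : (forall n, P (u n)) -> H1_weak_cvg T u w ->
  exists M : R, forall n, B (u n) (u n) <= M.
Proof.
move=> Pu uw.
apply: (uniform_boundedness P_lin B_symm B_linl B_nneg Pu) => F /bounded_dual FD.
have c := uw F FD.
have [M [_ HM]] := cvg_seq_bounded (cvgP _ c).
exists (M + 1) => n; apply: (HM (M + 1)) => //; lra.
Qed.

(** [approx_riesz] replaces [F] by pairing with some [y], at an error at most e / 2 on the bounded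
    sequence. In the pairing, the part with values vanishes by uniform convergence and the part with
    derivatives by [h1_weak0]. *)
Lemma weak_cvg_of_bounded (u : nat -> R -> H) w (M : R) : (forall n, P (u n)) -> P w ->
  (forall n, B (u n - w) (u n - w) <= M) ->
  (forall e : R, 0 < e -> \forall n \near \oo, forall t, 0 <= t <= T -> `|u n t - w t| <= e) ->
  H1_weak_cvg T u w.
Proof.
move=> Pu Pw BM uw F FD; have [Fl [C FC]] := dual_bounded FD.
have Pd n : P (u n - w).
  by rewrite (_ : u n - w = (-1) *: w + u n); [exact: P_lin|rewrite scaleN1r addrC].
have FE n : F (u n - w) = F (u n) - F w.
  by rewrite (_ : u n - w = (-1) *: w + u n) ?Fl//; [ring|rewrite scaleN1r addrC].
have M0 : 0 <= M by apply: le_trans (BM 0%N); exact: B_nneg.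
suff c0 : (fun n => F (u n - w)) @ \oo --> (0 : R).
  rewrite (_ : (fun n => F (u n)) = (fun n => F (u n - w) + F w)); last first.
    by apply/funext => n; rewrite FE subrK.
  by rewrite -[X in _ --> X]add0r; apply: cvgD; [exact: c0|exact: cvg_cst].
apply/cvgrPdist_le => e e0.
have d0 : 0 < (e / 2) ^+ 2 / (M + 1) by rewrite divr_gt0 ?exprn_gt0 ?divr_gt0// ltr_wpDl.
have [y Py Hy] := approx_riesz (P_zero Pw) P_lin B_symm B_linl B_nneg d0 (dual_bounded FD).
have hd n := der_h1 (Pd n); have hy := der_h1 Py.
have uw' (r : R) : 0 < r -> \forall n \near \oo, forall t, 0 <= t <= T -> `|(u n - w) t| <= r.
  exact: uw.
have KM n : J 0 T (fun t => `|der (u n - w) t| ^+ 2) <= M.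
  apply: le_trans (BM n); rewrite (B_h1 (Pd n) (hd n)) lerDr.
  by apply: J_ge0 => t _; exact: sqr_ge0.
have c1 := h1_weak0 T0 ipH xs_dense hd KM uw' hy.
have c2 : (fun n => J 0 T (fun t => ip ((u n - w) t) (y t))) @ \oo --> (0 : R).
  have Ly := L2_norm ipH xs_dense (h1_L2 T0 ipH xs_dense hy).
  have Y0 : 0 <= J 0 T (fun t => `|y t|) by apply: J_ge0.
  apply/cvgrPdist_le => r r0.
  have r1 : 0 < r / (J 0 T (fun t => `|y t|) + 1) by rewrite divr_gt0// ltr_wpDl.
  have [N _ HN] := uw' _ r1; exists N => // n /HN un /=.
  rewrite sub0r normrN.
  have Lu := h1_L2 T0 ipH xs_dense (hd n).
  have i1 := L2_ip ipH xs_dense Lu (h1_L2 T0 ipH xs_dense hy).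
  apply: le_trans (J_abs i1) _.
  apply: le_trans (_ : J 0 T (fun t => r / (J 0 T (fun t => `|y t|) + 1) * `|y t|) <= _).
    apply: J_le; [exact: integ_abs|exact: integZ|move=> t tT].
    by apply: le_trans (ip_cs ipH _ _) _; rewrite ler_wpM2r// un.
  rewrite JZ// mulrAC ler_pdivrMr ?ltr_wpDl// ler_pM2l//; lra.
have e2 : 0 < e / 4 by rewrite divr_gt0.
have [N1 _ HN1] := (cvgrPdist_le _ _).1 c1 _ e2.
have [N2 _ HN2] := (cvgrPdist_le _ _).1 c2 _ e2.
exists (maxn N1 N2) => // n; rewrite /= geq_max => /andP[/HN1 /= k1 /HN2 /= k2].
rewrite !sub0r !normrN in k1 k2 *.
have : `|F (u n - w) - B (u n - w) y| <= e / 2.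
  have K := Hy _ (Pd n).
  have e2' : 0 <= e / 2 by rewrite divr_ge0// ltW.
  rewrite -[leRHS]ger0_norm// -[leLHS]ger0_norm//.
  rewrite -ler_sqr ?nnegrE// !real_normK ?num_real//; apply: le_trans K _.
  apply: le_trans (ler_wpM2l (ltW d0) (BM n)) _.
  by rewrite mulrAC ler_pdivrMr ?ltr_wpDl// ler_wpM2l ?sqr_ge0//; lra.
have : `|B (u n - w) y| <= e / 2.
  by rewrite /B; apply: le_trans (ler_normD _ _) _; lra.
move=> a b; rewrite -[F (u n - w)](subrK (B (u n - w) y)).
apply: le_trans (ler_normD _ _) _; lra.
Qed.

End SobolevCurves.

(** * A priori estimates for the evolution inclusion *)

Section EvolutionEstimates.
Variables (R : realType) (T : R) (H : completeNormedModType R) (ip : H -> H -> R).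
Hypothesis T0 : 0 < T.
Hypothesis ipH : inner_product ip.
Variable xs : nat -> H.
Hypothesis xs_dense : forall (x : H) (e : R), 0 < e -> exists k, `|x - xs k| < e.
Notation mu := (@lebesgue_measure R).
Notation h1 := (h1 T ip).
Notation L2 := (L2 T ip).

Implicit Types (u v w y z k e g : R -> H).

Lemma J_mono (f : R -> R) s t : integ 0 T f -> (forall r, 0 <= r <= T -> 0 <= f r) ->
  0 <= s -> s <= t -> t <= T -> J s t f <= J 0 T f.
Proof.
move=> fi f0 s0 st tT.
rewrite (J_split s0 (le_trans st tT) fi) (J_split st tT (integ_sub s0 (lexx _) fi)).
have : 0 <= J 0 s f.
  by apply: J_ge0 => r /andP[a b]; apply: f0; rewrite a (le_trans b)// (le_trans st).
have : 0 <= J t T f.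
  by apply: J_ge0 => r /andP[a b]; apply: f0; rewrite b andbT (le_trans _ a)// (le_trans s0).
lra.
Qed.

(** Average |k t|^2 <= 2 |k s|^2 + 2 |k t - k s|^2 over [s], with [h1_holder] for the increment. *)
Lemma sobolev k k' t : h1 k k' -> 0 <= t <= T ->
  `|k t| ^+ 2 <= 2 / T * J 0 T (fun s => `|k s| ^+ 2) + 2 * T * J 0 T (fun s => `|k' s| ^+ 2).
Proof.
move=> hk tI; have Lk := h1_L2 T0 ipH xs_dense hk.
set a := J 0 T (fun s => `|k' s| ^+ 2).
have D s : 0 <= s <= T -> `|k t - k s| ^+ 2 <= T * a.
  wlog st : s t tI / s <= t.
    move=> W sI; have [|ts] := leP s t; first by move/W; apply.
    by rewrite distrC; apply: W => //; exact: ltW.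
  case/andP: tI => t0 tT /andP[s0 sT].
  apply: le_trans (h1_holder ipH xs_dense hk s0 st tT) _.
  apply: ler_pM; [lra|by apply: J_ge0 => r _; exact: sqr_ge0|lra|].
  by apply: J_mono => //; exact: hk.1.2.
have : J 0 T (fun=> `|k t| ^+ 2) <= J 0 T (fun s => 2 * `|k s| ^+ 2 + 2 * (T * a)).
  apply: J_le; [exact: integ_cst|apply: integD; [by apply: integZ; exact: Lk.2|exact: integ_cst]|].
  move=> s sI; have := D s sI.
  have := sqr_ge0 `|(k t - k s) - k s|; rewrite (norm2B ipH) => h1_ h2_.
  have : `|k t| ^+ 2 = `|k t - k s| ^+ 2 + 2 * ip (k t - k s) (k s) + `|k s| ^+ 2.
    by rewrite -(norm2D ipH) subrK.
  lra.
rewrite JD; [|by apply: integZ; exact: Lk.2|exact: integ_cst].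
rewrite (JZ 2 Lk.2).
rewrite (J_cst (`|k t| ^+ 2) (ltW T0)) (J_cst (2 * (T * a)) (ltW T0)) subr0 => h.
rewrite -(ler_pM2r T0).
have -> : (2 / T * J 0 T (fun s => `|k s| ^+ 2) + 2 * T * a) * T =
   2 * J 0 T (fun s => `|k s| ^+ 2) + 2 * (T * a) * T by field; rewrite gt_eqF.
exact: h.
Qed.

Variables (A : H -> set H) (Q : H -> H) (gQ : R).
Hypothesis A_mon : monotone_op ip A.
Hypothesis Q_lin : linear_cont Q.
Hypothesis Q_sym : forall x y : H, ip (Q x) y = ip x (Q y).
Hypothesis gQ0 : 0 < gQ.
Hypothesis Q_coer : forall h, gQ * `|h| ^+ 2 <= ip (Q h) h.

Lemma Q_bounded : exists2 C : R, 0 <= C & forall x, `|Q x| <= C * `|x|.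
Proof. exact: linear_cont_bounded. Qed.

Lemma QB (x y : H) : Q (x - y) = Q x - Q y.
Proof. by rewrite [x - y]addrC -scaleN1r Q_lin.1 scaleN1r addrC. Qed.

Lemma h1_Q z v : h1 z v -> h1 (Q \o z) (Q \o v).
Proof.
move=> [[mv iv] E]; have [C C0 QC] := Q_bounded.
have mQ : wm T ip (Q \o v).
  move=> x; rewrite (_ : (fun t => _) = (fun t => ip (v t) (Q x))); first exact: mv.
  by apply/funext => t; exact: Q_sym.
split; first split => //.
  apply: (@integ_dom R 0 T _ (fun t => C ^+ 2 * `|v t| ^+ 2)).
  - exact: (wm_norm2 ipH xs_dense).
  - by move=> t _; rewrite ger0_norm ?sqr_ge0// -exprMn lerXn2r ?nnegrE ?mulr_ge0//; exact: QC.
  - exact: integZ.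
move=> s t s0 st tT x; rewrite /= !Q_sym E//.
by apply: J_ext => r _ /=; rewrite Q_sym.
Qed.

Definition in_A w v : Prop := {ae mu, forall t, 0 < t < T -> A (w t) (v t)}.

(** By symmetry of [Q], the derivative of (Q e, e) is 2 (Q e, e'), which monotonicity bounds by 2
    (e', k). *)
Lemma energy (C : R) e e' k b : (forall x, `|Q x| <= C * `|x|) ->
  h1 e e' -> L2 k ->
  {ae mu, forall t, 0 < t < T -> 0 <= ip (e' t) (k t - Q (e t))} -> 0 <= b <= T ->
  gQ * `|e b| ^+ 2 <= C * `|e 0| ^+ 2 + 2 * J 0 b (fun t => ip (e' t) (k t)).
Proof.
move=> QC he Lk mon bI; have /andP[b0 bT] := bI.
have hq := h1_Q he; have Le := he.1; have Lq := h1_L2 T0 ipH xs_dense hq.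
have := h1_prod T0 ipH xs_dense hq he bI.
have i1 := integ_sub (lexx 0) bT (L2_ip ipH xs_dense Le Lk).
have i2 := integ_sub (lexx 0) bT (L2_ip ipH xs_dense Lq Le).
rewrite (@J_ext _ 0 b _ (fun t => 2 * ip (Q (e t)) (e' t))); last first.
  by move=> t _ /=; rewrite Q_sym (ipC ipH (e' t)) /=; ring.
rewrite JZ// => E.
have : J 0 b (fun t => ip ((Q \o e) t) (e' t)) <= J 0 b (fun t => ip (e' t) (k t)).
  apply: J_le_ae => //; apply: aeS (ae_interior mon) => t h /andP[t0 tb].
  have := h; rewrite t0 (le_trans tb bT) => /(_ isT).
  by rewrite (ipBr ipH) subr_ge0 (ipC ipH (Q _)).
have : ip (Q (e 0)) (e 0) <= C * `|e 0| ^+ 2.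
  apply: le_trans (ip_le ipH _ _) _; rewrite expr2 mulrA ler_wpM2r//; exact: QC.
have := Q_coer (e b).
move: E; rewrite /=; lra.
Qed.

(* Integrating by parts moves the derivative from [e] to [k], so the bound on
   [e] only involves the H^1 norm of [k]. *)
Lemma energy_bound (C E0 s0 s1 : R) e e' k k' : 0 <= C -> (forall x, `|Q x| <= C * `|x|) ->
  h1 e e' -> h1 k k' ->
  {ae mu, forall t, 0 < t < T -> 0 <= ip (e' t) (k t - Q (e t))} ->
  `|e 0| <= E0 -> (forall t, 0 <= t <= T -> `|k t| <= s0) -> J 0 T (fun t => `|k' t|) <= s1 ->
  forall t, 0 <= t <= T -> `|e t| <= 1 + (C * E0 ^+ 2 + (4 * s0 + 2 * s1)) / gQ.
Proof.
move=> C0 QC he hk mon eE ks ks1.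
have Lk := h1_L2 T0 ipH xs_dense hk; have Le := h1_L2 T0 ipH xs_dense he.
have [M M0 eM] := h1_bounded ipH xs_dense he.
have E00 : 0 <= E0 := le_trans (normr_ge0 _) eE.
have tI0 : 0 <= (0 : R) <= T by rewrite lexx ltW.
have s00 : 0 <= s0 := le_trans (normr_ge0 _) (ks 0 tI0).
have s10 : 0 <= s1 by apply: le_trans ks1; apply: J_ge0.
pose S := [set `|e t| | t in [set t | 0 <= t <= T]].
have Ssup : has_sup S.
  split; first by exists `|e 0|; exists 0.
  by exists M => _ [t tI <-]; exact: eM.
pose m := sup S.
have em t : 0 <= t <= T -> `|e t| <= m by move=> tI; apply: ub_le_sup; [exact: Ssup.2|exists t].
have m0 : 0 <= m := le_trans (normr_ge0 _) (em 0 tI0).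
(* Integration by parts leaves two boundary terms of size [m * s0] and an integral of size [m * s1];
   [energy] doubles them. *)
pose c := 4 * s0 + 2 * s1.
have c0 : 0 <= c by rewrite /c; lra.
have key t : 0 <= t <= T -> gQ * `|e t| ^+ 2 <= C * E0 ^+ 2 + m * c.
  move=> tI; have /andP[t0 tT] := tI.
  apply: le_trans (energy QC he Lk mon tI) _.
  have i1 := integ_sub (lexx 0) tT (L2_ip ipH xs_dense he.1 Lk).
  have i2 := integ_sub (lexx 0) tT (L2_ip ipH xs_dense Le hk.1).
  have := h1_prod T0 ipH xs_dense he hk tI; rewrite JD// => E.
  have b1 : ip (e t) (k t) <= m * s0.
    by apply: le_trans (ip_le ipH _ _) _; apply: ler_pM => //; [exact: em|exact: ks].
  have b2 : - ip (e 0) (k 0) <= m * s0.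
    apply: le_trans (ler_norm _) _; rewrite normrN; apply: le_trans (ip_cs ipH _ _) _.
    by apply: ler_pM => //; [exact: em|exact: ks].
  have b3 : - J 0 t (fun r => ip (e r) (k' r)) <= m * s1.
    apply: le_trans (ler_norm _) _; rewrite normrN; apply: le_trans (J_abs i2) _.
    have i3 := L2_norm ipH xs_dense hk.1.
    apply: le_trans (_ : J 0 t (fun r => m * `|k' r|) <= _).
      apply: J_le; [exact: integ_abs|by apply: integZ; exact: integ_sub i3|].
      move=> r /andP[r0 rt]; apply: le_trans (ip_cs ipH _ _) _; rewrite ler_wpM2r//.
      by apply: em; rewrite r0 (le_trans rt).
    rewrite JZ; last exact: integ_sub i3.
    by rewrite ler_wpM2l//; apply: le_trans ks1; apply: J_mono.
  have b4 : C * `|e 0| ^+ 2 <= C * E0 ^+ 2 by rewrite ler_wpM2l// lerXn2r ?nnegrE.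
  rewrite /c; lra.
have msq : gQ * m ^+ 2 <= C * E0 ^+ 2 + m * c.
  have y0 : 0 <= (C * E0 ^+ 2 + m * c) / gQ.
    by rewrite divr_ge0 ?(ltW gQ0)// addr_ge0// mulr_ge0// sqr_ge0.
  have mle : m <= Num.sqrt ((C * E0 ^+ 2 + m * c) / gQ).
    apply: ge_sup; first exact: Ssup.1.
    move=> _ [t tI <-]; rewrite -[leLHS]ger0_norm// -sqrtr_sqr ler_wsqrtr//.
    by rewrite ler_pdivlMr// mulrC; exact: key.
  have : m ^+ 2 <= (C * E0 ^+ 2 + m * c) / gQ.
    by rewrite -[leRHS]sqr_sqrtr// lerXn2r ?nnegrE// sqrtr_ge0.
  by rewrite ler_pdivlMr// mulrC.
move=> t tI; apply: le_trans (em t tI) _; rewrite -/c.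
(* For m > 1 the quadratic inequality may be divided by [m]; the summand 1 of the claim covers the
   other case. *)
have [m1|m1] := leP m 1.
  have : 0 <= (C * E0 ^+ 2 + c) / gQ.
    by rewrite divr_ge0 ?(ltW gQ0)// addr_ge0// mulr_ge0// sqr_ge0.
  lra.
have : m <= (C * E0 ^+ 2 + c) / gQ.
  rewrite ler_pdivlMr// -(ler_pM2r (lt_trans ltr01 m1)).
  have : C * E0 ^+ 2 <= C * E0 ^+ 2 * m by rewrite ler_peMr ?mulr_ge0 ?sqr_ge0// ltW.
  lra.
lra.
Qed.

(* Comparing [v t] with a bounded selection at earlier times. *)
Lemma min_section_ineq (C : R) w w' v : h1 w w' -> in_A w v -> 0 <= C ->
  (forall t, 0 <= t <= T -> exists2 q, A (w t) q & `|q| <= C) ->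
  {ae mu, forall t, 0 < t < T -> - (C * `|w' t|) <= ip (v t) (w' t)}.
Proof.
move=> hw wA C0 sel.
apply: aeS (aeI (h1_dif_ae T0 ipH xs_dense hw) wA) => t [D a] tI.
have [{}D _] := D tI; have {}a := a tI; have /andP[t0 tT] := tI.
apply/ler_addgt0Pr => e e0.
have den : 0 < C + `|v t| + 1 by rewrite ltr_wpDl// addr_ge0.
have [r r0 K] := D (e / (C + `|v t| + 1)) (divr_gt0 e0 den).
set n := e / (C + `|v t| + 1) in K.
have n0 : 0 < n by rewrite divr_gt0.
(* Half of the minimum keeps [t - h] inside [[0, T]] and strictly within the radius [r]. *)
pose h := Num.min r t / 2.
have h0 : 0 < h by rewrite divr_gt0// lt_min r0.
have hE : 2 * h = Num.min r t by rewrite mulrC divfK.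
have hr : 2 * h <= r by rewrite hE ge_min lexx.
have ht : 2 * h <= t by rewrite hE ge_min lexx orbT.
have sI : 0 <= t - h <= T by apply/andP; split; lra.
have [q Aq qC] := sel _ sI.
have := K (t - h) sI; have -> : t - h - t = - h by ring.
rewrite normrN gtr0_norm// => /(_ _); have -> : h < r by lra.
move=> /(_ isT); rewrite scaleNr opprK => dw.
set d := w (t - h) - w t in dw.
have := A_mon a Aq.
have -> : w t - w (t - h) = - d by rewrite opprB.
rewrite (ipNr ipH) (ipBl ipH) => m1.
have b1 : ip q d <= C * (h * `|w' t| + n * h).
  apply: le_trans (ip_le ipH _ _) _; apply: ler_pM => //.
  rewrite -[d](addrK (h *: w' t)); apply: le_trans (ler_normB _ _) _.
  by rewrite normrZ gtr0_norm// addrC lerD2l.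
have b2 : - ip (v t) (d + h *: w' t) <= `|v t| * (n * h).
  apply: le_trans (ler_norm _) _; rewrite normrN; apply: le_trans (ip_cs ipH _ _) _.
  by rewrite ler_wpM2l.
rewrite (ipDr ipH) (ipZr ipH) in b2.
have b3 : - (C * `|w' t|) * h <= (ip (v t) (w' t) + (C + `|v t|) * n) * h by lra.
rewrite ler_pM2r// in b3; apply: le_trans b3 _; rewrite lerD2l /n mulrCA ler_piMr ?(ltW e0)//.
rewrite ler_pdivrMr// mul1r; lra.
Qed.

(** With w' = g' - Q v, [min_section_ineq] and coercivity give gQ |v|^2 <= |v| |g'| + C |g'| + C CQ
    |v|. Young's inequality absorbs a quarter of the left side for each of the two terms linear in
    |v|. *)
Lemma velocity_bound (C CQ : R) g g' z v : h1 g g' -> h1 z v -> 0 <= C -> 0 <= CQ ->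
  (forall x, `|Q x| <= CQ * `|x|) ->
  in_A (fun t => g t - Q (z t)) v ->
  (forall t, 0 <= t <= T -> exists2 q, A (g t - Q (z t)) q & `|q| <= C) ->
  J 0 T (fun t => `|v t| ^+ 2) <=
    2 / gQ * ((gQ^-1 + 1) * J 0 T (fun t => `|g' t| ^+ 2) + ((C * CQ) ^+ 2 / gQ + C ^+ 2) * T).
Proof.
move=> hg hz C0 CQ0 QC wA sel.
have hw : h1 (fun t => g t - Q (z t)) (fun t => g' t - Q (v t)).
  exact: (h1B ipH xs_dense hg (h1_Q hz)).
have i1 := hg.1.2; have i2 := hz.1.2.
have ii : integ 0 T (fun t => 2 / gQ * ((gQ^-1 + 1) * `|g' t| ^+ 2 + ((C * CQ) ^+ 2 / gQ + C ^+ 2))).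
  by apply: integZ; apply: integD; [exact: integZ|exact: integ_cst].
apply: le_trans (J_le_ae i2 ii _) _; last first.
  rewrite JZ; last by apply: integD; [exact: integZ|exact: integ_cst].
  rewrite JD; [|exact: integZ|exact: integ_cst].
  by rewrite JZ// (J_cst _ (ltW T0)) subr0.
apply: ae_interior; apply: aeS (min_section_ineq hw wA C0 sel) => t K tI.
have {}K := K tI; set a := `|v t|; set p := `|g' t|.
have a0 : 0 <= a := normr_ge0 _; have p0 : 0 <= p := normr_ge0 _.
have b1 := Q_coer (v t).
have b2 : ip (v t) (g' t) <= a * p by exact: ip_le.
have b3 : `|g' t - Q (v t)| <= p + CQ * a.
  by apply: le_trans (ler_normB _ _) _; rewrite lerD2l QC.
have b4 : C * `|g' t - Q (v t)| <= C * (p + CQ * a) by rewrite ler_wpM2l.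
rewrite (ipBr ipH) in K; rewrite Q_sym in b1.
have b5 : gQ * a ^+ 2 <= a * p + C * p + C * CQ * a by rewrite -/a in b1; lra.
have b6 : a * p <= gQ / 4 * a ^+ 2 + gQ^-1 * p ^+ 2.
  rewrite -(ler_pM2l gQ0) mulrDr mulrA mulVKf ?gt_eqF//.
  by have := sqr_ge0 (gQ * a / 2 - p); lra.
have b7 : C * CQ * a <= gQ / 4 * a ^+ 2 + (C * CQ) ^+ 2 / gQ.
  rewrite -(ler_pM2l gQ0) mulrDr [gQ * (_ / gQ)]mulrC divfK ?gt_eqF//.
  by have := sqr_ge0 (gQ * a / 2 - C * CQ); lra.
have b8 : C * p <= C ^+ 2 + p ^+ 2.
  by have := sqr_ge0 (C - p); have := sqr_ge0 C; have := sqr_ge0 p; lra.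
set X := (gQ^-1 + 1) * p ^+ 2 + _.
have XE : gQ * (2 / gQ * X) = 2 * X by field; rewrite gt_eqF.
rewrite -(ler_pM2l gQ0) XE /X; lra.
Qed.

Lemma ae_interval_witness (P : R -> Prop) a b : {ae mu, forall t, P t} -> a < b ->
  exists2 t, a <= t <= b & P t.
Proof.
move=> aeP ab; apply: contrapT => nP.
have ae0 : {ae mu, forall t, a <= t <= b -> (1 : R) = 0}.
  by apply: aeS aeP => t Pt tI; exfalso; apply: nP; exists t.
have := J_ext_ae (integ_cst a b 1) (integ_cst a b 0) ae0.
by rewrite !J_cst ?ltW// mul1r mul0r => E; move: ab; rewrite -subr_gt0 E ltxx.
Qed.

(** Times at which the inclusion holds are dense, [w] is continuous and the domain is closed. This
    covers the endpoints too, where [phi] will be evaluated. *)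
Lemma domain_everywhere w w' v : h1 w w' -> in_A w v -> closed (domain A) ->
  forall t, 0 <= t <= T -> domain A (w t).
Proof.
move=> hw wA cD t tI; have /andP[t0 tT] := tI.
rewrite ((closure_id _).1 cD) => O.
rewrite nbhs_ballP => -[r /= r0 rO].
set K := J 0 T (fun r => `|w' r| ^+ 2).
have K0 : 0 <= K by apply: J_ge0 => s _; exact: sqr_ge0.
pose d := Num.min (r ^+ 2 / (K + 1)) (T / 2).
have d0 : 0 < d by rewrite lt_min !divr_gt0 ?exprn_gt0// ltr_wpDl.
have dr : d * K < r ^+ 2.
  have h : d * (K + 1) <= r ^+ 2 by rewrite -ler_pdivlMr ?ltr_wpDl// ge_min lexx.
  lra.
have dT : d <= T / 2 by rewrite ge_min lexx orbT.
have close s : 0 <= s <= T -> `|s - t| <= d -> `|w t - w s| < r.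
  move=> sI sd.
  have : `|w t - w s| ^+ 2 <= `|s - t| * K.
    have [st|ts] := leP s t.
      have /andP[s0 sT] := sI.
      apply: le_trans (h1_holder ipH xs_dense hw s0 st tT) _.
      rewrite ler0_norm ?opprB; last lra.
      by rewrite ler_wpM2l ?subr_ge0//; apply: J_mono => //; exact: hw.1.2.
    have /andP[s0 sT] := sI; rewrite distrC.
    apply: le_trans (h1_holder ipH xs_dense hw t0 (ltW ts) sT) _.
    rewrite gtr0_norm ?subr_gt0// ler_wpM2l ?subr_ge0 ?(ltW ts)//.
    by apply: J_mono => //; [exact: hw.1.2|exact: ltW].
  move=> h; have : `|w t - w s| ^+ 2 < r ^+ 2.
    by apply: le_lt_trans h _; apply: le_lt_trans dr; rewrite ler_wpM2r.
  by rewrite ltr_sqr ?nnegrE// ltW.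
(* A window of length [d] starting or ending at [t], on the side where [d <= T / 2] keeps it inside
   [[0, T]]. *)
pose a := if t <= T / 2 then t else t - d.
have wit : exists2 s, a <= s <= a + d & (0 < s < T -> A (w s) (v s)) /\ s != 0 /\ s != T.
  apply: ae_interval_witness; last by rewrite ltrDl.
  have a0 (c : R) : {ae mu, forall s, s != c :> R}.
    exists [set c]; split => //; first exact: lebesgue_measure_set1.
    by move=> x /= /negP; rewrite negbK => /eqP.
  exact: aeI wA (aeI (a0 0) (a0 T)).
have [s /andP[as_ sa] [As [s0 sT]]] := wit.
have sI : 0 <= s <= T /\ `|s - t| <= d.
  rewrite /a in as_ sa; move: as_ sa; case: ifPn => [th as_ sa|]; last rewrite -ltNge => th as_ sa.
    by split; [apply/andP; split; lra|rewrite ger0_norm; lra].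
  by split; [apply/andP; split; lra|rewrite ler0_norm; lra].
exists (w s); split; last by apply: rO; rewrite -ball_normE/=; apply: close; [exact: sI.1|exact: sI.2].
exists (v s); apply: As; have /andP[p q] := sI.1.
by rewrite !lt_neqAle p q eq_sym s0 sT.
Qed.

(** A form of approximate continuity: [s] may be exchanged, at relative cost [n], for a point [s']
    of [G] at which [v] is controlled, although [v] need not be continuous. *)
Definition near_good (G : R -> Prop) v t : Prop := forall n : R, 0 < n -> n <= 1 ->
  exists2 r : R, 0 < r & forall s, 0 <= s <= T -> `|s - t| < r -> s != t ->
    exists2 s', G s' & [/\ 0 <= s' <= T, `|s' - t| <= `|s - t|, `|s - s'| <= n * `|s - t| &
      `|v s' - v t| <= n].

(* Around a Lebesgue point every nearby point is relatively close to a good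
   point where [v] takes nearly the value [v t]. *)
Lemma near_good_ae (G : R -> Prop) v : L2 v -> {ae mu, forall t, 0 < t < T -> G t} ->
  {ae mu, forall t, 0 < t < T -> near_good G v t}.
Proof.
move=> Lv aeG.
have Lk (k : nat) : integ 0 T (fun r => `|v r - xs k|).
  have Lc : L2 (fun=> xs k).
    by split; [move=> x|exact: integ_cst].
  exact: (L2_norm ipH xs_dense (L2B ipH xs_dense Lv Lc)).
have B : {ae mu, forall t, forall k : nat, 0 < t < T ->
    sdif T (fun s => J 0 s (fun r => `|v r - xs k|)) t `|v t - xs k|}.
  by apply: ae_foralln => k; exact: ftc_ae.
have aeG' : {ae mu, forall t, 0 <= t <= T -> G t} by exact: ae_interior.
apply: aeS B => t D tI n n0 n1; have /andP[t0 tT] := tI.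
have m0 : 0 < n ^+ 2 / 4 by rewrite divr_gt0// exprn_gt0.
have [k vk] := xs_dense (v t) m0.
have [r r0 K] := D k tI _ m0.
exists r => // s sI st sNt; have {}K := K s sI st.
set F := (fun s => J 0 s (fun r => `|v r - xs k|)) in K.
set d := `|s - t| in st K *.
have d0 : 0 < d by rewrite normr_gt0 subr_eq0.
have Fle : `|F s - F t| <= n ^+ 2 / 2 * d.
  rewrite -[F s - F t](subrK ((s - t) * `|v t - xs k|)).
  apply: le_trans (ler_normD _ _) _; rewrite normrM normr_id -/d.
  have : d * `|v t - xs k| <= d * (n ^+ 2 / 4) by rewrite ler_wpM2l// ltW.
  move: K; rewrite /F; lra.
(* The interval [[a, b]] has length [n * d] and reaches from [s] towards [t], so its points are no
   farther from [t] than [s] is. *)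
pose a := if t <= s then s - n * d else s.
pose b := a + n * d.
have nd : 0 < n * d by rewrite mulr_gt0.
have ndd : n * d <= d by rewrite ler_piMl// ltW.
have ab : a < b by rewrite ltrDl.
have /andP[s0 sT] := sI.
have dE : d = if t <= s then s - t else t - s.
  by rewrite /d; case: ifPn => [h|]; [rewrite ger0_norm ?subr_ge0|rewrite -ltNge => h; rewrite ltr0_norm ?opprB ?subr_lt0].
have abI r' : a <= r' <= b -> [/\ 0 <= r' <= T, `|r' - t| <= d & `|s - r'| <= n * d].
  rewrite /b /a; move: dE; case: ifPn => [h|]; last rewrite -ltNge => h;
    move=> dE /andP[p q]; split; rewrite ?ler_norml; apply/andP; split;
    clear -t0 tT s0 sT ndd nd dE p q h; lra.
have aI := abI a (_ : a <= a <= b); rewrite lexx (ltW ab) in aI.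
have bI := abI b (_ : a <= b <= b); rewrite lexx (ltW ab) in bI.
have {aI} [/andP[a0 aT] _ _] := aI isT; have {bI} [/andP[b0 bT] _ _] := bI isT.
have Jab : J a b (fun r => `|v r - xs k|) <= n ^+ 2 / 2 * d.
  apply: le_trans Fle; rewrite /F.
  have Jnn p q : 0 <= J p q (fun r => `|v r - xs k|) by apply: J_ge0.
  rewrite /b /a in a0 aT b0 bT ab *; move: dE a0 aT b0 bT ab; case: ifPn => [h|]; last rewrite -ltNge => h;
    move=> dE a0 aT b0 bT ab.
    have -> : s - n * d + n * d = s by rewrite subrK.
    rewrite (J_split (ltW t0) h (integ_sub (lexx 0) sT (Lk k))) addrAC subrr add0r.
    have h1_ : t <= s - n * d by lra.
    have h2_ : s - n * d <= s by lra.
    rewrite ger0_norm// (J_split h1_ h2_ (integ_sub (ltW t0) sT (Lk k))).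
    by rewrite lerDr.
  rewrite distrC (J_split s0 (ltW h) (integ_sub (lexx 0) (ltW tT) (Lk k))) addrAC subrr add0r.
  have h1_ : s <= s + n * d by lra.
  have h2_ : s + n * d <= t by lra.
  rewrite ger0_norm// (J_split h1_ h2_ (integ_sub s0 (ltW tT) (Lk k))).
  by rewrite lerDl.
(* Without such a point, [|v - xs k|] is at least n - n^2/4 almost everywhere on [[a, b]]. Its
   integral is then at least n^2 (1 - n/4) d, more than n^2 d / 2 because n <= 1. *)
apply: contrapT => none.
have : J a b (fun=> n - n ^+ 2 / 4) <= J a b (fun r => `|v r - xs k|).
  apply: J_le_ae; [exact: integ_cst|exact: integ_sub (Lk k)|].
  apply: aeS aeG' => r' Gr /[dup] rab /abI[rI rt rs].
  have : n < `|v r' - v t|.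
    rewrite ltNge; apply/negP => vr; apply: none; exists r'; [exact: Gr|split => //].
  have := ler_distD (xs k) (v r') (v t); rewrite (distrC (xs k)) => tri vn_.
  move: tri vn_ vk; move: `|v r' - v t| `|v r' - xs k| `|v t - xs k| => p1 p2 p3.
  move=> q1 q2 q3; rewrite lerBlDr; apply: ltW; apply: lt_le_trans q2 _.
  by apply: le_trans q1 _; rewrite lerD2l ltW.
rewrite (J_cst (n - n ^+ 2 / 4) (ltW ab)) /b addrAC subrr add0r.
have : n ^+ 2 / 2 * d < (n - n ^+ 2 / 4) * (n * d).
  rewrite mulrA ltr_pM2r// mulrBl -expr2.
  have : n ^+ 2 / 4 * n <= n ^+ 2 / 4 by rewrite ler_piMr// ltW.
  have : 0 < n ^+ 2 by rewrite exprn_gt0.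
  lra.
lra.
Qed.

Hypothesis A_closed : closed (domain A).
Hypothesis A_sec : min_section_bounded A.

(** [C] depends on [r] alone, so a single constant serves the whole sequence of trajectories. *)
Lemma selection_bound (r : R) : exists2 C : R, 0 <= C & forall w w' v,
  h1 w w' -> in_A w v -> (forall t, 0 <= t <= T -> `|w t| <= r) ->
  forall t, 0 <= t <= T -> exists2 q, A (w t) q & `|q| <= C.
Proof.
have [C HC] := A_sec r.
exists `|C| => // w w' v hw wA wr t tI.
have [q [Aq _ qC]] := HC (w t) (domain_everywhere hw wA A_closed tI) (wr t tI).
by exists q => //; apply: le_trans qC _; exact: ler_norm.
Qed.

(** * Sequences of solutions: uniform bounds and uniform convergence *)

Section Sequences.
Variables (g g' z v : R -> H) (gn gn' zn vn : nat -> R -> H) (K : R).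
Hypothesis hg : h1 g g'.
Hypothesis hgn : forall n, h1 (gn n) (gn' n).
Hypothesis hz : h1 z v.
Hypothesis hzn : forall n, h1 (zn n) (vn n).
Hypothesis zA : in_A (fun t => g t - Q (z t)) v.
Hypothesis znA : forall n, in_A (fun t => gn n t - Q (zn n t)) (vn n).
Hypothesis zn0 : (fun n => `|zn n 0 - z 0|) @ \oo --> (0 : R).
Hypothesis gnK : forall n, J 0 T (fun t => `|gn n t - g t| ^+ 2) +
  J 0 T (fun t => `|gn' n t - g' t| ^+ 2) <= K.

Let hk n := h1B ipH xs_dense (hgn n) hg.
Let he n := h1B ipH xs_dense (hzn n) hz.

Let Jk1 n : 0 <= J 0 T (fun t => `|gn n t - g t| ^+ 2).
Proof. by apply: J_ge0 => t _; exact: sqr_ge0. Qed.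

Let Jk2 n : 0 <= J 0 T (fun t => `|gn' n t - g' t| ^+ 2).
Proof. by apply: J_ge0 => t _; exact: sqr_ge0. Qed.

Let K0 : 0 <= K.
Proof. by apply: le_trans (gnK 0%N); rewrite addr_ge0. Qed.

Lemma mono_diff n : {ae mu, forall t, 0 < t < T ->
  0 <= ip (vn n t - v t) (gn n t - g t - Q (zn n t - z t))}.
Proof.
apply: aeS (aeI zA (znA n)) => t [a b] tI; have := A_mon (b tI) (a tI).
have -> : gn n t - Q (zn n t) - (g t - Q (z t)) = gn n t - g t - Q (zn n t - z t).
  by rewrite QB !opprB [Q (z t) - g t]addrC addrACA [- Q (zn n t) + _]addrC.
by [].
Qed.

Lemma k_bounded : exists2 s0 : R, 0 <= s0 & forall n t, 0 <= t <= T -> `|gn n t - g t| <= s0.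
Proof.
pose S := (2 / T + 2 * T) * K.
have S0 : 0 <= S.
  by rewrite mulr_ge0// addr_ge0 ?divr_ge0 ?mulr_ge0 ?(ltW T0).
exists (Num.sqrt S); first exact: sqrtr_ge0.
move=> n t tI; rewrite -[leLHS]ger0_norm// -sqrtr_sqr ler_wsqrtr//.
apply: le_trans (sobolev (hk n) tI) _.
have := gnK n; have := Jk1 n; have := Jk2 n.
set a := J 0 T _; set b := J 0 T _ => a0 b0 abK.
have t1 : 0 <= 2 / T by rewrite divr_ge0// ltW.
have t2 : 0 <= 2 * T by rewrite mulr_ge0// ltW.
have -> : S = 2 / T * K + 2 * T * K by rewrite /S; ring.
by apply: lerD; rewrite ler_wpM2l//; lra.
Qed.

Lemma zn0_bounded : exists E0 : R, forall n, `|zn n 0 - z 0| <= E0.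
Proof.
have [M [_ HM]] := cvg_seq_bounded (cvgP _ zn0).
have lt1 : M < M + 1 by rewrite ltrDl.
by exists (M + 1) => n; have := HM _ lt1 n I; rewrite /= normr_id.
Qed.

Lemma e_bounded : exists L : R, forall n t, 0 <= t <= T -> `|zn n t - z t| <= L.
Proof.
have [C C0 QC] := Q_bounded; have [s0 s00 ks] := k_bounded; have [E0 eE] := zn0_bounded.
(* [T + K] bounds the L^1 norm of the derivative of the load difference, since a <= 1 + a^2. *)
exists (1 + (C * E0 ^+ 2 + (4 * s0 + 2 * (T + K))) / gQ) => n.
apply: (energy_bound C0 QC (he n) (hk n) (mono_diff n) (eE n) (ks n)).
have i1 := L2_norm ipH xs_dense (hk n).1; have i2 := (hk n).1.2.
apply: le_trans (_ : J 0 T (fun t => 1 + `|gn' n t - g' t| ^+ 2) <= _).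
  apply: J_le => //; first by apply: integD => //; exact: integ_cst.
  move=> t _; set a := `|_|; have := sqr_ge0 (a - 1); have := sqr_ge0 a; rewrite sqrrB; lra.
rewrite JD//; last exact: integ_cst.
rewrite (J_cst 1 (ltW T0)) subr0 mul1r lerD2l.
by have := gnK n; have := Jk1 n; lra.
Qed.

Lemma sections_bounded : exists2 C : R, 0 <= C &
  (forall t, 0 <= t <= T -> exists2 q, A (g t - Q (z t)) q & `|q| <= C) /\
  (forall n t, 0 <= t <= T -> exists2 q, A (gn n t - Q (zn n t)) q & `|q| <= C).
Proof.
have [CQ CQ0 QC] := Q_bounded; have [s0 s00 ks] := k_bounded; have [L eL] := e_bounded.
have [Mg Mg0 gM] := h1_bounded ipH xs_dense hg; have [Mz Mz0 zM] := h1_bounded ipH xs_dense hz.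
have tI0 : 0 <= (0 : R) <= T by rewrite lexx ltW.
have L0 : 0 <= L := le_trans (normr_ge0 _) (eL 0%N 0 tI0).
pose r := (Mg + s0) + CQ * (Mz + L).
have [C C0 HC] := selection_bound r.
have wbound a b t : 0 <= t <= T -> `|a| <= Mg + s0 -> `|b| <= Mz + L -> `|a - Q b| <= r.
  move=> tI ha hb; apply: le_trans (ler_normB _ _) _; apply: lerD => //.
  by apply: le_trans (QC b) _; rewrite ler_wpM2l.
exists C => //; split.
  apply: (HC _ (fun t => g' t - Q (v t)) v _ zA).
    exact: (h1B ipH xs_dense hg (h1_Q hz)).
  move=> t tI; apply: (wbound _ _ t) => //; first by have := gM t tI; lra.
  by have := zM t tI; lra.
move=> n; apply: (HC _ (fun t => gn' n t - Q (vn n t)) (vn n) _ (znA n)).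
  exact: (h1B ipH xs_dense (hgn n) (h1_Q (hzn n))).
move=> t tI; apply: (wbound _ _ t) => //.
  rewrite -[gn n t](subrK (g t)); apply: le_trans (ler_normD _ _) _.
  by have := gM t tI; have := ks n t tI; lra.
rewrite -[zn n t](subrK (z t)); apply: le_trans (ler_normD _ _) _.
by have := zM t tI; have := eL n t tI; lra.
Qed.

Lemma velocity_diff_bounded : exists2 M : R, 0 <= M &
  forall n, J 0 T (fun t => `|vn n t - v t| ^+ 2) <= M /\ J 0 T (fun t => `|vn n t| ^+ 2) <= M.
Proof.
have [CQ CQ0 QC] := Q_bounded; have [C C0 [_ sel]] := sections_bounded.
set a := J 0 T (fun t => `|g' t| ^+ 2); set b := J 0 T (fun t => `|v t| ^+ 2).
have a0 : 0 <= a by apply: J_ge0 => t _; exact: sqr_ge0.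
have b0 : 0 <= b by apply: J_ge0 => t _; exact: sqr_ge0.
pose M1 := 2 / gQ * ((gQ^-1 + 1) * (2 * K + 2 * a) + ((C * CQ) ^+ 2 / gQ + C ^+ 2) * T).
have gi0 : 0 <= gQ^-1 by rewrite invr_ge0 ltW.
have M1b n : J 0 T (fun t => `|vn n t| ^+ 2) <= M1.
  apply: le_trans (velocity_bound (hgn n) (hzn n) C0 CQ0 QC (znA n) (sel n)) _.
  rewrite ler_wpM2l ?mulr_ge0// lerD2r ler_wpM2l ?addr_ge0//.
  apply: le_trans (_ : J 0 T (fun t => 2 * `|gn' n t - g' t| ^+ 2 + 2 * `|g' t| ^+ 2) <= _).
    apply: J_le; [exact: (hgn n).1.2|by apply: integD; apply: integZ; [exact: (hk n).1.2|exact: hg.1.2]|].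
    move=> t _; have := sqr_ge0 `|(gn' n t - g' t) - g' t|; rewrite (norm2B ipH) => q1.
    by rewrite -{1}[gn' n t](subrK (g' t)) (norm2D ipH); lra.
  rewrite JD; [|by apply: integZ; exact: (hk n).1.2|by apply: integZ; exact: hg.1.2].
  rewrite (JZ 2 (hk n).1.2) (JZ 2 hg.1.2).
  by have := gnK n; have := Jk1 n; rewrite -/a; lra.
have M10 : 0 <= M1 by apply: le_trans (M1b 0%N); apply: J_ge0 => t _; exact: sqr_ge0.
exists (2 * M1 + 2 * b); first by rewrite addr_ge0// mulr_ge0.
move=> n; split; last by have := M1b n; lra.
apply: le_trans (_ : J 0 T (fun t => 2 * `|vn n t| ^+ 2 + 2 * `|v t| ^+ 2) <= _).
  apply: J_le; [exact: (he n).1.2|by apply: integD; apply: integZ; [exact: (hzn n).1.2|exact: hz.1.2]|].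
  move=> t _; have := sqr_ge0 `|vn n t + v t|; rewrite (norm2D ipH) (norm2B ipH); lra.
rewrite JD; [|by apply: integZ; exact: (hzn n).1.2|by apply: integZ; exact: hz.1.2].
by rewrite (JZ 2 (hzn n).1.2) (JZ 2 hz.1.2) lerD2r ler_pM2l.
Qed.

(** Young's inequality with weight: 2 (e', k) <= d |e'|^2 + |k|^2 / d. The weight [d] is fixed
    first, to make the bounded velocity term small; then |k|^2 <= s0 |k| leaves the rest to L^1
    convergence. *)
Lemma solutions_cvg_uniform : (fun n => J 0 T (fun t => `|gn n t - g t|)) @ \oo --> (0 : R) ->
  forall e : R, 0 < e -> \forall n \near \oo, forall t, 0 <= t <= T -> `|zn n t - z t| <= e.
Proof.
move=> g0 e e0.
have [CQ CQ0 QC] := Q_bounded; have [s0 s00 ks] := k_bounded.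
have [M M0 vM] := velocity_diff_bounded.
pose eps := gQ * e ^+ 2.
have eps0 : 0 < eps by rewrite mulr_gt0// exprn_gt0.
pose d := eps / 3 / (M + 1).
have d0 : 0 < d by rewrite !divr_gt0// ltr_wpDl.
have dM : d * M <= eps / 3.
  by rewrite /d mulrAC ler_pdivrMr ?ltr_wpDl// ler_wpM2l//; [rewrite divr_ge0// ltW|lra].
have r10 : 0 < Num.min 1 (eps / 3 / (CQ + 1)).
  by rewrite lt_min ltr01 !divr_gt0// ltr_wpDl.
have r20 : 0 < eps / 3 * d / (s0 + 1).
  by apply: divr_gt0; [rewrite mulr_gt0// divr_gt0|exact: ltr_wpDl].
have [N1 _ HN1] := (cvgrPdist_le _ _).1 zn0 _ r10.
have [N2 _ HN2] := (cvgrPdist_le _ _).1 g0 _ r20.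
exists (maxn N1 N2) => // n; rewrite /= geq_max => /andP[/HN1 /= k1 /HN2 /= k2] t tI.
rewrite !sub0r !normrN normr_id in k1 k2.
rewrite ger0_norm in k2; last by apply: J_ge0.
have /andP[t0 tT] := tI.
have Lk := h1_L2 T0 ipH xs_dense (hk n).
have key := energy QC (he n) Lk (mono_diff n) tI.
have j1 : 2 * J 0 t (fun r => ip (vn n r - v r) (gn n r - g r)) <=
    d * M + d^-1 * (s0 * J 0 T (fun r => `|gn n r - g r|)).
  have i1 := L2_ip ipH xs_dense (he n).1 Lk.
  have i2 := (he n).1.2; have i3 := L2_norm ipH xs_dense Lk.
  rewrite -(JZ 2 (integ_sub (lexx 0) tT i1)).
  have i4 : integ 0 T (fun r => d * `|vn n r - v r| ^+ 2 + d^-1 * (s0 * `|gn n r - g r|)).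
    by apply: integD; apply: integZ => //; exact: integZ.
  apply: le_trans (_ : J 0 t (fun r => d * `|vn n r - v r| ^+ 2 + d^-1 * (s0 * `|gn n r - g r|)) <= _).
    apply: J_le; [by apply: integZ; exact: integ_sub i1|exact: integ_sub i4|].
    move=> r /andP[r0 rt]; have rI : 0 <= r <= T by rewrite r0 (le_trans rt).
    have := ip_le ipH (vn n r - v r) (gn n r - g r).
    set a := `|vn n r - v r|; set b := `|gn n r - g r| => h.
    have b1 : b ^+ 2 <= s0 * b by rewrite expr2 ler_wpM2r ?normr_ge0// ks.
    have di : 0 <= d^-1 by rewrite invr_ge0 ltW.
    have b2 : d^-1 * b ^+ 2 <= d^-1 * (s0 * b) by rewrite ler_wpM2l.
    have b3 : 2 * (a * b) <= d * a ^+ 2 + d^-1 * b ^+ 2.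
      rewrite -(ler_pM2l d0) mulrDr mulrA mulVKf ?gt_eqF//.
      by have := sqr_ge0 (d * a - b); lra.
    lra.
  apply: le_trans (J_mono i4 _ (lexx 0) t0 tT) _.
    move=> r _; rewrite addr_ge0// mulr_ge0 ?(ltW d0) ?sqr_ge0//.
      by rewrite invr_ge0 ltW.
    by rewrite mulr_ge0.
  rewrite JD; [|exact: integZ|by apply: integZ; exact: integZ].
  rewrite (JZ d i2) (JZ d^-1 (integZ s0 i3)) (JZ s0 i3).
  by rewrite lerD2r ler_pM2l//; exact: (vM n).1.
have j2 : d^-1 * (s0 * J 0 T (fun r => `|gn n r - g r|)) <= eps / 3.
  rewrite ler_pdivrMl// [d * _]mulrC.
  have : s0 * J 0 T (fun r => `|gn n r - g r|) <= s0 * (eps / 3 * d / (s0 + 1)) by rewrite ler_wpM2l.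
  move=> h; apply: le_trans h _; rewrite mulrCA ler_piMr//.
    by rewrite mulr_ge0 ?(ltW d0)// divr_ge0// ltW.
  by rewrite ler_pdivrMr ?ltr_wpDl// mul1r; lra.
have j3 : CQ * `|zn n 0 - z 0| ^+ 2 <= eps / 3.
  have u1 : `|zn n 0 - z 0| <= 1 by apply: le_trans k1 _; rewrite ge_min lexx.
  have u2 : `|zn n 0 - z 0| <= eps / 3 / (CQ + 1) by apply: le_trans k1 _; rewrite ge_min lexx orbT.
  have u3 : `|zn n 0 - z 0| ^+ 2 <= eps / 3 / (CQ + 1) by rewrite expr2 -[leRHS]mul1r ler_pM.
  apply: le_trans (ler_wpM2l CQ0 u3) _; rewrite mulrCA ler_piMr//.
    by rewrite divr_ge0// ltW.
  by rewrite ler_pdivrMr ?ltr_wpDl// mul1r; lra.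
have : gQ * `|zn n t - z t| ^+ 2 <= gQ * e ^+ 2 by rewrite -/eps; lra.
by rewrite ler_pM2l// ler_sqr ?nnegrE// ltW.
Qed.

Lemma sup_cvg_of_h1 : (fun n => J 0 T (fun t => `|gn n t - g t| ^+ 2)) @ \oo --> (0 : R) ->
  (fun n => J 0 T (fun t => `|gn' n t - g' t| ^+ 2)) @ \oo --> (0 : R) ->
  forall t, 0 <= t <= T -> gn ^~ t @ \oo --> g t.
Proof.
move=> c1 c2 t tI; apply/cvgrPdist_le => e e0.
have c3 : (fun n => 2 / T * J 0 T (fun t => `|gn n t - g t| ^+ 2) +
    2 * T * J 0 T (fun t => `|gn' n t - g' t| ^+ 2)) @ \oo --> (0 : R).
  have E : (0 : R) = 2 / T * 0 + 2 * T * 0 by rewrite !mulr0 addr0.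
  by rewrite [X in _ --> X]E; apply: cvgD; apply: cvgMr.
have e2 : 0 < e ^+ 2 by rewrite exprn_gt0.
have [N _ HN] := (cvgrPdist_le _ _).1 c3 _ e2; exists N => // n /HN /=.
rewrite sub0r normrN => h; have := le_trans (ler_norm _) h => {}h.
have := le_trans (sobolev (hk n) tI) h.
by rewrite distrC ler_sqr ?nnegrE// ltW.
Qed.

End Sequences.

(** * Subdifferentials: chain rule and strong convergence *)

Variable phi : H -> \bar R.
Hypothesis phi_A : is_subdiff ip phi A.

Lemma phi_fin (x u : H) : A x u -> phi x = (fine (phi x))%:E.
Proof. by move=> /(phi_A x u).1[f _]; rewrite fineK. Qed.

Lemma phi_ineq (x u y q : H) : A x u -> A y q -> fine (phi x) + ip u (y - x) <= fine (phi y).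
Proof.
move=> Ax Ay; have [f /(_ y)] := (phi_A x u).1 Ax.
by rewrite (phi_fin Ax) (phi_fin Ay) /= lee_fin.
Qed.

(* The subgradient inequality pins the derivative of [phi o w] from both sides;
   the bounded selection makes [phi o w] absolutely continuous. *)
Lemma phi_chain (C : R) w w' v : h1 w w' -> L2 v -> in_A w v -> 0 <= C ->
  (forall t, 0 <= t <= T -> exists2 q, A (w t) q & `|q| <= C) ->
  fine (phi (w T)) - fine (phi (w 0)) = J 0 T (fun t => ip (v t) (w' t)).
Proof.
move=> hw Lv wA C0 sel.
pose p t := fine (phi (w t)).
have plip s t : 0 <= s <= T -> 0 <= t <= T -> p s - p t <= C * `|w s - w t|.
  move=> sI tI; have [q Aq qC] := sel s sI; have [q' Aq' _] := sel t tI.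
  have := phi_ineq Aq Aq'; rewrite -/(p s) -/(p t) => h.
  have : - ip q (w t - w s) <= C * `|w s - w t|.
    rewrite -(ipNr ipH) opprB; apply: le_trans (ip_le ipH _ _) _; exact: ler_wpM2r.
  lra.
apply: (@ac_ftc R T p (fun t => C * `|w' t|)) => //.
- by apply: integZ; exact: (L2_norm ipH xs_dense hw.1).
- exact: (L2_ip ipH xs_dense Lv hw.1).
- by move=> t _; rewrite mulr_ge0.
- move=> s t s0 st tT; rewrite JZ; last exact: integ_sub (L2_norm ipH xs_dense hw.1).
  have sI : 0 <= s <= T by rewrite s0 (le_trans st).
  have tI : 0 <= t <= T by rewrite tT (le_trans s0).
  have l1 := plip s t sI tI; have l2 := plip t s tI sI; rewrite distrC in l1.
  have l3 : C * `|w t - w s| <= C * J s t (fun r => `|w' r|).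
    by rewrite ler_wpM2l//; exact: (h1_lip ipH xs_dense hw).
  rewrite ler_norml; apply/andP; split; lra.
have good := near_good_ae Lv wA.
apply: aeS (aeI (aeI good wA) (h1_dif_ae T0 ipH xs_dense hw)) => t [[Gd Av] D] tI e e0.
have {}Gd := Gd tI; have {}Av := Av tI; have [{}D _] := D tI.
have tI' : 0 <= t <= T by case/andP: tI => a b; rewrite !ltW.
set d := ip (v t) (w' t).
(* The sum of the coefficients of n |s - t| in the upper estimate below, plus 1 for positivity. *)
pose c := C * (`|w' t| + 2) + (`|w' t| + 1) + `|v t| + `|d| + 1.
have Cw : 0 <= C * (`|w' t| + 2) by rewrite mulr_ge0// addr_ge0.
have c0 : 0 < c.
  by have := normr_ge0 (w' t); have := normr_ge0 (v t); have := normr_ge0 d; rewrite /c; lra.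
pose n := Num.min 1 (e / c).
have n0 : 0 < n by rewrite lt_min ltr01 divr_gt0.
have n1 : n <= 1 by rewrite ge_min lexx.
have nc : n * c <= e by rewrite -ler_pdivlMr// ge_min lexx orbT.
have [r1 r10 K1] := D n n0; have [r2 r20 K2] := Gd n n0 n1.
exists (Num.min r1 r2); first by rewrite lt_min r10.
move=> s sI; rewrite lt_min => /andP[s1 s2].
have [->|sNt] := eqVneq s t; first by rewrite !subrr mul0r subrr normr0 mulr0.
have [s' As' [s'I s't ss' vs']] := K2 s sI s2 sNt.
have b1 := K1 s sI s1; have b2 := K1 s' s'I (le_lt_trans s't s1).
set D1 := w s - w t - (s - t) *: w' t in b1.
set D2 := w s' - w t - (s' - t) *: w' t in b2.
have E1 : w s - w t = D1 + (s - t) *: w' t by rewrite subrK.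
have E2 : w s' - w t = D2 + (s' - t) *: w' t by rewrite subrK.
set x := `|s - t| in s't ss' b1 b2 *.
have x0 : 0 <= x by rewrite normr_ge0.
have {}b2 : `|D2| <= n * x by apply: le_trans b2 _; rewrite ler_wpM2l// ltW.
have [q Aq _] := sel s sI.
(* Lower estimate: the subgradient [v t] at [w t], tested at [w s]. *)
have low := phi_ineq Av Aq; rewrite -/(p s) -/(p t) E1 (ipDr ipH) (ipZr ipH) -/d in low.
have l1 : - ip (v t) D1 <= `|v t| * (n * x).
  rewrite -(ipNr ipH); apply: le_trans (ip_le ipH _ _) _; rewrite normrN ler_wpM2l//.
(* Upper estimate: nothing relates [v s] to [v t], so the subgradient is taken at the good point
   [s'], where it is near [v t]. The estimate [plip] then passes from [s'] to [s]. *)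
have up := phi_ineq As' Av; rewrite -/(p s') -/(p t) in up.
have l2 := plip s s' sI s'I.
have E3 : w s - w s' = (D1 - D2) + (s - s') *: w' t.
  have -> : s - s' = (s - t) - (s' - t) by ring.
  rewrite scalerBl addrACA -E1 -opprD -E2 opprB addrA subrK.
  by [].
have l3 : `|w s - w s'| <= n * x * (`|w' t| + 2).
  rewrite E3; apply: le_trans (ler_normD _ _) _; rewrite normrZ.
  have : `|s - s'| * `|w' t| <= n * x * `|w' t| by rewrite ler_wpM2r.
  have := ler_normB D1 D2; lra.
have l4 : C * `|w s - w s'| <= C * (n * x * (`|w' t| + 2)) by rewrite ler_wpM2l.
have E4 : - ip (v s') (w t - w s') = ip (v s' - v t) (w s' - w t) + ip (v t) D2 + (s' - t) * d.
  rewrite -(ipNr ipH) opprB (ipBl ipH) -addrA -(ipZr ipH) -(ipDr ipH) -E2.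
  by rewrite subrK.
have l5 : ip (v s' - v t) (w s' - w t) <= n * (x * (`|w' t| + 1)).
  apply: le_trans (ip_le ipH _ _) _; apply: ler_pM => //.
  rewrite E2; apply: le_trans (ler_normD _ _) _; rewrite normrZ.
  have : `|s' - t| * `|w' t| <= x * `|w' t| by rewrite ler_wpM2r.
  have : n * x <= x by rewrite ler_piMl.
  lra.
have l6 : ip (v t) D2 <= `|v t| * (n * x).
  by apply: le_trans (ip_le ipH _ _) _; rewrite ler_wpM2l.
have l7 : (s' - t) * d <= (s - t) * d + n * x * `|d|.
  have : - ((s - s') * d) <= `|s - s'| * `|d| by rewrite -normrM -mulNr; apply: le_trans (ler_norm _) _; rewrite mulNr normrN.
  have : `|s - s'| * `|d| <= n * x * `|d| by rewrite ler_wpM2r.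
  lra.
have ncx : n * c * x <= e * x by rewrite ler_wpM2r.
have p1 : 0 <= n * x * `|w' t| by rewrite !mulr_ge0 ?(ltW n0).
have p2 : 0 <= n * x * `|v t| by rewrite !mulr_ge0 ?(ltW n0).
have p3 : 0 <= n * x * `|d| by rewrite !mulr_ge0 ?(ltW n0).
have p4 : 0 <= n * x by rewrite !mulr_ge0 ?(ltW n0).
have p5 : 0 <= n * x * (C * (`|w' t| + 2)) by rewrite !mulr_ge0 ?(ltW n0)// addr_ge0.
rewrite /c in ncx.
rewrite ler_norml; apply/andP; split; rewrite -/(p s) -/(p t);
  clear -low up l1 l2 l4 E4 l5 l6 l7 ncx p1 p2 p3 p4 p5; lra.
Qed.

Hypothesis phi_lsc : lsc_fun phi.

Lemma fine_lsc (wn : nat -> H) (w : H) : wn @ \oo --> w ->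
  domain A w -> (forall n, domain A (wn n)) ->
  forall e : R, 0 < e -> \forall n \near \oo, fine (phi w) - fine (phi (wn n)) <= e.
Proof.
move=> cw [u Au] dA e e0.
(* The complement of this closed sublevel set is a neighbourhood of [w]. *)
have op : open (~` [set x | (phi x <= (fine (phi w) - e)%:E)%E]) by apply: closed_openC; exact: phi_lsc.
have : nbhs w (~` [set x | (phi x <= (fine (phi w) - e)%:E)%E]).
  apply: open_nbhs_nbhs; split => //=; rewrite (phi_fin Au) lee_fin => /=.
  by move=> h; have := le_trans h (_ : _ <= fine (phi w)); lra.
move=> /cw[N _ HN]; exists N => // n /HN /= /negP.
have [q Aq] := dA n; rewrite (phi_fin Aq) lee_fin -ltNge; lra.
Qed.

Section StrongConvergence.
Variables (g g' z v : R -> H) (gn gn' zn vn : nat -> R -> H) (K : R).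
Hypothesis hg : h1 g g'.
Hypothesis hgn : forall n, h1 (gn n) (gn' n).
Hypothesis hz : h1 z v.
Hypothesis hzn : forall n, h1 (zn n) (vn n).
Hypothesis zA : in_A (fun t => g t - Q (z t)) v.
Hypothesis znA : forall n, in_A (fun t => gn n t - Q (zn n t)) (vn n).
Hypothesis zn0 : (fun n => `|zn n 0 - z 0|) @ \oo --> (0 : R).
Hypothesis gnK : forall n, J 0 T (fun t => `|gn n t - g t| ^+ 2) +
  J 0 T (fun t => `|gn' n t - g' t| ^+ 2) <= K.
Hypothesis g_cvg : (fun n => J 0 T (fun t => `|gn n t - g t| ^+ 2)) @ \oo --> (0 : R).
Hypothesis g'_cvg : (fun n => J 0 T (fun t => `|gn' n t - g' t| ^+ 2)) @ \oo --> (0 : R).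
Hypothesis zn_cvg : forall e : R, 0 < e ->
  \forall n \near \oo, forall t, 0 <= t <= T -> `|zn n t - z t| <= e.
Hypothesis phi0 : (fun n => fine (phi (gn n 0 - Q (zn n 0)))) @ \oo -->
  fine (phi (g 0 - Q (z 0))).

Lemma strong_velocity_cvg :
  (fun n => J 0 T (fun t => `|vn n t - v t| ^+ 2)) @ \oo --> (0 : R).
Proof.
have [C C0 [sel seln]] := sections_bounded hg hgn hz hzn zA znA zn0 gnK.
have [M M0 vM] := velocity_diff_bounded hg hgn hz hzn zA znA zn0 gnK.
have hw := h1B ipH xs_dense hg (h1_Q hz).
have hwn n := h1B ipH xs_dense (hgn n) (h1_Q (hzn n)).
have he n := h1B ipH xs_dense (hzn n) hz.
have hk n := h1B ipH xs_dense (hgn n) hg.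
have ch := phi_chain hw hz.1 zA C0 sel.
have chn n := phi_chain (hwn n) (hzn n).1 (znA n) C0 (seln n).
have tI : 0 <= T <= T by rewrite lexx ltW.
pose pw t := fine (phi (g t - Q (z t))).
pose pwn n t := fine (phi (gn n t - Q (zn n t))).
have dvM n : J 0 T (fun t => `|vn n t - v t| ^+ 2) <= M := (vM n).1.
have weak y y' : h1 y y' -> (fun n => J 0 T (fun t => ip (vn n t - v t) (y' t))) @ \oo --> (0 : R).
  by move=> hy; apply: (h1_weak0 T0 ipH xs_dense he dvM zn_cvg hy).
have w1 := weak _ _ hg; have w2 := weak _ _ (h1_Q hz).
have lim3 : (fun n => J 0 T (fun t => ip (vn n t) (gn' n t - g' t))) @ \oo --> (0 : R).
  apply/cvgrPdist_le => e e0.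
  have e1 : 0 < e ^+ 2 / (M + 1) by rewrite divr_gt0 ?exprn_gt0// ltr_wpDl.
  have [N _ HN] := (cvgrPdist_le _ _).1 g'_cvg _ e1; exists N => // n /HN /=.
  rewrite !sub0r !normrN => h; have {}h := le_trans (ler_norm _) h.
  rewrite -[leRHS]ger0_norm ?(ltW e0)// -ler_sqr ?nnegrE// !real_normK ?num_real//.
  apply: le_trans (J_ip_cs T0 ipH xs_dense (hzn n).1 (hk n).1) _.
  apply: le_trans (ler_pM _ _ (vM n).2 h) _.
  - by apply: J_ge0 => t _; exact: sqr_ge0.
  - by apply: J_ge0 => t _; exact: sqr_ge0.
  by rewrite mulrCA ler_piMr ?sqr_ge0// ler_pdivrMr ?ltr_wpDl// mul1r; lra.
have wT : (fun n => gn n T - Q (zn n T)) @ \oo --> g T - Q (z T).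
  apply: cvgB; first exact: (sup_cvg_of_h1 hg hgn g_cvg g'_cvg tI).
  apply: continuous_cvg; first exact: Q_lin.2.
  apply/cvgrPdist_le => e e0; have [N _ HN] := zn_cvg e0; exists N => // n /HN /=.
  by move=> /(_ T tI); rewrite distrC.
have dT : domain A (g T - Q (z T)) by exact: (domain_everywhere hw zA A_closed tI).
have dnT n : domain A (gn n T - Q (zn n T)) by exact: (domain_everywhere (hwn n) (znA n) A_closed tI).
have lsc := fine_lsc wT dT dnT.
(* Insert Q v = g' - w' and the same for [n]. The differences of [pw] and [pwn] stand for the
   integrals of (v, w') and (v_n, w_n') by the chain rule. *)
have ident n : J 0 T (fun t => ip (Q (vn n t - v t)) (vn n t - v t)) =
    J 0 T (fun t => ip (vn n t) (gn' n t - g' t)) + J 0 T (fun t => ip (vn n t - v t) (g' t)) +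
    (pw T - pwn n T) + (pwn n 0 - pw 0) - 2 * J 0 T (fun t => ip (vn n t - v t) (Q (v t))).
  have ii := L2_ip ipH xs_dense.
  have Lv := hz.1; have Lvn := (hzn n).1; have Lg := hg.1; have LQ := (h1_Q hz).1.
  have Le := (he n).1; have Lk := (hk n).1.
  have Lw := hw.1; have Lwn := (hwn n).1.
  have i1 := ii _ _ _ Lvn Lk; have i2 := ii _ _ _ Le Lg; have i3 := ii _ _ _ Lv Lw.
  have i4 := ii _ _ _ Lvn Lwn; have i5 := ii _ _ _ Le LQ.
  have -> (a b : R) : a + b + (pw T - pwn n T) + (pwn n 0 - pw 0) =
      a + b + ((pw T - pw 0) - (pwn n T - pwn n 0)) by ring.
  have -> : pw T - pw 0 = J 0 T (fun t => ip (v t) (g' t - Q (v t))) by exact: ch.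
  have -> : pwn n T - pwn n 0 = J 0 T (fun t => ip (vn n t) (gn' n t - Q (vn n t))) by exact: chn.
  rewrite -(JZ 2 i5) -(JB i3 i4) -(JD i1 i2) -(JD (integD i1 i2) (integB i3 i4)).
  rewrite -(JB (integD (integD i1 i2) (integB i3 i4)) (integZ 2 i5)).
  apply: J_ext => t _; rewrite QB !(ipBl ipH, ipBr ipH) !Q_sym.
  have -> : ip (v t) (Q (vn n t)) = ip (vn n t) (Q (v t)) by rewrite (ipC ipH) Q_sym.
  by ring.
apply/cvgrPdist_le => e e0.
(* The identity has five error terms, the last with weight 2: six shares in all. *)
have e1 : 0 < gQ * e / 6 by rewrite divr_gt0// mulr_gt0.
have [N1 _ H1] := (cvgrPdist_le _ _).1 lim3 _ e1.
have [N2 _ H2] := (cvgrPdist_le _ _).1 w1 _ e1.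
have [N3 _ H3] := lsc _ e1.
have [N4 _ H4] := (cvgrPdist_le _ _).1 phi0 _ e1.
have [N5 _ H5] := (cvgrPdist_le _ _).1 w2 _ e1.
exists (N1 + N2 + N3 + N4 + N5)%N => // n /= Nn.
have le1 : (N1 <= n)%N by apply: leq_trans Nn; rewrite -!addnA leq_addr.
have le2 : (N2 <= n)%N by apply: leq_trans Nn; rewrite -!addnA addnCA leq_addr.
have le3 : (N3 <= n)%N.
  by apply: leq_trans Nn; apply: leq_trans (leq_addr N5 _); apply: leq_trans (leq_addl _ _) (leq_addr N4 _).
have le4 : (N4 <= n)%N by apply: leq_trans Nn; rewrite addnAC leq_addl.
have le5 : (N5 <= n)%N by apply: leq_trans Nn; rewrite leq_addl.
have := H1 n le1; have := H2 n le2; have := H3 n le3; have := H4 n le4; have := H5 n le5.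
rewrite /= !sub0r !normrN => a5 a4 a3 a2 a1.
rewrite ger0_norm; last by apply: J_ge0 => t _; exact: sqr_ge0.
rewrite -(ler_pM2l gQ0).
have i1 := (he n).1.2.
rewrite -(JZ gQ i1).
apply: le_trans (_ : J 0 T (fun t => ip (Q (vn n t - v t)) (vn n t - v t)) <= _).
  apply: J_le; [exact: integZ|exact: (L2_ip ipH xs_dense (h1_Q (he n)).1 (he n).1)|].
  by move=> t _; exact: Q_coer.
rewrite ident.
have b1 := ler_norm (J 0 T (fun t => ip (vn n t) (gn' n t - g' t))).
have b2 := ler_norm (J 0 T (fun t => ip (vn n t - v t) (g' t))).
have b4 := ler_norm (pwn n 0 - pw 0); rewrite distrC in b4.
have b5 := ler_norm (- J 0 T (fun t => ip (vn n t - v t) (Q (v t)))); rewrite normrN in b5.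
rewrite /pw /pwn in b4 *; rewrite /= in a5.
have {}b1 := le_trans b1 a1; have {}b2 := le_trans b2 a2.
have {}b4 := le_trans b4 a4; have {}b5 := le_trans b5 a5.
set X1 := J 0 T _ in b1 *; set X2 := J 0 T _ in b2 *; set X5 := J 0 T _ in b5 *.
lra.
Qed.

End StrongConvergence.

End EvolutionEstimates.

(** * Composition with a bounded linear operator *)

Section Composition.
Variables (R : realType) (T : R) (X H : normedModType R) (L : X -> H).
Hypothesis L_lin : linear_cont L.

Lemma linear_cont_sub (x y : X) : L (x - y) = L x - L y.
Proof. by rewrite addrC -scaleN1r L_lin.1 scaleN1r addrC. Qed.

Lemma H1_comp u v : H1_with_deriv T u v -> H1_with_deriv T (L \o u) (L \o v).
Proof.
move=> [sv [su [Lu [Lv E]]]]; have [C C0 LC] := linear_cont_bounded L_lin.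
have fin (f : R -> X) : strongly_meas T f -> (Lp_int T 2 f < +oo)%E ->
    (Lp_int T 2 (L \o f) < +oo)%E.
  move=> sf Lf; apply: le_lt_trans (strongly_meas_le 2 C0 L_lin.2 LC sf) _.
  by rewrite lte_mul_pinfty// ?lee_fin ?exprn_ge0.
split; first exact: strongly_meas_comp L_lin.2 sv.
split; first exact: strongly_meas_comp L_lin.2 su.
split; first exact: fin.
split; first exact: fin.
move=> f [fl fc] s t sI tI st; apply: (E (f \o L)) => //; split.
  by move=> a x y /=; rewrite L_lin.1 fl.
by move=> x; apply: continuous_comp; [exact: L_lin.2|exact: fc].
Qed.

Lemma inH1_comp u : inH1 T u -> inH1 T (L \o u).
Proof. by move=> [v Hu]; exists (L \o v); exact: H1_comp. Qed.

(** Pulling functionals back along [L] transports weak convergence of the loads from [X] to [H]. *)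
Lemma H1_dual_comp F : H1_dual T F -> H1_dual T (fun u => F (L \o u)).
Proof.
move=> [Fl [D FD]]; have [C C0 LC] := linear_cont_bounded L_lin; split.
  move=> a u w Hu Hw; rewrite -Fl; [|exact: inH1_comp|exact: inH1_comp].
  by congr F; apply/funext => t /=; rewrite L_lin.1.
exists (`|D| * C) => u v Huv.
apply: le_trans (FD _ _ (H1_comp Huv)) _.
apply: le_trans (ler_wpM2r (sqrtr_ge0 _) (ler_norm D)) _.
rewrite -mulrA ler_wpM2l//.
rewrite -[X in X * _](ger0_norm C0) -sqrtr_sqr -sqrtrM ?sqr_ge0//; apply: ler_wsqrtr.
have [sv [su [Lu [Lv _]]]] := Huv; have [_ [_ [Lu' [Lv' _]]]] := H1_comp Huv.
have fn (W : normedModType R) (f : R -> W) : (Lp_int T 2 f < +oo)%E -> Lp_int T 2 f \is a fin_num.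
  by rewrite ge0_fin_numE ?Lp_int_ge0.
have le f : strongly_meas T f -> (Lp_int T 2 f < +oo)%E -> (Lp_int T 2 (L \o f) < +oo)%E ->
    fine (Lp_int T 2 (L \o f)) <= C ^+ 2 * fine (Lp_int T 2 f).
  move=> sf /fn f1 /fn f2; rewrite -lee_fin EFinM !fineK//.
  exact: (strongly_meas_le 2 C0 L_lin.2 LC sf).
have nE (W : normedModType R) (f g : R -> W) : (Lp_int T 2 f < +oo)%E -> (Lp_int T 2 g < +oo)%E ->
    H1_normsq T f g = fine (Lp_int T 2 f) + fine (Lp_int T 2 g).
  by move=> /fn f1 /fn g1; exact: fineD.
rewrite (nE _ _ _ Lu' Lv') (nE _ _ _ Lu Lv) mulrDr.
by apply: lerD; [exact: le su Lu Lu'|exact: le sv Lv Lv'].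
Qed.

Lemma H1_weak_cvg_comp u w : H1_weak_cvg T u w ->
  H1_weak_cvg T (fun n => L \o u n) (L \o w).
Proof. by move=> uw F /H1_dual_comp /uw. Qed.

Lemma Lp_comp_cvg p (f : nat -> R -> X) : (forall n, strongly_meas T (f n)) ->
  (fun n => Lp_int T p (f n)) @ \oo --> (0 : \bar R) ->
  (fun n => Lp_int T p (L \o f n)) @ \oo --> (0 : \bar R).
Proof.
move=> sf f0; have [C C0 LC] := linear_cont_bounded L_lin.
apply: (@squeeze_cvge _ _ _ _ (cst 0%E) _ (fun n => (C ^+ p)%:E * Lp_int T p (f n))%E).
- by apply: nearW => n; rewrite Lp_int_ge0; exact: (strongly_meas_le p C0 L_lin.2 LC (sf n)).
- exact: cvg_cst.
- by rewrite -[X in _ --> X](mule0 (C ^+ p)%:E); exact: cvgeZl.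
Qed.

End Composition.

Lemma strongly_meas_sub (R : realType) (V : normedModType R) (T : R) (f g : R -> V) :
  strongly_meas T f -> strongly_meas T g -> strongly_meas T (fun t => f t - g t).
Proof.
move=> sf sg; rewrite (_ : (fun t => _) = (fun t => -1 *: g t + f t)).
  exact: strongly_meas_lin.
by apply/funext => t; rewrite scaleN1r addrC.
Qed.

Lemma sum_cvg0 (R : realType) (a b : nat -> \bar R) :
  (forall n, 0 <= a n)%E -> (forall n, 0 <= b n)%E ->
  (fun n => a n + b n)%E @ \oo --> (0 : \bar R) ->
  a @ \oo --> (0 : \bar R) /\ b @ \oo --> (0 : \bar R).
Proof.
move=> a0 b0 ab; split.
  apply: (squeeze_cvge _ (cvg_cst 0%E) ab); apply: nearW => n.
  by rewrite a0 leeDl.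
apply: (squeeze_cvge _ (cvg_cst 0%E) ab); apply: nearW => n.
by rewrite b0 leeDr.
Qed.

(** * From the stated hypotheses to measurable representatives *)

Section StateEquation.
Variables (R : realType) (T : R) (H : completeNormedModType R) (ip : H -> H -> R).
Hypothesis T0 : 0 < T.
Hypothesis ipH : inner_product ip.
Variable xs : nat -> H.
Hypothesis xs_dense : forall (x : H) (e : R), 0 < e -> exists k, `|x - xs k| < e.
Notation h1 := (h1 T ip).
Notation L2 := (L2 T ip).

Lemma J_sqr_sub_le (u v : R -> H) : L2 u -> L2 v -> L2 (fun t => u t - v t) ->
  J 0 T (fun t => `|u t - v t| ^+ 2) <=
  2 * J 0 T (fun t => `|u t| ^+ 2) + 2 * J 0 T (fun t => `|v t| ^+ 2).
Proof.
move=> [_ i1] [_ i2] [_ i3].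
rewrite -(JZ 2 i1) -(JZ 2 i2) -JD; [|exact: integZ|exact: integZ].
apply: J_le => //; first by apply: integD; exact: integZ.
move=> t _; have := sqr_ge0 `|u t + v t|; rewrite (norm2D ipH) (norm2B ipH); lra.
Qed.

(** The single place where weak convergence of the loads enters, through the uniform boundedness
    principle. *)
Lemma weak_cvg_difference_bounded (g g' : R -> H) (gn gn' : nat -> R -> H) :
  (forall n, inH1 T (gn n)) -> (forall n, h1 (gn n) (gn' n)) -> h1 g g' ->
  H1_weak_cvg T gn g -> exists K, forall n,
  J 0 T (fun t => `|gn n t - g t| ^+ 2) + J 0 T (fun t => `|gn' n t - g' t| ^+ 2) <= K.
Proof.
move=> Pgn hgn hg /(weak_cvg_bounded T0 ipH xs_dense Pgn)[M BM].
exists (2 * M + 2 * (J 0 T (fun t => `|g t| ^+ 2) + J 0 T (fun t => `|g' t| ^+ 2))) => n.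
have := BM n; rewrite (B_h1 T0 ipH xs_dense (Pgn n) (hgn n)).
have hk := h1B ipH xs_dense (hgn n) hg.
have L2_of (y y' : R -> H) : h1 y y' -> L2 y by move=> hy; exact: (h1_L2 T0 ipH xs_dense hy).
have := J_sqr_sub_le (L2_of _ _ (hgn n)) (L2_of _ _ hg) (L2_of _ _ hk).
have := J_sqr_sub_le (hgn n).1 hg.1 hk.1.
lra.
Qed.

Lemma Lp_int1_h1 (z v : R -> H) : h1 z v ->
  Lp_int T 1 z = (J 0 T (fun t => `|z t|))%:E.
Proof. by move=> /(h1_L2 T0 ipH xs_dense) /(L2_norm ipH xs_dense) /J_EFin <-. Qed.

Lemma H1_Lp_sub (y u z v u' v' : R -> H) : H1_with_deriv T y u -> H1_with_deriv T z v ->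
  h1 y u' -> h1 z v' ->
  Lp_int T 2 (fun t => u t - v t) = (J 0 T (fun t => `|u' t - v' t| ^+ 2))%:E /\
  Lp_int T 2 (fun t => y t - z t) = (J 0 T (fun t => `|y t - z t| ^+ 2))%:E.
Proof.
move=> Hy Hz hy hz.
exact: (H1_Lp T0 ipH xs_dense (H1_sub T0 ipH xs_dense Hy Hz) (h1B ipH xs_dense hy hz)).
Qed.

Lemma J_sqr_cvg_of_uniform (zn : nat -> R -> H) (vn : nat -> R -> H) (z v : R -> H) :
  (forall n, h1 (zn n) (vn n)) -> h1 z v ->
  (forall e : R, 0 < e -> \forall n \near \oo, forall t, 0 <= t <= T -> `|zn n t - z t| <= e) ->
  (fun n => J 0 T (fun t => `|zn n t - z t| ^+ 2)) @ \oo --> (0 : R).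
Proof.
move=> hzn hz zc; apply/cvgrPdist_le => e e0.
have d0 : 0 < Num.sqrt (e / T) by rewrite sqrtr_gt0 divr_gt0.
have [N _ HN] := zc _ d0; exists N => // n /HN /= zd.
have [_ i1] := h1_L2 T0 ipH xs_dense (h1B ipH xs_dense (hzn n) hz).
rewrite sub0r normrN ger0_norm; last by apply: J_ge0 => t _; exact: sqr_ge0.
apply: le_trans (_ : J 0 T (fun=> e / T) <= _).
  apply: J_le => //; first exact: integ_cst.
  move=> t tI; rewrite -[leRHS]sqr_sqrtr; last by rewrite ltW// divr_gt0.
  by rewrite ler_sqr ?nnegrE// ?zd// sqrtr_ge0.
by rewrite (J_cst _ (ltW T0)) subr0 divfK ?gt_eqF.
Qed.

Lemma solution_representative (X : normedModType R) (A : H -> set H) (L : X -> H) (Q : H -> H)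
    (l : R -> X) (z0 : H) (z : R -> H) : solves T A L Q l z0 z ->
  exists v v', [/\ H1_with_deriv T z v, h1 z v' & in_A T A (fun t => L (l t) - Q (z t)) v'].
Proof.
move=> [_ [v [Hz zA]]]; have [v' vv' hz] := H1_h1 ipH Hz.
exists v, v'; split => //.
apply: aeS (aeI zA vv') => t [a b] /andP[t0 tT].
rewrite -b; first by apply: a; rewrite /= in_itv/= t0 tT.
by rewrite /= in_itv/= !ltW.
Qed.

End StateEquation.

Theorem mainTheorem5 (R : realType) (T : R) (X : completeNormedModType R)
  (H : completeNormedModType R) (ip : H -> H -> R)
  (A : H -> set H) (Rop : X -> H) (Q : H -> H) (gammaQ : R)
  (z0 : H) (l : R -> X) (z : R -> H)
  (zn0 : nat -> H) (ln : nat -> R -> X) (zn : nat -> R -> H) :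
  0 < T ->
  inner_product ip -> separable_space H ->
  maximal_monotone ip A -> closed (domain A) -> min_section_bounded A ->
  linear_cont Rop ->
  linear_cont Q -> (forall x y, ip (Q x) y = ip x (Q y)) ->
  0 < gammaQ -> (forall h, gammaQ * `|h| ^+ 2 <= ip (Q h) h) ->
  admissible T Rop Q (domain A) z0 l -> solves T A Rop Q l z0 z ->
  (forall n, admissible T Rop Q (domain A) (zn0 n) (ln n)) ->
  zn0 @ \oo --> z0 ->
  H1_weak_cvg T ln l -> L1_cvg T ln l ->
  (forall n, solves T A Rop Q (ln n) (zn0 n) (zn n)) ->
  (H1_weak_cvg T zn z /\ C_cvg T zn z) /\
  (forall phi : H -> \bar R,
     H1_strong_cvg T ln l ->
     proper_fun phi -> convex_fun phi -> lsc_fun phi -> is_subdiff ip phi A ->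
     (fun n => phi (Rop (ln n 0) - Q (zn0 n))) @ \oo --> phi (Rop (l 0) - Q z0) ->
     H1_strong_cvg T zn z).
Proof.
move=> T0 ipH [xs xs_dense_cl] [A_mon _] A_closed A_sec L_lin Q_lin Q_sym gQ0 Q_coer.
move=> [[l' Hl] d0] Sz ladm zn0_cvg ln_weak ln_L1 Szn.
have xs_dense (x : H) (e : R) : 0 < e -> exists k, `|x - xs k| < e.
  move=> e0; have : closure (range xs) x by rewrite xs_dense_cl.
  move=> /(_ _ (nbhsx_ballx x e e0))[_ [[k _ <-] xk]].
  by exists k; move: xk; rewrite -ball_normE.
have [v [v' [Hz hz zA]]] := solution_representative ipH Sz.
have Hl_n n := (ladm n).1.
have [ln' Hln] := choice Hl_n.
have [vn Hvn] := choice (fun n => solution_representative ipH (Szn n)).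
have [vn' Hvn'] := choice Hvn.
have Hzn n : H1_with_deriv T (zn n) (vn n) by have [] := Hvn' n.
have hzn n : h1 T ip (zn n) (vn' n) by have [] := Hvn' n.
have znA n : in_A T A (fun t => (Rop \o ln n) t - Q (zn n t)) (vn' n) by have [] := Hvn' n.
have Hg := H1_comp L_lin Hl.
have Hgn n := H1_comp L_lin (Hln n).
have [g' _ hg] := H1_h1 ipH Hg.
have hgn_ex n : exists k, h1 T ip (Rop \o ln n) k by have [k _ hk] := H1_h1 ipH (Hgn n); exists k.
have [gn' hgn] := choice hgn_ex.
have Pgn n : inH1 T (Rop \o ln n) by exists (Rop \o ln' n).
have Pzn n : inH1 T (zn n) by exists (vn n).
have Pz : inH1 T z by exists v.
have [K gnK] := weak_cvg_difference_bounded T0 ipH xs_dense Pgn hgn hg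
  (H1_weak_cvg_comp L_lin ln_weak).
have zn00 : (fun n => `|zn n 0 - z 0|) @ \oo --> (0 : R).
  rewrite Sz.1 (_ : (fun n => _) = (fun n => `|zn0 n - z0|)); last first.
    by apply/funext => n; rewrite (Szn n).1.
  by rewrite -[X in _ --> X](normr0 H) -(subrr z0); apply: cvg_norm; apply: cvgB => //; exact: cvg_cst.
have strong_sub (p : nat) (u : nat -> R -> X) (w : R -> X) : (forall n, strongly_meas T (u n)) ->
    strongly_meas T w -> (fun n => Lp_int T p (fun t => u n t - w t)) @ \oo --> (0 : \bar R) ->
    (fun n => Lp_int T p (fun t => Rop (u n t) - Rop (w t))) @ \oo --> (0 : \bar R).
  move=> su sw uw.
  have := Lp_comp_cvg L_lin (fun n => strongly_meas_sub (su n) sw) uw.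
  rewrite (_ : (fun n => Lp_int T p (Rop \o _)) =
    (fun n => Lp_int T p (fun t => Rop (u n t) - Rop (w t)))) //.
  by apply/funext => n; congr Lp_int; apply/funext => t; rewrite /= linear_cont_sub.
have g_L1 : (fun n => J 0 T (fun t => `|(Rop \o ln n) t - (Rop \o l) t|)) @ \oo --> (0 : R).
  have := strong_sub 1 _ _ (fun n => (Hln n).2.1) Hl.2.1 ln_L1.
  rewrite (_ : (fun n => Lp_int T 1 _) =
    (fun n => (J 0 T (fun t => `|(Rop \o ln n) t - (Rop \o l) t|))%:E)).
    by move=> /fine_cvg.
  apply/funext => n; exact: (Lp_int1_h1 T0 ipH xs_dense (h1B ipH xs_dense (hgn n) hg)).
have zn_unif := solutions_cvg_uniform T0 ipH xs_dense A_mon Q_lin Q_sym gQ0 Q_coer A_closed A_sec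
  hg hgn hz hzn zA znA zn00 gnK g_L1.
have [M M0 vM] := velocity_diff_bounded T0 ipH xs_dense A_mon Q_lin Q_sym gQ0 Q_coer A_closed A_sec
  hg hgn hz hzn zA znA zn00 gnK.
have he n := h1B ipH xs_dense (hzn n) hz.
split.
  split; last first.
    move=> e e0; have e2 : 0 < e / 2 by rewrite divr_gt0.
    have [N _ HN] := zn_unif _ e2; exists N => // n /HN /= h t; rewrite in_itv/= => /h.
    by move=> /le_lt_trans; apply; rewrite ltr_pdivrMr// ltr_pMr// ltr1n.
  have [E eE] := e_bounded T0 ipH xs_dense A_mon Q_lin Q_sym gQ0 Q_coer
    hg hgn hz hzn zA znA zn00 gnK.
  apply: (@weak_cvg_of_bounded R T H ip T0 ipH xs xs_dense zn z (E ^+ 2 * T + M)) => // n.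
  have Pe : inH1 T (zn n - z).
    by exists (fun t => vn n t - v t); exact: (H1_sub T0 ipH xs_dense (Hzn n) Hz).
  rewrite (B_h1 T0 ipH xs_dense Pe (he n)); apply: lerD; last exact: (vM n).1.
  have [_ i1] := h1_L2 T0 ipH xs_dense (he n).
  rewrite -[T in leRHS]subr0 -(J_cst _ (ltW T0)); apply: J_le => //; first exact: integ_cst.
  move=> t tI; rewrite ler_sqr ?nnegrE ?normr_ge0 ?eE//.
  by apply: le_trans (eE n t tI); exact: normr_ge0.
move=> phi [dln [dl [Hdln [Hdl sum_cvg]]]] _ _ phi_lsc phi_A phi0.
(* The derivatives [dln] and [dl] come with the strong convergence and may differ from the earlier
   ones on null sets; [H1_Lp_sub] compares them, after composition with [Rop], with [gn'] and
   [g']. *)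
have [c1 c2] := sum_cvg0 (fun n => Lp_int_ge0 T 2 _) (fun n => Lp_int_ge0 T 2 _) sum_cvg.
have HG := H1_comp L_lin Hdl; have HGn n := H1_comp L_lin (Hdln n).
have Hk n := H1_Lp_sub T0 ipH xs_dense (HGn n) HG (hgn n) hg.
have g_cvg : (fun n => J 0 T (fun t => `|(Rop \o ln n) t - (Rop \o l) t| ^+ 2)) @ \oo --> (0 : R).
  have := strong_sub 2 _ _ (fun n => (Hln n).2.1) Hl.2.1 c1.
  by under eq_fun do rewrite (Hk _).2; move=> /fine_cvg.
have g'_cvg : (fun n => J 0 T (fun t => `|gn' n t - g' t| ^+ 2)) @ \oo --> (0 : R).
  have := strong_sub 2 _ _ (fun n => (Hdln n).1) Hdl.1 c2.
  by under eq_fun do rewrite (Hk _).1; move=> /fine_cvg.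
have phi0' : (fun n => fine (phi (Rop (ln n 0) - Q (zn n 0)))) @ \oo -->
    fine (phi (Rop (l 0) - Q (z 0))).
  (* Admissibility puts the initial point in the domain of [A], so the limit is finite and
     convergence passes to real values. *)
  case: d0 => q /(phi_fin phi_A) phiE.
  have := phi0; rewrite Sz.1 phiE.
  under [in X in _ -> X]eq_fun do rewrite (Szn _).1.
  by move=> /fine_cvg.
have v_cvg := strong_velocity_cvg T0 ipH xs_dense A_mon Q_lin Q_sym gQ0 Q_coer A_closed A_sec
  phi_A phi_lsc hg hgn hz hzn zA znA zn00 gnK g_cvg g'_cvg zn_unif phi0'.
have z_cvg := J_sqr_cvg_of_uniform T0 ipH xs_dense hzn hz zn_unif.
(* The original derivatives are the witnesses; integrals are computed with the measurable
   representatives [vn'] and [v']. *)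
exists vn, v; split => //; split => //.
have E n := H1_Lp_sub T0 ipH xs_dense (Hzn n) Hz (hzn n) hz.
rewrite (_ : (fun n => adde _ _) = (fun n => (J 0 T (fun t => `|zn n t - z t| ^+ 2) +
    J 0 T (fun t => `|vn' n t - v' t| ^+ 2))%:E)).
  by apply: cvg_EFin; [exact: nearW|rewrite -[X in _ --> X](addr0 0); exact: (cvgD z_cvg v_cvg)].
by apply/funext => n; rewrite (E n).1 (E n).2.
Qed.
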